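(* Let $\mathcal{E}$ be a category with chosen pullbacks (chosen such that identities pull back to identities). For any bicategory $\mathscr{C}$, the functor $$(-)_{\otimes\Delta}\colon \mathbf{Greg}_{\otimes,\Delta}\left(\mathbf{Span}_{\mathrm{iso}}(\mathcal{E}),\mathscr{C}\right)\to\mathbf{LaxBeckPair}(\mathcal{E},\mathscr{C})$$ (which sends $F$ to its restrictions $F_\otimes,F_\Delta$ equipped with the Beck data ${}^F\mathfrak{b}$ described in the context) is an equivalence of categories $$\mathbf{Greg}_{\otimes,\Delta}\left(\mathbf{Span}_{\mathrm{iso}}(\mathcal{E}),\mathscr{C}\right)\simeq\mathbf{LaxBeckPair}(\mathcal{E},\mathscr{C}),$$ and it restricts to an equivalence $$\mathbf{Icon}\left(\mathbf{Span}_{\mathrm{iso}}(\mathcal{E}),\mathscr{C}\right)\simeq\mathbf{BeckPair}(\mathcal{E},\mathscr{C}).$$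
   Context: **Functors of bicategories.** Composition of 1-cells is written $g\cdot f$, or diagrammatically $f;g=g\cdot f$. An oplax functor $F\colon\mathscr{A}\to\mathscr{B}$ consists of an assignment on objects, functors $F_{X,Y}\colon\mathscr{A}_{X,Y}\to\mathscr{B}_{FX,FY}$ on hom-categories, and constraint 2-cells $\lambda_X\colon F1_X\to 1_{FX}$ and $\varphi_{g,f}\colon F(gf)\to Fg\cdot Ff$ (natural in $g,f$), subject to the usual associativity and unit axioms. It is normal if all $\lambda_X$ are invertible, and a pseudofunctor if all $\lambda_X$ and $\varphi_{g,f}$ are invertible. A gregarious functor is a normal oplax functor such that $\varphi_{g,f}$ is invertible for all $f\colon A\to B$, $g\colon B\to C$ for which $g$ has a right adjoint. An icon $\alpha\colon F\Rightarrow G$ between oplax functors $(F,\varphi,\lambda)$, $(G,\psi,\omega)$ which agree on objects is a family of natural transformations $F_{X,Y}\Rightarrow G_{X,Y}$ such that $\psi_{g,f}\circ\alpha_{gf}=(\alpha_g\ast\alpha_f)\circ\varphi_{g,f}$ and $\omega_X\circ\alpha_{1_X}=\lambda_X$. $\mathbf{Icon}(\mathscr{A},\mathscr{C})$ is the category of pseudofunctors $\mathscr{A}\to\mathscr{C}$ and icons. **Spans.** $\mathbf{Span}_{\mathrm{iso}}(\mathcal{E})$ is the bicategory whose objects are those of $\mathcal{E}$, whose 1-cells $X\to Y$ are spans $(s,t)$, i.e. diagrams $X\xleftarrow{s}T\xrightarrow{t}Y$, composed by chosen pullback, and whose 2-cells are the invertible morphisms of spans (isomorphisms between vertices commuting with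 the legs). The embeddings $(-)_\otimes\colon\mathcal{E}\to\mathbf{Span}_{\mathrm{iso}}(\mathcal{E})$ and $(-)_\Delta\colon\mathcal{E}^{\mathrm{op}}\to\mathbf{Span}_{\mathrm{iso}}(\mathcal{E})$ are the identity on objects and send $f\colon X\to Y$ to $(1_X,f)\colon X\to Y$ and $(f,1_X)\colon Y\to X$ respectively. $\mathbf{Greg}_{\otimes,\Delta}(\mathbf{Span}_{\mathrm{iso}}(\mathcal{E}),\mathscr{C})$ is the category whose objects are gregarious functors $F\colon\mathbf{Span}_{\mathrm{iso}}(\mathcal{E})\to\mathscr{C}$ whose restrictions $F_\otimes:=F\circ(-)_\otimes$ and $F_\Delta:=F\circ(-)_\Delta$ are pseudofunctors and for which every oplax constraint $F(s,t)\to F(s,1);F(1,t)$ is invertible; morphisms are icons. **Lax Beck pairs.** An object of $\mathbf{LaxBeckPair}(\mathcal{E},\mathscr{C})$ is a pair of pseudofunctors $F_\otimes\colon\mathcal{E}\to\mathscr{C}$, $F_\Delta\colon\mathcal{E}^{\mathrm{op}}\to\mathscr{C}$ agreeing on objects, with Beck data ${}^F\mathfrak{b}$: for each pullback square $gf'=fg'$ (with $f'$ the top, $g'$ the left, $g$ the right and $f$ the bottom map) a 2-cell $$\mathfrak{b}_{f,g}^{f',g'}\colon F_\otimes f'\cdot F_\Delta g'\to F_\Delta g\cdot F_\otimes f,$$ subject to the Beck–Chevalley coherence conditions: 1. (horizontal double pullback) for pullback squares $g'f_2'=f_2g''$ and $gf_1'=f_1g'$ pasted side by side, the composite $F_\otimes(f_1'f_2')F_\Delta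 g''\cong F_\otimes f_1'\,F_\otimes f_2'\,F_\Delta g''\to F_\otimes f_1'\,F_\Delta g'\,F_\otimes f_2\to F_\Delta g\,F_\otimes f_1\,F_\otimes f_2\cong F_\Delta g\,F_\otimes(f_1f_2)$ of the two Beck 2-cells and pseudofunctoriality constraints equals $\mathfrak{b}_{f_1f_2,g}^{f_1'f_2',g''}$; 2. (vertical double pullback) for pullback squares $g_2f''=f'g_2'$ and $g_1f'=fg_1'$ stacked vertically, the composite $F_\otimes f''F_\Delta(g_1'g_2')\cong F_\otimes f''F_\Delta g_2'F_\Delta g_1'\to F_\Delta g_2F_\otimes f'F_\Delta g_1'\to F_\Delta g_2F_\Delta g_1F_\otimes f\cong F_\Delta(g_1g_2)F_\otimes f$ equals $\mathfrak{b}_{f,g_1g_2}^{f'',g_1'g_2'}$; 3. (horizontal nullary) $F_\otimes f\cong F_\otimes f\,F_\Delta\mathrm{id}\xrightarrow{\mathfrak{b}_{f,\mathrm{id}}^{f,\mathrm{id}}}F_\Delta\mathrm{id}\,F_\otimes f\cong F_\otimes f$ is the identity; 4. (vertical nullary) $F_\Delta g\cong F_\otimes\mathrm{id}\,F_\Delta g\xrightarrow{\mathfrak{b}_{\mathrm{id},g}^{\mathrm{id},g}}F_\Delta g\,F_\otimes\mathrm{id}\cong F_\Delta g$ is the identity. A morphism $(F_\otimes,F_\Delta,{}^F\mathfrak{b})\to(G_\otimes,G_\Delta,{}^G\mathfrak{b})$ is a pair of icons $\alpha\colon F_\otimes\Rightarrow G_\otimes$, $\beta\colon F_\Delta\Rightarrow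 G_\Delta$ with ${}^G\mathfrak{b}_{f,g}^{f',g'}\circ(\alpha_{f'}\ast\beta_{g'})=(\beta_g\ast\alpha_f)\circ{}^F\mathfrak{b}_{f,g}^{f',g'}$ for every pullback square. $\mathbf{BeckPair}(\mathcal{E},\mathscr{C})$ is the (full) subcategory of those objects all of whose Beck 2-cells are invertible. **The functor $(-)_{\otimes\Delta}$.** It sends $F$ to $(F_\otimes,F_\Delta,{}^F\mathfrak{b})$, where for a pullback square $gf'=fg'$, with $(\widetilde g,\widetilde f)$ the span given by the chosen pullback of $f$ and $g$, ${}^F\mathfrak{b}_{f,g}^{f',g'}$ is the composite $$F(g',1);F(1,f')\to F(g',f')\to F(\widetilde g,\widetilde f)\to F(1,f);F(g,1)$$ of the inverse of an oplax constraint, $F$ of the induced isomorphism of pullbacks, and an oplax constraint. On morphisms it restricts an icon along $(-)_\otimes$ and $(-)_\Delta$. *)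

(* Defs.v *)
From Stdlib Require Import ssreflect FunctionalExtensionality ProofIrrelevance
  IndefiniteDescription.

Set Implicit Arguments.
Unset Strict Implicit.
Unset Printing Implicit Defensive.

(* Composition is written in diagrammatic order throughout. *)
Record Category := {
  cob :> Type;
  chom : cob -> cob -> Type;
  cid : forall X, chom X X;
  ccomp : forall X Y Z, chom X Y -> chom Y Z -> chom X Z;
  cidl : forall X Y (f : chom X Y), ccomp (cid X) f = f;
  cidr : forall X Y (f : chom X Y), ccomp f (cid Y) = f;
  cassoc : forall X Y Z W (f : chom X Y) (g : chom Y Z) (h : chom Z W),
    ccomp (ccomp f g) h = ccomp f (ccomp g h)
}.

Arguments chom : clear implicits.
Arguments cid {_} X.
Arguments ccomp {_ _ _ _} f g.

Notation "f >> g" := (ccomp f g) (at level 42, left associativity).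

Definition is_iso (E : Category) (X Y : E) (f : chom E X Y) : Prop :=
  exists g : chom E Y X, f >> g = cid X /\ g >> f = cid Y.

Definition Op (E : Category) : Category := {|
  cob := cob E;
  chom := fun X Y => chom E Y X;
  cid := fun X => cid X;
  ccomp := fun X Y Z f g => g >> f;
  cidl := fun X Y f => cidr f;
  cidr := fun X Y f => cidl f;
  cassoc := fun X Y Z W f g h => eq_sym (cassoc h g f)
|}.

Record Functor (A B : Category) := {
  fob :> A -> B;
  fhom : forall X Y, chom A X Y -> chom B (fob X) (fob Y);
  fhom_id : forall X, fhom (cid X) = cid (fob X);
  fhom_comp : forall X Y Z (f : chom A X Y) (g : chom A Y Z),
    fhom (f >> g) = fhom f >> fhom g
}.

Arguments fhom {_ _} _ {_ _} _.

Definition functor_id (A : Category) : Functor A A :=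
  {| fob := fun X => X; fhom := fun X Y f => f;
     fhom_id := fun X => eq_refl; fhom_comp := fun X Y Z f g => eq_refl |}.

Definition functor_comp (A B C : Category) (F : Functor A B) (G : Functor B C) :
  Functor A C.
Proof.
refine {| fob := fun X => G (F X); fhom := fun X Y f => fhom G (fhom F f) |}.
- abstract (by move=> X; rewrite !fhom_id).
- abstract (by move=> X Y Z f g; rewrite !fhom_comp).
Defined.

Definition nat_isomorphic (A B : Category) (F G : Functor A B) : Prop :=
  exists eta : forall X, chom B (F X) (G X),
    (forall X Y (f : chom A X Y), fhom F f >> eta Y = eta X >> fhom G f) /\
    (forall X, is_iso (eta X)).

Definition is_equivalence (A B : Category) (F : Functor A B) : Prop :=
  exists G : Functor B A,
    nat_isomorphic (functor_comp F G) (functor_id A) /\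
    nat_isomorphic (functor_comp G F) (functor_id B).

Definition FullSub (A : Category) (P : A -> Prop) : Category := {|
  cob := {X : A | P X};
  chom := fun X Y => chom A (proj1_sig X) (proj1_sig Y);
  cid := fun X => cid (proj1_sig X);
  ccomp := fun X Y Z f g => f >> g;
  cidl := fun X Y f => cidl f;
  cidr := fun X Y f => cidr f;
  cassoc := fun X Y Z W f g h => cassoc f g h
|}.

Definition full_incl (A : Category) (P Q : A -> Prop)
    (PQ : forall X, P X -> Q X) : Functor (FullSub P) (FullSub Q) :=
  {| fob := fun X : FullSub P =>
       exist Q (proj1_sig X) (PQ _ (proj2_sig X)) : FullSub Q;
     fhom := fun X Y f => f;
     fhom_id := fun X => eq_refl; fhom_comp := fun X Y Z f g => eq_refl |}.

Definition full_forget (A : Category) (P : A -> Prop) : Functor (FullSub P) A :=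
  {| fob := fun X : FullSub P => proj1_sig X; fhom := fun X Y f => f;
     fhom_id := fun X => eq_refl; fhom_comp := fun X Y Z f g => eq_refl |}.

Definition full_lift (A B : Category) (P : B -> Prop) (F : Functor A B)
    (FP : forall X, P (F X)) : Functor A (FullSub P) :=
  {| fob := fun X => exist P (F X) (FP X) : FullSub P;
     fhom := fun X Y f => fhom F f : chom (FullSub P) (exist P _ _) (exist P _ _);
     fhom_id := fun X => fhom_id F X;
     fhom_comp := fun X Y Z f g => fhom_comp F f g |}.

(* The disjoint union of the categories [D i], except that an equality [i = j]
   of indices is used to compare objects of [D i] and [D j].  It is applied with
   [i] ranging over functions on objects: icons only exist between functors that
   agree on objects, so their categories are obtained by this construction from
   the categories of functors with a fixed function on objects. *)
Definition total_comp (I : Type) (D : I -> Category) (i j k : I)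
    (x : D i) (y : D j) (z : D k) (e : i = j) (e' : j = k) :
  chom (D j) (eq_rect i D x j e) y -> chom (D k) (eq_rect j D y k e') z ->
  chom (D k) (eq_rect i D x k (eq_trans e e')) z :=
  match e' as e0 in _ = k0 return forall z : D k0,
    chom (D j) (eq_rect i D x j e) y -> chom (D k0) (eq_rect j D y k0 e0) z ->
    chom (D k0) (eq_rect i D x k0 (eq_trans e e0)) z
  with eq_refl => fun z a b => a >> b end z.

Definition TotalCat (I : Type) (D : I -> Category) : Category.
Proof.
refine {|
  cob := {i : I & D i};
  chom := fun x y => {e : projT1 x = projT1 y &
                        chom (D _) (eq_rect _ D (projT2 x) _ e) (projT2 y)};
  cid := fun x => existT _ eq_refl (cid (projT2 x));
  ccomp := fun x y z f g =>
    existT _ (eq_trans (projT1 f) (projT1 g)) (total_comp (projT2 f) (projT2 g))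
|}.
- abstract (move=> [i x] [j y] [/= e f]; destruct e; by rewrite /= cidl).
- abstract (move=> [i x] [j y] [/= e f]; destruct e; by rewrite /= cidr).
- abstract (move=> [i x] [j y] [k z] [l w] [/= e f] [/= e' g] [/= e'' h];
  destruct e, e', e''; by rewrite /= cassoc).
Defined.

Definition total_map (I : Type) (D D' : I -> Category)
    (F : forall i, Functor (D i) (D' i)) (i j : I) (x : D i) (y : D j) (e : i = j) :
  chom (D j) (eq_rect i D x j e) y ->
  chom (D' j) (eq_rect i D' (F i x) j e) (F j y) :=
  match e as e0 in _ = j0 return forall y : D j0,
    chom (D j0) (eq_rect i D x j0 e0) y ->
    chom (D' j0) (eq_rect i D' (F i x) j0 e0) (F j0 y)
  with eq_refl => fun y a => fhom (F i) a end y.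

Definition TotalFunctor (I : Type) (D D' : I -> Category)
    (F : forall i, Functor (D i) (D' i)) : Functor (TotalCat D) (TotalCat D').
Proof.
refine {|
  fob := fun x : TotalCat D => existT D' (projT1 x) (F _ (projT2 x)) : TotalCat D';
  fhom := fun x y f => existT _ (projT1 f) (total_map F (projT2 f))
|}.
- abstract (by move=> [i x] /=; rewrite fhom_id).
- abstract (move=> [i x] [j y] [k z] [/= e f] [/= e' g]; destruct e, e';
  by rewrite /= fhom_comp).
Defined.

Record Bicategory := {
  bob :> Type;
  hom1 : bob -> bob -> Type;
  hom2 : forall X Y, hom1 X Y -> hom1 X Y -> Type;
  id2 : forall X Y (f : hom1 X Y), hom2 f f;
  vcomp : forall X Y (f g h : hom1 X Y), hom2 f g -> hom2 g h -> hom2 f h;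
  vidl : forall X Y (f g : hom1 X Y) (a : hom2 f g), vcomp (id2 f) a = a;
  vidr : forall X Y (f g : hom1 X Y) (a : hom2 f g), vcomp a (id2 g) = a;
  vassoc : forall X Y (f g h k : hom1 X Y) (a : hom2 f g) (b : hom2 g h)
    (c : hom2 h k), vcomp (vcomp a b) c = vcomp a (vcomp b c);
  id1 : forall X, hom1 X X;
  comp1 : forall X Y Z, hom1 X Y -> hom1 Y Z -> hom1 X Z;
  hcomp : forall X Y Z (f f' : hom1 X Y) (g g' : hom1 Y Z),
    hom2 f f' -> hom2 g g' -> hom2 (comp1 f g) (comp1 f' g');
  hcomp_id : forall X Y Z (f : hom1 X Y) (g : hom1 Y Z),
    hcomp (id2 f) (id2 g) = id2 (comp1 f g);
  hcomp_vcomp : forall X Y Z (f f' f'' : hom1 X Y) (g g' g'' : hom1 Y Z)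
    (a : hom2 f f') (a' : hom2 f' f'') (b : hom2 g g') (b' : hom2 g' g''),
    hcomp (vcomp a a') (vcomp b b') = vcomp (hcomp a b) (hcomp a' b');
  assoc : forall X Y Z W (f : hom1 X Y) (g : hom1 Y Z) (h : hom1 Z W),
    hom2 (comp1 (comp1 f g) h) (comp1 f (comp1 g h));
  assocV : forall X Y Z W (f : hom1 X Y) (g : hom1 Y Z) (h : hom1 Z W),
    hom2 (comp1 f (comp1 g h)) (comp1 (comp1 f g) h);
  assocK : forall X Y Z W (f : hom1 X Y) (g : hom1 Y Z) (h : hom1 Z W),
    vcomp (assoc f g h) (assocV f g h) = id2 _;
  assocVK : forall X Y Z W (f : hom1 X Y) (g : hom1 Y Z) (h : hom1 Z W),
    vcomp (assocV f g h) (assoc f g h) = id2 _;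
  assoc_nat : forall X Y Z W (f f' : hom1 X Y) (g g' : hom1 Y Z) (h h' : hom1 Z W)
    (a : hom2 f f') (b : hom2 g g') (c : hom2 h h'),
    vcomp (hcomp (hcomp a b) c) (assoc f' g' h')
    = vcomp (assoc f g h) (hcomp a (hcomp b c));
  lunit : forall X Y (f : hom1 X Y), hom2 (comp1 (id1 X) f) f;
  lunitV : forall X Y (f : hom1 X Y), hom2 f (comp1 (id1 X) f);
  lunitK : forall X Y (f : hom1 X Y), vcomp (lunit f) (lunitV f) = id2 _;
  lunitVK : forall X Y (f : hom1 X Y), vcomp (lunitV f) (lunit f) = id2 _;
  lunit_nat : forall X Y (f f' : hom1 X Y) (a : hom2 f f'),
    vcomp (hcomp (id2 (id1 X)) a) (lunit f') = vcomp (lunit f) a;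
  runit : forall X Y (f : hom1 X Y), hom2 (comp1 f (id1 Y)) f;
  runitV : forall X Y (f : hom1 X Y), hom2 f (comp1 f (id1 Y));
  runitK : forall X Y (f : hom1 X Y), vcomp (runit f) (runitV f) = id2 _;
  runitVK : forall X Y (f : hom1 X Y), vcomp (runitV f) (runit f) = id2 _;
  runit_nat : forall X Y (f f' : hom1 X Y) (a : hom2 f f'),
    vcomp (hcomp a (id2 (id1 Y))) (runit f') = vcomp (runit f) a;
  pentagon : forall X Y Z W V (f : hom1 X Y) (g : hom1 Y Z) (h : hom1 Z W)
    (k : hom1 W V),
    vcomp (assoc (comp1 f g) h k) (assoc f g (comp1 h k))
    = vcomp (hcomp (assoc f g h) (id2 k))
        (vcomp (assoc f (comp1 g h) k) (hcomp (id2 f) (assoc g h k)));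
  triangle : forall X Y Z (f : hom1 X Y) (g : hom1 Y Z),
    vcomp (assoc f (id1 Y) g) (hcomp (id2 f) (lunit g))
    = hcomp (runit f) (id2 g)
}.

Arguments hom1 : clear implicits.
Arguments hom2 {_ _ _} f g.
Arguments id2 {_ _ _} f.
Arguments vcomp {_ _ _ _ _ _} _ _.
Arguments id1 {_} X.
Arguments comp1 {_ _ _ _} f g.
Arguments hcomp {_ _ _ _ _ _ _ _} _ _.
Arguments assoc {_ _ _ _ _} f g h.
Arguments assocV {_ _ _ _ _} f g h.
Arguments lunit {_ _ _} f.
Arguments lunitV {_ _ _} f.
Arguments runit {_ _ _} f.
Arguments runitV {_ _ _} f.

Notation "f ;; g" := (comp1 f g) (at level 41, left associativity).
Notation "a >=> b" := (vcomp a b) (at level 45, left associativity).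
Notation "a ** b" := (hcomp a b) (at level 43, left associativity).

Definition is_inv2 (B : Bicategory) (X Y : B) (f g : hom1 B X Y) (a : hom2 f g)
  : Prop := exists b : hom2 g f, a >=> b = id2 f /\ b >=> a = id2 g.

Definition inv2 (B : Bicategory) (X Y : B) (f g : hom1 B X Y) (a : hom2 f g)
    (H : is_inv2 a) : hom2 g f :=
  proj1_sig (constructive_indefinite_description _ H).

Lemma rea (B : Bicategory) (X Y : B) (f g h : hom1 B X Y) (a : hom2 f g)
    (b : hom2 g h) (c : hom2 f h) :
  a >=> b = c -> forall k (d : hom2 h k), a >=> (b >=> d) = c >=> d.
Proof. by move=> <- k d; rewrite vassoc. Qed.

Lemma whiskr_vcomp (B : Bicategory) (X Y Z : B) (f f' f'' : hom1 B X Y)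
    (g : hom1 B Y Z) (a : hom2 f f') (b : hom2 f' f'') :
  (a >=> b) ** id2 g = (a ** id2 g) >=> (b ** id2 g).
Proof. by rewrite -hcomp_vcomp vidl. Qed.

Lemma whiskl_vcomp (B : Bicategory) (X Y Z : B) (f : hom1 B X Y)
    (g g' g'' : hom1 B Y Z) (a : hom2 g g') (b : hom2 g' g'') :
  id2 f ** (a >=> b) = (id2 f ** a) >=> (id2 f ** b).
Proof. by rewrite -hcomp_vcomp vidl. Qed.

Lemma inv2K (B : Bicategory) (X Y : B) (f g : hom1 B X Y) (a : hom2 f g)
    (H : is_inv2 a) : a >=> inv2 H = id2 f.
Proof.
by rewrite /inv2; case: constructive_indefinite_description => b [].
Qed.

Lemma inv2VK (B : Bicategory) (X Y : B) (f g : hom1 B X Y) (a : hom2 f g)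
    (H : is_inv2 a) : inv2 H >=> a = id2 g.
Proof.
by rewrite /inv2; case: constructive_indefinite_description => b [].
Qed.

Lemma is_inv2_id (B : Bicategory) (X Y : B) (f : hom1 B X Y) : is_inv2 (id2 f).
Proof. by exists (id2 f); rewrite vidl. Qed.

Lemma is_inv2_inv (B : Bicategory) (X Y : B) (f g : hom1 B X Y) (a : hom2 f g)
    (H : is_inv2 a) : is_inv2 (inv2 H).
Proof. by exists a; rewrite inv2K inv2VK. Qed.

Lemma is_inv2_vcomp (B : Bicategory) (X Y : B) (f g h : hom1 B X Y)
    (a : hom2 f g) (b : hom2 g h) :
  is_inv2 a -> is_inv2 b -> is_inv2 (a >=> b).
Proof.
move=> [a' [aK a'K]] [b' [bK b'K]]; exists (b' >=> a'); split.
- by rewrite vassoc (rea bK) vidl.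
- by rewrite vassoc (rea a'K) vidl.
Qed.

Lemma is_inv2_hcomp (B : Bicategory) (X Y Z : B) (f f' : hom1 B X Y)
    (g g' : hom1 B Y Z) (a : hom2 f f') (b : hom2 g g') :
  is_inv2 a -> is_inv2 b -> is_inv2 (a ** b).
Proof.
move=> [a' [aK a'K]] [b' [bK b'K]]; exists (a' ** b').
by rewrite -!hcomp_vcomp aK a'K bK b'K !hcomp_id.
Qed.

Definition has_right_adjoint (B : Bicategory) (X Y : B) (f : hom1 B X Y) : Prop :=
  exists (r : hom1 B Y X) (eta : hom2 (id1 X) (f ;; r))
         (eps : hom2 (r ;; f) (id1 Y)),
    lunitV f >=> (eta ** id2 f) >=> assoc f r f >=> (id2 f ** eps) >=> runit f
      = id2 f /\
    runitV r >=> (id2 r ** eta) >=> assocV r f r >=> (eps ** id2 r) >=> lunit r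
      = id2 r.

Definition LocDisc (E : Category) : Bicategory.
Proof.
refine {|
  bob := E; hom1 := chom E; hom2 := fun X Y f g => f = g;
  id2 := fun X Y f => eq_refl;
  vcomp := fun X Y f g h a b => eq_trans a b;
  id1 := fun X => cid X;
  comp1 := fun X Y Z f g => f >> g;
  hcomp := fun X Y Z f f' g g' a b => f_equal2 (fun u v => u >> v) a b;
  assoc := fun X Y Z W f g h => cassoc f g h;
  assocV := fun X Y Z W f g h => eq_sym (cassoc f g h);
  lunit := fun X Y f => cidl f;
  lunitV := fun X Y f => eq_sym (cidl f);
  runit := fun X Y f => cidr f;
  runitV := fun X Y f => eq_sym (cidr f)
|}; intros; apply proof_irrelevance.
Defined.

(* The function on objects [F0] is a parameter, so that functors agreeing on
   objects can be compared without transport. *)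
Record Oplax (A B : Bicategory) (F0 : A -> B) := {
  o1 : forall X Y, hom1 A X Y -> hom1 B (F0 X) (F0 Y);
  o2 : forall X Y (f g : hom1 A X Y), hom2 f g -> hom2 (o1 f) (o1 g);
  o2_id : forall X Y (f : hom1 A X Y), o2 (id2 f) = id2 (o1 f);
  o2_vcomp : forall X Y (f g h : hom1 A X Y) (a : hom2 f g) (b : hom2 g h),
    o2 (a >=> b) = o2 a >=> o2 b;
  lam : forall X, hom2 (o1 (id1 X)) (id1 (F0 X));
  phi : forall X Y Z (f : hom1 A X Y) (g : hom1 A Y Z),
    hom2 (o1 (f ;; g)) (o1 f ;; o1 g);
  phi_nat : forall X Y Z (f f' : hom1 A X Y) (g g' : hom1 A Y Z)
    (a : hom2 f f') (b : hom2 g g'),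
    o2 (a ** b) >=> phi f' g' = phi f g >=> (o2 a ** o2 b);
  phi_assoc : forall X Y Z W (f : hom1 A X Y) (g : hom1 A Y Z) (h : hom1 A Z W),
    phi (f ;; g) h >=> (phi f g ** id2 (o1 h)) >=> assoc (o1 f) (o1 g) (o1 h)
    = o2 (assoc f g h) >=> phi f (g ;; h) >=> (id2 (o1 f) ** phi g h);
  phi_lunit : forall X Y (f : hom1 A X Y),
    phi (id1 X) f >=> (lam X ** id2 (o1 f)) >=> lunit (o1 f) = o2 (lunit f);
  phi_runit : forall X Y (f : hom1 A X Y),
    phi f (id1 Y) >=> (id2 (o1 f) ** lam Y) >=> runit (o1 f) = o2 (runit f)
}.

Arguments o1 {_ _ _} _ {_ _} _.
Arguments o2 {_ _ _} _ {_ _ _ _} _.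
Arguments lam {_ _ _} _ X.
Arguments phi {_ _ _} _ {_ _ _} f g.

Definition is_normal (A B : Bicategory) (F0 : A -> B) (F : Oplax F0) : Prop :=
  forall X, is_inv2 (lam F X).

Definition is_pseudo (A B : Bicategory) (F0 : A -> B) (F : Oplax F0) : Prop :=
  is_normal F /\
  forall X Y Z (f : hom1 A X Y) (g : hom1 A Y Z), is_inv2 (phi F f g).

Definition is_gregarious (A B : Bicategory) (F0 : A -> B) (F : Oplax F0) : Prop :=
  is_normal F /\
  forall X Y Z (f : hom1 A X Y) (g : hom1 A Y Z),
    has_right_adjoint g -> is_inv2 (phi F f g).

Definition lamV (A B : Bicategory) (F0 : A -> B) (F : Oplax F0)
    (H : is_pseudo F) X : hom2 (id1 (F0 X)) (o1 F (id1 X)) :=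
  inv2 (proj1 H X).

Definition phiV (A B : Bicategory) (F0 : A -> B) (F : Oplax F0)
    (H : is_pseudo F) X Y Z (f : hom1 A X Y) (g : hom1 A Y Z) :
  hom2 (o1 F f ;; o1 F g) (o1 F (f ;; g)) :=
  inv2 (proj2 H X Y Z f g).

Lemma is_inv2_o2 (A B : Bicategory) (F0 : A -> B) (F : Oplax F0) (X Y : A)
    (f g : hom1 A X Y) (a : hom2 f g) : is_inv2 a -> is_inv2 (o2 F a).
Proof.
by move=> [b [ab ba]]; exists (o2 F b); rewrite -!o2_vcomp ab ba !o2_id.
Qed.

Lemma phi_natl (A B : Bicategory) (F0 : A -> B) (F : Oplax F0) (X Y Z : A)
    (f f' : hom1 A X Y) (g : hom1 A Y Z) (a : hom2 f f') :
  phi F f g >=> (o2 F a ** id2 (o1 F g)) = o2 F (a ** id2 g) >=> phi F f' g.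
Proof. by rewrite phi_nat o2_id. Qed.

Lemma phi_natr (A B : Bicategory) (F0 : A -> B) (F : Oplax F0) (X Y Z : A)
    (f : hom1 A X Y) (g g' : hom1 A Y Z) (a : hom2 g g') :
  phi F f g >=> (id2 (o1 F f) ** o2 F a) = o2 F (id2 f ** a) >=> phi F f g'.
Proof. by rewrite phi_nat o2_id. Qed.

Definition oplax_comp (A B C : Bicategory) (F0 : A -> B) (G0 : B -> C)
    (F : Oplax F0) (G : Oplax G0) : Oplax (A := A) (B := C) (fun X => G0 (F0 X)).
Proof.
refine {|
  o1 := fun X Y f => o1 G (o1 F f);
  o2 := fun X Y f g a => o2 G (o2 F a);
  lam := fun X => o2 G (lam F X) >=> lam G (F0 X);
  phi := fun X Y Z f g => o2 G (phi F f g) >=> phi G (o1 F f) (o1 F g)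
|}.
- abstract (by move=> X Y f; rewrite !o2_id).
- abstract (by move=> X Y f g h a b; rewrite !o2_vcomp).
- abstract (move=> X Y Z f f' g g' a b;
  by rewrite -vassoc -o2_vcomp phi_nat o2_vcomp !vassoc phi_nat).
- abstract (move=> X Y Z W f g h; rewrite whiskr_vcomp whiskl_vcomp !vassoc;
  rewrite (rea (phi_natl _ _ _)) (rea (phi_natr _ _ _)) !vassoc;
  have := phi_assoc G (o1 F f) (o1 F g) (o1 F h); rewrite vassoc => ->;
  by rewrite -!vassoc -!o2_vcomp phi_assoc).
- abstract (move=> X Y f; rewrite whiskr_vcomp !vassoc (rea (phi_natl _ _ _)) vassoc;
  have := phi_lunit G (o1 F f); rewrite vassoc => ->;
  by rewrite -!o2_vcomp -vassoc phi_lunit).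
- abstract (move=> X Y f; rewrite whiskl_vcomp !vassoc (rea (phi_natr _ _ _)) vassoc;
  have := phi_runit G (o1 F f); rewrite vassoc => ->;
  by rewrite -!o2_vcomp -vassoc phi_runit).
Defined.

Record Icon (A B : Bicategory) (F0 : A -> B) (F G : Oplax F0) := {
  ic : forall X Y (f : hom1 A X Y), hom2 (o1 F f) (o1 G f);
  ic_nat : forall X Y (f g : hom1 A X Y) (a : hom2 f g),
    o2 F a >=> ic g = ic f >=> o2 G a;
  ic_phi : forall X Y Z (f : hom1 A X Y) (g : hom1 A Y Z),
    ic (f ;; g) >=> phi G f g = phi F f g >=> (ic f ** ic g);
  ic_lam : forall X, ic (id1 X) >=> lam G X = lam F X
}.

Arguments ic {_ _ _ _ _} _ {_ _} f.

Lemma icon_ext (A B : Bicategory) (F0 : A -> B) (F G : Oplax F0) (a b : Icon F G) :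
  (forall X Y (f : hom1 A X Y), ic a f = ic b f) -> a = b.
Proof.
case: a b => [a a1 a2 a3] [b b1 b2 b3] /= ab.
have {ab} e : a = b.
  by do 3 apply: functional_extensionality_dep => ?; apply: ab.
by destruct e; f_equal; apply: proof_irrelevance.
Qed.

Definition icon_id (A B : Bicategory) (F0 : A -> B) (F : Oplax F0) : Icon F F.
Proof.
refine {| ic := fun X Y f => id2 (o1 F f) |}.
- abstract (by move=> X Y f g a; rewrite vidl vidr).
- abstract (by move=> X Y Z f g; rewrite hcomp_id vidl vidr).
- abstract (by move=> X; rewrite vidl).
Defined.

Definition icon_comp (A B : Bicategory) (F0 : A -> B) (F G H : Oplax F0)
    (a : Icon F G) (b : Icon G H) : Icon F H.
Proof.
refine {| ic := fun X Y f => ic a f >=> ic b f |}.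
- abstract (by move=> X Y f g c; rewrite -vassoc ic_nat !vassoc ic_nat).
- abstract (by move=> X Y Z f g; rewrite vassoc ic_phi -vassoc ic_phi vassoc hcomp_vcomp).
- abstract (by move=> X; rewrite vassoc !ic_lam).
Defined.

Definition IconFib (A B : Bicategory) (F0 : A -> B) : Category.
Proof.
refine {| cob := Oplax F0; chom := @Icon A B F0; cid := @icon_id A B F0;
          ccomp := @icon_comp A B F0 |}.
- abstract (by move=> F G a; apply: icon_ext => X Y f /=; rewrite vidl).
- abstract (by move=> F G a; apply: icon_ext => X Y f /=; rewrite vidr).
- abstract (by move=> F G H K a b c; apply: icon_ext => X Y f /=; rewrite vassoc).
Defined.

Definition IconCat (A B : Bicategory) : Category :=
  TotalCat (fun F0 : A -> B => FullSub (A := IconFib F0) (@is_pseudo A B F0)).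

Definition icon_restr (A B C : Bicategory) (P0 : A -> B) (P : Oplax P0)
    (F0 : B -> C) (F G : Oplax F0) (a : Icon F G) :
  Icon (oplax_comp P F) (oplax_comp P G).
Proof.
refine {| ic := fun X Y f => ic a (o1 P f) :
                  hom2 (o1 (oplax_comp P F) f) (o1 (oplax_comp P G) f) |}.
- abstract (by move=> X Y f g b /=; rewrite ic_nat).
- abstract (by move=> X Y Z f g /=; rewrite -vassoc -ic_nat !vassoc ic_phi).
- abstract (by move=> X /=; rewrite -vassoc -ic_nat vassoc ic_lam).
Defined.

(* The square  p >> f = q >> g  on the cospan  X --f--> Z <--g-- Y. *)
Definition is_pullback (E : Category) (X Y Z P : E) (f : chom E X Z)
    (g : chom E Y Z) (p : chom E P X) (q : chom E P Y) : Prop :=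
  p >> f = q >> g /\
  forall (Q : E) (a : chom E Q X) (b : chom E Q Y), a >> f = b >> g ->
    exists! u : chom E Q P, u >> p = a /\ u >> q = b.

Lemma is_pullback_sq (E : Category) (X Y Z P : E) (f : chom E X Z)
    (g : chom E Y Z) (p : chom E P X) (q : chom E P Y) :
  is_pullback f g p q -> p >> f = q >> g.
Proof. exact: proj1. Qed.

Record Span (E : Category) (X Y : E) := mkSpan {
  apex : E;
  lleg : chom E apex X;
  rleg : chom E apex Y
}.

Arguments mkSpan {E X Y apex} lleg rleg.

Record ChosenPullbacks (E : Category) := {
  pb : forall X Y Z : E, chom E X Z -> chom E Y Z -> Span X Y;
  pb_is : forall (X Y Z : E) (f : chom E X Z) (g : chom E Y Z),
    is_pullback f g (lleg (pb f g)) (rleg (pb f g));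
  pb_idr : forall (X Z : E) (f : chom E X Z), pb f (cid Z) = mkSpan (cid X) f;
  pb_idl : forall (Y Z : E) (g : chom E Y Z), pb (cid Z) g = mkSpan g (cid Y)
}.

Arguments pb {_} _ {_ _ _} f g.

Definition pb_med (E : Category) (P : ChosenPullbacks E) (X Y Z Q : E)
    (f : chom E X Z) (g : chom E Y Z) (a : chom E Q X) (b : chom E Q Y)
    (e : a >> f = b >> g) : chom E Q (apex (pb P f g)) :=
  proj1_sig (constructive_indefinite_description _ (proj2 (pb_is P f g) Q a b e)).

Arguments pb_med {_} P {_ _ _ _ f g} a b e.

Lemma pb_sq (E : Category) (P : ChosenPullbacks E) (X Y Z : E)
    (f : chom E X Z) (g : chom E Y Z) :
  lleg (pb P f g) >> f = rleg (pb P f g) >> g.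
Proof. exact: proj1 (pb_is P f g). Qed.

Lemma pb_medl (E : Category) (P : ChosenPullbacks E) (X Y Z Q : E)
    (f : chom E X Z) (g : chom E Y Z) (a : chom E Q X) (b : chom E Q Y)
    (e : a >> f = b >> g) : pb_med P a b e >> lleg (pb P f g) = a.
Proof. by rewrite /pb_med; case: constructive_indefinite_description => u [[]]. Qed.

Lemma pb_medr (E : Category) (P : ChosenPullbacks E) (X Y Z Q : E)
    (f : chom E X Z) (g : chom E Y Z) (a : chom E Q X) (b : chom E Q Y)
    (e : a >> f = b >> g) : pb_med P a b e >> rleg (pb P f g) = b.
Proof. by rewrite /pb_med; case: constructive_indefinite_description => u [[]]. Qed.

Lemma rec (E : Category) (X Y Z : E) (f : chom E X Y) (g : chom E Y Z)
    (h : chom E X Z) :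
  f >> g = h -> forall W (k : chom E Z W), f >> (g >> k) = h >> k.
Proof. by move=> <- W k; rewrite cassoc. Qed.

Lemma pullback_ext (E : Category) (X Y Z P Q : E) (f : chom E X Z)
    (g : chom E Y Z) (p : chom E P X) (q : chom E P Y) (u v : chom E Q P) :
  is_pullback f g p q -> u >> p = v >> p -> u >> q = v >> q -> u = v.
Proof.
move=> [sq un] ep eq.
have [w [_ wu]] : exists! w, w >> p = v >> p /\ w >> q = v >> q.
  by apply: un; rewrite !cassoc sq.
by rewrite -(wu u) // -(wu v).
Qed.

Lemma pb_ext (E : Category) (P : ChosenPullbacks E) (X Y Z Q : E)
    (f : chom E X Z) (g : chom E Y Z) (u v : chom E Q (apex (pb P f g))) :
  u >> lleg (pb P f g) = v >> lleg (pb P f g) ->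
  u >> rleg (pb P f g) = v >> rleg (pb P f g) -> u = v.
Proof. exact: pullback_ext (pb_is P f g). Qed.

Record SpanCell (E : Category) (X Y : E) (S T : Span X Y) := {
  sc : chom E (apex S) (apex T);
  sc_l : sc >> lleg T = lleg S;
  sc_r : sc >> rleg T = rleg S;
  sc_iso : is_iso sc
}.

Lemma span_cell_ext (E : Category) (X Y : E) (S T : Span X Y) (a b : SpanCell S T) :
  sc a = sc b -> a = b.
Proof.
case: a b => [a a1 a2 a3] [b b1 b2 b3] /= ab; destruct ab.
by f_equal; apply: proof_irrelevance.
Qed.

Definition span_id (E : Category) (X : E) : Span X X := mkSpan (cid X) (cid X).

Definition span_comp (E : Category) (P : ChosenPullbacks E) (X Y Z : E)
    (S : Span X Y) (T : Span Y Z) : Span X Z :=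
  let R := pb P (rleg S) (lleg T) in
  mkSpan (lleg R >> lleg S) (rleg R >> rleg T).

Lemma is_iso_id (E : Category) (X : E) : is_iso (cid X).
Proof. by exists (cid X); rewrite cidl. Qed.

Ltac spn1 := rewrite ?cassoc ?cidl ?cidr ?pb_medl ?pb_medr ?(rec (pb_medl _ _))
  ?(rec (pb_medr _ _)) ?sc_l ?sc_r ?(rec (sc_l _)) ?(rec (sc_r _)).
Ltac spn := repeat progress spn1.

Definition span_cell_id (E : Category) (X Y : E) (S : Span X Y) : SpanCell S S.
Proof. by exists (cid (apex S)); [rewrite cidl | rewrite cidl | apply: is_iso_id]. Defined.

Definition span_cell_comp (E : Category) (X Y : E) (S T R : Span X Y)
    (a : SpanCell S T) (b : SpanCell T R) : SpanCell S R.
Proof.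
exists (sc a >> sc b).
- abstract (by rewrite cassoc !sc_l).
- abstract (by rewrite cassoc !sc_r).
- abstract (case: (sc_iso a) => a' [aK a'K]; case: (sc_iso b) => b' [bK b'K];
  exists (b' >> a'); split;
  [ by rewrite cassoc (rec bK) cidl
  | by rewrite cassoc (rec a'K) cidl ]).
Defined.

Definition span_cell_inv (E : Category) (X Y : E) (S T : Span X Y)
    (a : SpanCell S T) : SpanCell T S.
Proof.
case: (constructive_indefinite_description _ (sc_iso a)) => b [ab ba].
exists b.
- abstract (by rewrite -(sc_l a) (rec ba) cidl).
- abstract (by rewrite -(sc_r a) (rec ba) cidl).
- abstract (by exists (sc a)).
Defined.

Lemma span_cell_invK (E : Category) (X Y : E) (S T : Span X Y)
    (a : SpanCell S T) :
  sc a >> sc (span_cell_inv a) = cid (apex S).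
Proof.
by rewrite /span_cell_inv; case: constructive_indefinite_description => b [].
Qed.

Lemma span_cell_invVK (E : Category) (X Y : E) (S T : Span X Y)
    (a : SpanCell S T) :
  sc (span_cell_inv a) >> sc a = cid (apex T).
Proof.
by rewrite /span_cell_inv; case: constructive_indefinite_description => b [].
Qed.

Lemma span_hmap_sq (E : Category) (P : ChosenPullbacks E) (X Y Z : E)
    (S S' : Span X Y) (T T' : Span Y Z) (a : SpanCell S S') (b : SpanCell T T') :
  (lleg (pb P (rleg S) (lleg T)) >> sc a) >> rleg S'
  = (rleg (pb P (rleg S) (lleg T)) >> sc b) >> lleg T'.
Proof. by rewrite !cassoc sc_r sc_l pb_sq. Qed.

Definition span_hcomp (E : Category) (P : ChosenPullbacks E) (X Y Z : E)
    (S S' : Span X Y) (T T' : Span Y Z) (a : SpanCell S S') (b : SpanCell T T') :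
  SpanCell (span_comp P S T) (span_comp P S' T').
Proof.
exists (pb_med P _ _ (span_hmap_sq P a b)); rewrite /=.
- abstract (by spn).
- abstract (by spn).
- abstract (exists (pb_med P _ _ (span_hmap_sq P (span_cell_inv a) (span_cell_inv b)));
  by split; apply: pb_ext; spn;
    rewrite ?span_cell_invK ?span_cell_invVK cidr).
Defined.

Lemma span_assoc_sq1 (E : Category) (P : ChosenPullbacks E) (X Y Z W : E)
    (S : Span X Y) (T : Span Y Z) (U : Span Z W) :
  (lleg (pb P (rleg (span_comp P S T)) (lleg U))
     >> rleg (pb P (rleg S) (lleg T))) >> rleg T
  = rleg (pb P (rleg (span_comp P S T)) (lleg U)) >> lleg U.
Proof. by rewrite -pb_sq /= !cassoc. Qed.

Lemma span_assoc_sq (E : Category) (P : ChosenPullbacks E) (X Y Z W : E)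
    (S : Span X Y) (T : Span Y Z) (U : Span Z W) :
  (lleg (pb P (rleg (span_comp P S T)) (lleg U))
     >> lleg (pb P (rleg S) (lleg T))) >> rleg S
  = pb_med P _ _ (span_assoc_sq1 P S T U) >> lleg (span_comp P T U).
Proof. by rewrite /=; spn; rewrite pb_sq. Qed.

Lemma span_assocV_sq1 (E : Category) (P : ChosenPullbacks E) (X Y Z W : E)
    (S : Span X Y) (T : Span Y Z) (U : Span Z W) :
  lleg (pb P (rleg S) (lleg (span_comp P T U))) >> rleg S
  = (rleg (pb P (rleg S) (lleg (span_comp P T U)))
       >> lleg (pb P (rleg T) (lleg U))) >> lleg T.
Proof. by rewrite pb_sq /= !cassoc. Qed.

Lemma span_assocV_sq (E : Category) (P : ChosenPullbacks E) (X Y Z W : E)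
    (S : Span X Y) (T : Span Y Z) (U : Span Z W) :
  pb_med P _ _ (span_assocV_sq1 P S T U) >> rleg (span_comp P S T)
  = (rleg (pb P (rleg S) (lleg (span_comp P T U)))
       >> rleg (pb P (rleg T) (lleg U))) >> lleg U.
Proof. by rewrite /=; spn; rewrite pb_sq. Qed.

Lemma span_assocK (E : Category) (P : ChosenPullbacks E) (X Y Z W : E)
    (S : Span X Y) (T : Span Y Z) (U : Span Z W) :
  pb_med P _ _ (span_assoc_sq P S T U) >> pb_med P _ _ (span_assocV_sq P S T U)
  = cid _.
Proof. by apply: pb_ext; [apply: pb_ext|]; spn. Qed.

Lemma span_assocVK (E : Category) (P : ChosenPullbacks E) (X Y Z W : E)
    (S : Span X Y) (T : Span Y Z) (U : Span Z W) :
  pb_med P _ _ (span_assocV_sq P S T U) >> pb_med P _ _ (span_assoc_sq P S T U)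
  = cid _.
Proof. by apply: pb_ext; [|apply: pb_ext]; spn. Qed.

Definition span_assoc (E : Category) (P : ChosenPullbacks E) (X Y Z W : E)
    (S : Span X Y) (T : Span Y Z) (U : Span Z W) :
  SpanCell (span_comp P (span_comp P S T) U) (span_comp P S (span_comp P T U)).
Proof.
exists (pb_med P _ _ (span_assoc_sq P S T U)).
- abstract (by rewrite /=; spn).
- abstract (by rewrite /=; spn).
- abstract (exists (pb_med P _ _ (span_assocV_sq P S T U)); split;
    [exact: span_assocK | exact: span_assocVK]).
Defined.

Definition span_assocV (E : Category) (P : ChosenPullbacks E) (X Y Z W : E)
    (S : Span X Y) (T : Span Y Z) (U : Span Z W) :
  SpanCell (span_comp P S (span_comp P T U)) (span_comp P (span_comp P S T) U).
Proof.
exists (pb_med P _ _ (span_assocV_sq P S T U)).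
- abstract (by rewrite /=; spn).
- abstract (by rewrite /=; spn).
- abstract (exists (pb_med P _ _ (span_assoc_sq P S T U)); split;
    [exact: span_assocVK | exact: span_assocK]).
Defined.

Lemma span_lunit_sq (E : Category) (X Y : E) (S : Span X Y) :
  lleg S >> rleg (span_id X) = cid (apex S) >> lleg S.
Proof. by rewrite cidl cidr. Qed.

Lemma span_runit_sq (E : Category) (X Y : E) (S : Span X Y) :
  cid (apex S) >> rleg S = rleg S >> lleg (span_id Y).
Proof. by rewrite cidl cidr. Qed.

Lemma span_lunitK (E : Category) (P : ChosenPullbacks E) (X Y : E) (S : Span X Y) :
  rleg (pb P (rleg (span_id X)) (lleg S)) >> pb_med P _ _ (span_lunit_sq S) = cid _.
Proof. by apply: pb_ext; spn; rewrite // -pb_sq /= cidr. Qed.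

Lemma span_runitK (E : Category) (P : ChosenPullbacks E) (X Y : E) (S : Span X Y) :
  lleg (pb P (rleg S) (lleg (span_id Y))) >> pb_med P _ _ (span_runit_sq S) = cid _.
Proof. by apply: pb_ext; spn; rewrite // pb_sq /= cidr. Qed.

Definition span_lunit (E : Category) (P : ChosenPullbacks E) (X Y : E)
    (S : Span X Y) : SpanCell (span_comp P (span_id X) S) S.
Proof.
exists (rleg (pb P (rleg (span_id X)) (lleg S))).
- abstract (by rewrite -pb_sq).
- abstract (by []).
- abstract (exists (pb_med P _ _ (span_lunit_sq S)); split; [exact: span_lunitK | exact: pb_medr]).
Defined.

Definition span_lunitV (E : Category) (P : ChosenPullbacks E) (X Y : E)
    (S : Span X Y) : SpanCell S (span_comp P (span_id X) S).
Proof.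
exists (pb_med P _ _ (span_lunit_sq S)).
- abstract (by rewrite /=; spn).
- abstract (by rewrite /=; spn).
- abstract (exists (rleg (pb P (rleg (span_id X)) (lleg S))); split;
    [exact: pb_medr | exact: span_lunitK]).
Defined.

Definition span_runit (E : Category) (P : ChosenPullbacks E) (X Y : E)
    (S : Span X Y) : SpanCell (span_comp P S (span_id Y)) S.
Proof.
exists (lleg (pb P (rleg S) (lleg (span_id Y)))).
- abstract (by []).
- abstract (by rewrite pb_sq).
- abstract (exists (pb_med P _ _ (span_runit_sq S)); split; [exact: span_runitK | exact: pb_medl]).
Defined.

Definition span_runitV (E : Category) (P : ChosenPullbacks E) (X Y : E)
    (S : Span X Y) : SpanCell S (span_comp P S (span_id Y)).
Proof.
exists (pb_med P _ _ (span_runit_sq S)).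
- abstract (by rewrite /=; spn).
- abstract (by rewrite /=; spn).
- abstract (exists (lleg (pb P (rleg S) (lleg (span_id Y)))); split;
    [exact: pb_medl | exact: span_runitK]).
Defined.

Definition SpanIso (E : Category) (P : ChosenPullbacks E) : Bicategory.
Proof.
refine {|
  bob := cob E; hom1 := @Span E; hom2 := @SpanCell E;
  id2 := @span_cell_id E; vcomp := @span_cell_comp E;
  id1 := @span_id E; comp1 := @span_comp E P; hcomp := @span_hcomp E P;
  assoc := @span_assoc E P; assocV := @span_assocV E P;
  lunit := @span_lunit E P; lunitV := @span_lunitV E P;
  runit := @span_runit E P; runitV := @span_runitV E P
|}; intros; apply: span_cell_ext; rewrite /=.
- abstract (exact: cidl).
- abstract (exact: cidr).
- abstract (exact: cassoc).
- abstract (by apply: pb_ext; spn).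
- abstract (by apply: pb_ext; spn).
- abstract (exact: span_assocK).
- abstract (exact: span_assocVK).
- abstract (by apply: pb_ext; [|apply: pb_ext]; spn).
- abstract (exact: span_lunitK).
- abstract (exact: pb_medr).
- abstract (by spn).
- abstract (exact: span_runitK).
- abstract (exact: pb_medl).
- abstract (by spn).
- abstract (by apply: pb_ext; [|apply: pb_ext; [|apply: pb_ext]]; spn).
- abstract (by apply: pb_ext; spn; rewrite // pb_sq).
Defined.

Definition tens_sp (E : Category) (X Y : E) (f : chom E X Y) : Span X Y :=
  mkSpan (cid X) f.

Definition delt_sp (E : Category) (X Y : E) (f : chom E X Y) : Span Y X :=
  mkSpan f (cid X).

Lemma sq_id (E : Category) (X Y : E) (f : chom E X Y) :
  cid X >> f = f >> cid Y.
Proof. by rewrite cidl cidr. Qed.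

Lemma sq_id_sym (E : Category) (X Y : E) (f : chom E X Y) :
  f >> cid Y = cid X >> f.
Proof. by rewrite cidl cidr. Qed.

(* The canonical comparison cells below are given by the universal property of
   the chosen pullback; since identities pull back to identities, their
   underlying morphisms are (up to the equations [pb_idr] and [pb_idl])
   identities, so that both embeddings are strict. *)
Definition tens_phi (E : Category) (P : ChosenPullbacks E) (X Y Z : E)
    (f : chom E X Y) (g : chom E Y Z) :
  SpanCell (tens_sp (f >> g)) (span_comp P (tens_sp f) (tens_sp g)).
Proof.
exists (pb_med P _ _ (sq_id f)); rewrite /=.
- abstract (by spn).
- abstract (by spn).
- abstract (exists (lleg (pb P f (cid Y))); split; first exact: pb_medl;
  by apply: pb_ext; spn; rewrite // pb_sq cidr).
Defined.

Definition delt_phi (E : Category) (P : ChosenPullbacks E) (X Y Z : E)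
    (f : chom E X Y) (g : chom E Y Z) :
  SpanCell (delt_sp (f >> g)) (span_comp P (delt_sp g) (delt_sp f)).
Proof.
exists (pb_med P _ _ (sq_id_sym f)); rewrite /=.
- abstract (by spn).
- abstract (by spn).
- abstract (exists (rleg (pb P (cid Y) f)); split; first exact: pb_medr;
  by apply: pb_ext; spn; rewrite // -pb_sq cidr).
Defined.

Definition tens_2 (E : Category) (X Y : E) (f g : chom E X Y) (e : f = g) :
  SpanCell (tens_sp f) (tens_sp g).
Proof.
exists (cid X); [exact: cidl | by rewrite /= cidl | exact: is_iso_id].
Defined.

Definition delt_2 (E : Category) (X Y : E) (f g : chom E X Y) (e : f = g) :
  SpanCell (delt_sp f) (delt_sp g).
Proof.
exists (cid X); [by rewrite /= cidl | exact: cidl | exact: is_iso_id].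
Defined.

Definition tens (E : Category) (P : ChosenPullbacks E) :
  Oplax (A := LocDisc E) (B := SpanIso P) (fun X => X).
Proof.
refine (@Build_Oplax (LocDisc E) (SpanIso P) (fun X => X)
  (@tens_sp E) (@tens_2 E) _ _ (fun X => id2 (id1 (X : SpanIso P)))
  (@tens_phi E P) _ _ _ _); intros; apply: span_cell_ext; rewrite /=.
- abstract (by []).
- abstract (by spn).
- abstract (by apply: pb_ext; spn).
- abstract (by apply: pb_ext; [|apply: pb_ext]; spn).
- abstract (by spn).
- abstract (by spn).
Defined.

Lemma delt_phi_assoc (E : Category) (P : ChosenPullbacks E) (X Y Z W : E)
    (f : chom E Y X) (g : chom E Z Y) (h : chom E W Z) :
  span_cell_comp (span_cell_comp (delt_phi P h (g >> f))
      (span_hcomp P (delt_phi P g f) (span_cell_id (delt_sp h))))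
    (span_assoc P (delt_sp f) (delt_sp g) (delt_sp h))
  = span_cell_comp (span_cell_comp (delt_2 (eq_sym (cassoc h g f)))
      (delt_phi P (h >> g) f))
    (span_hcomp P (span_cell_id (delt_sp f)) (delt_phi P h g)).
Proof.
apply: span_cell_ext; rewrite /=.
by apply: pb_ext; [|apply: pb_ext]; spn.
Qed.

Definition delt (E : Category) (P : ChosenPullbacks E) :
  Oplax (A := LocDisc (Op E)) (B := SpanIso P) (fun X => X).
Proof.
refine (@Build_Oplax (LocDisc (Op E)) (SpanIso P) (fun X => X)
  (fun X Y => @delt_sp E Y X) (fun X Y => @delt_2 E Y X) _ _
  (fun X => id2 (id1 (X : SpanIso P)))
  (fun X Y Z f g => @delt_phi E P Z Y X g f) _ _ _ _);
  intros; try exact: delt_phi_assoc; apply: span_cell_ext; rewrite /=.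
- abstract (by []).
- abstract (by spn).
- abstract (by apply: pb_ext; spn).
- abstract (by spn).
- abstract (by spn).
Defined.

Definition split_cell (E : Category) (P : ChosenPullbacks E) (X Y T : E)
    (s : chom E T X) (t : chom E T Y) :
  SpanCell (mkSpan s t) (span_comp P (delt_sp s) (tens_sp t)).
Proof.
exists (pb_med P (cid T) (cid T) (eq_refl _)); rewrite /=.
- abstract (by spn).
- abstract (by spn).
- abstract (exists (lleg (pb P (cid T) (cid T))); split; first exact: pb_medl;
  by apply: pb_ext; spn; rewrite //; have := pb_sq P (cid T) (cid T); rewrite !cidr).
Defined.

(* The composite (1,f);(g,1) has as vertex the chosen pullback of f and g, and
   its legs are the two projections composed with identities, so this is the
   isomorphism from an arbitrary pullback of f and g to the chosen one. *)
Definition base_change_cell (E : Category) (P : ChosenPullbacks E) (X Y Z Q : E)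
    (f : chom E X Z) (g : chom E Y Z) (p : chom E Q X) (q : chom E Q Y)
    (H : is_pullback f g p q) :
  SpanCell (mkSpan p q) (span_comp P (tens_sp f) (delt_sp g)).
Proof.
exists (pb_med P _ _ (is_pullback_sq H)); rewrite /=.
- abstract (by spn).
- abstract (by spn).
- abstract (case: (proj2 H _ _ _ (pb_sq P f g)) => u [[up uq] _];
  exists u; split;
  [ by apply: (pullback_ext H); rewrite cassoc ?up ?uq ?pb_medl ?pb_medr cidl
  | by apply: pb_ext; rewrite cassoc ?pb_medl ?pb_medr ?up ?uq cidl ]).
Defined.

Definition F_tens (E : Category) (P : ChosenPullbacks E) (C : Bicategory)
    (F0 : E -> C) (F : Oplax (A := SpanIso P) (B := C) F0) :
  Oplax (A := LocDisc E) (B := C) F0 := oplax_comp (tens P) F.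

Definition F_delt (E : Category) (P : ChosenPullbacks E) (C : Bicategory)
    (F0 : E -> C) (F : Oplax (A := SpanIso P) (B := C) F0) :
  Oplax (A := LocDisc (Op E)) (B := C) F0 := oplax_comp (delt P) F.

(* The oplax constraint  F(s,t) => F(s,1);F(1,t), where (s,t) is compared with
   the composite span (s,1);(1,t) along [split_cell]; the latter is an identity
   up to the equations [pb_idr], [pb_idl] and the unit laws of E. *)
Definition F_split (E : Category) (P : ChosenPullbacks E) (C : Bicategory)
    (F0 : E -> C) (F : Oplax (A := SpanIso P) (B := C) F0) (X Y T : E)
    (s : chom E T X) (t : chom E T Y) :
  hom2 (o1 F (mkSpan s t)) (o1 (F_delt F) s ;; o1 (F_tens F) t) :=
  o2 F (split_cell P s t) >=> phi F (delt_sp s) (tens_sp t).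

Definition is_greg (E : Category) (P : ChosenPullbacks E) (C : Bicategory)
    (F0 : E -> C) (F : Oplax (A := SpanIso P) (B := C) F0) : Prop :=
  is_gregarious F /\ is_pseudo (F_tens F) /\ is_pseudo (F_delt F) /\
  forall (X Y T : E) (s : chom E T X) (t : chom E T Y), is_inv2 (F_split F s t).

Definition GregFib (E : Category) (P : ChosenPullbacks E) (C : Bicategory)
    (F0 : E -> C) : Category :=
  FullSub (A := IconFib (A := SpanIso P) (B := C) F0) (@is_greg E P C F0).

Definition Greg (E : Category) (P : ChosenPullbacks E) (C : Bicategory) : Category :=
  TotalCat (@GregFib E P C).

(* For a pullback square  g' >> f = f' >> g, a cell from [F_tens f'] after
   [F_delt g'] to [F_delt g] after [F_tens f]. *)
Definition BeckData (E : Category) (C : Bicategory) (F0 : E -> C)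
    (Ft : Oplax (A := LocDisc E) (B := C) F0) (Fd : Oplax (A := LocDisc (Op E)) (B := C) F0)
  : Type :=
  forall (X Y Z P : E) (f : chom E X Z) (g : chom E Y Z)
    (g' : chom E P X) (f' : chom E P Y), is_pullback f g g' f' ->
  hom2 (o1 Fd g' ;; o1 Ft f') (o1 Ft f ;; o1 Fd g).

Record LaxBeckPairOver (E : Category) (C : Bicategory) (F0 : E -> C) := {
  bt : Oplax (A := LocDisc E) (B := C) F0;
  bd : Oplax (A := LocDisc (Op E)) (B := C) F0;
  bt_pseudo : is_pseudo bt;
  bd_pseudo : is_pseudo bd;
  bk : BeckData bt bd;
  bk_horiz : forall (X1 X2 Y Z P1 P2 : E) (f1 : chom E X1 Z) (f2 : chom E X2 X1)
    (g : chom E Y Z) (g' : chom E P1 X1) (g'' : chom E P2 X2)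
    (f1' : chom E P1 Y) (f2' : chom E P2 P1)
    (H2 : is_pullback f2 g' g'' f2') (H1 : is_pullback f1 g g' f1')
    (H : is_pullback (f2 >> f1) g g'' (f2' >> f1')),
    (id2 (o1 bd g'') ** phi bt f2' f1')
      >=> assocV (o1 bd g'') (o1 bt f2') (o1 bt f1')
      >=> (bk H2 ** id2 (o1 bt f1'))
      >=> assoc (o1 bt f2) (o1 bd g') (o1 bt f1')
      >=> (id2 (o1 bt f2) ** bk H1)
      >=> assocV (o1 bt f2) (o1 bt f1) (o1 bd g)
      >=> (phiV bt_pseudo f2 f1 ** id2 (o1 bd g))
    = bk H;
  bk_vert : forall (X Y1 Y2 Z P1 P2 : E) (g1 : chom E Y1 Z) (g2 : chom E Y2 Y1)
    (f : chom E X Z) (f' : chom E P1 Y1) (f'' : chom E P2 Y2)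
    (g1' : chom E P1 X) (g2' : chom E P2 P1)
    (H2 : is_pullback f' g2 g2' f'') (H1 : is_pullback f g1 g1' f')
    (H : is_pullback f (g2 >> g1) (g2' >> g1') f''),
    (phi bd g1' g2' ** id2 (o1 bt f''))
      >=> assoc (o1 bd g1') (o1 bd g2') (o1 bt f'')
      >=> (id2 (o1 bd g1') ** bk H2)
      >=> assocV (o1 bd g1') (o1 bt f') (o1 bd g2)
      >=> (bk H1 ** id2 (o1 bd g2))
      >=> assoc (o1 bt f) (o1 bd g1) (o1 bd g2)
      >=> (id2 (o1 bt f) ** phiV bd_pseudo g1 g2)
    = bk H;
  bk_horiz0 : forall (X Y : E) (f : chom E X Y)
    (H : is_pullback f (cid Y) (cid X) f),
    lunitV (o1 bt f)
      >=> (lamV bd_pseudo X ** id2 (o1 bt f))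
      >=> bk H
      >=> (id2 (o1 bt f) ** lam bd Y)
      >=> runit (o1 bt f)
    = id2 (o1 bt f);
  bk_vert0 : forall (X Y : E) (g : chom E X Y)
    (H : is_pullback (cid Y) g g (cid X)),
    runitV (o1 bd g)
      >=> (id2 (o1 bd g) ** lamV bt_pseudo X)
      >=> bk H
      >=> (lam bt Y ** id2 (o1 bd g))
      >=> lunit (o1 bd g)
    = id2 (o1 bd g)
}.

Arguments bk {_ _ _} _ {_ _ _ _ _ _ _ _} _.

Record LaxBeckMor (E : Category) (C : Bicategory) (F0 : E -> C)
    (F G : LaxBeckPairOver F0) := {
  mt : Icon (bt F) (bt G);
  md : Icon (bd F) (bd G);
  m_bk : forall (X Y Z P : E) (f : chom E X Z) (g : chom E Y Z)
    (g' : chom E P X) (f' : chom E P Y) (H : is_pullback f g g' f'),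
    (ic md g' ** ic mt f') >=> bk G H = bk F H >=> (ic mt f ** ic md g)
}.

Lemma lax_beck_mor_ext (E : Category) (C : Bicategory) (F0 : E -> C)
    (F G : LaxBeckPairOver F0) (a b : LaxBeckMor F G) :
  mt a = mt b -> md a = md b -> a = b.
Proof.
case: a b => [a1 a2 a3] [b1 b2 b3] /= e1 e2; destruct e1, e2.
by f_equal; apply: proof_irrelevance.
Qed.

Definition lax_beck_id (E : Category) (C : Bicategory) (F0 : E -> C)
    (F : LaxBeckPairOver F0) : LaxBeckMor F F.
Proof.
exists (icon_id (bt F)) (icon_id (bd F)) => * /=.
by rewrite !hcomp_id vidl vidr.
Defined.

Definition lax_beck_comp (E : Category) (C : Bicategory) (F0 : E -> C)
    (F G H : LaxBeckPairOver F0) (a : LaxBeckMor F G) (b : LaxBeckMor G H) :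
  LaxBeckMor F H.
Proof.
exists (icon_comp (mt a) (mt b)) (icon_comp (md a) (md b)) => * /=.
by rewrite !hcomp_vcomp vassoc m_bk -vassoc m_bk vassoc.
Defined.

Definition LaxBeckPairFib (E : Category) (C : Bicategory) (F0 : E -> C) : Category.
Proof.
refine {| cob := LaxBeckPairOver F0; chom := @LaxBeckMor E C F0;
  cid := @lax_beck_id E C F0; ccomp := @lax_beck_comp E C F0 |};
intros; apply: lax_beck_mor_ext; apply: icon_ext => ? ? ? /=.
- abstract (exact: vidl).
- abstract (exact: vidl).
- abstract (exact: vidr).
- abstract (exact: vidr).
- abstract (exact: vassoc).
- abstract (exact: vassoc).
Defined.

(* The objects contain two pseudofunctors with the same function on objects. *)
Definition LaxBeckPair (E : Category) (C : Bicategory) : Category :=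
  TotalCat (@LaxBeckPairFib E C).

Definition is_beck (E : Category) (C : Bicategory) (F0 : E -> C)
    (F : LaxBeckPairOver F0) : Prop :=
  forall (X Y Z P : E) (f : chom E X Z) (g : chom E Y Z)
    (g' : chom E P X) (f' : chom E P Y) (H : is_pullback f g g' f'),
  is_inv2 (bk F H).

Definition BeckPair (E : Category) (C : Bicategory) : Category :=
  TotalCat (fun F0 : E -> C => FullSub (A := LaxBeckPairFib F0) (@is_beck E C F0)).

Definition F_beck (E : Category) (P : ChosenPullbacks E) (C : Bicategory)
    (F0 : E -> C) (F : Oplax (A := SpanIso P) (B := C) F0)
    (Hs : forall (X Y T : E) (s : chom E T X) (t : chom E T Y),
      is_inv2 (F_split F s t)) : BeckData (F_tens F) (F_delt F) :=
  fun X Y Z Q f g g' f' H =>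
    inv2 (Hs X Y Q g' f')
      >=> o2 F (base_change_cell P H)
      >=> phi F (tens_sp f) (delt_sp g).

Lemma rea3 (B : Bicategory) (X Y : B) (f g h k : hom1 B X Y) (a : hom2 f g)
    (b : hom2 g h) (c : hom2 h k) (d : hom2 f k) :
  a >=> b >=> c = d -> forall l (x : hom2 k l), a >=> (b >=> (c >=> x)) = d >=> x.
Proof. by move=> <- l x; rewrite !vassoc. Qed.

Lemma inv2_cancell (B : Bicategory) (X Y : B) (f g h : hom1 B X Y) (a : hom2 f g)
    (b c : hom2 g h) : is_inv2 a -> a >=> b = a >=> c -> b = c.
Proof.
move=> [a' [_ a'K]] e.
by rewrite -(vidl b) -(vidl c) -a'K !vassoc e.
Qed.

Lemma phi_assocV (A B : Bicategory) (F0 : A -> B) (F : Oplax F0) (X Y Z W : A)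
    (f : hom1 A X Y) (g : hom1 A Y Z) (h : hom1 A Z W) :
  phi F f (g ;; h) >=> (id2 (o1 F f) ** phi F g h)
    >=> assocV (o1 F f) (o1 F g) (o1 F h)
  = o2 F (assocV f g h) >=> phi F (f ;; g) h >=> (phi F f g ** id2 (o1 F h)).
Proof.
apply: (@inv2_cancell _ _ _ _ _ _ (o2 F (assoc f g h))).
  by apply: is_inv2_o2; exists (assocV f g h); rewrite assocK assocVK.
rewrite -!vassoc -o2_vcomp assocK o2_id vidl -phi_assoc.
by rewrite !vassoc assocK vidr.
Qed.

Lemma paste_horiz (A B : Bicategory) (F0 : A -> B) (F : Oplax F0)
    (X1 X2 X3 X4 X5 X6 : A) (p : hom1 A X1 X2) (q : hom1 A X2 X3) (r : hom1 A X3 X4)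
    (q' : hom1 A X1 X5) (p' : hom1 A X5 X3) (r' : hom1 A X5 X6)
    (p'' : hom1 A X6 X4) (qr : hom1 A X2 X4) (qr' : hom1 A X1 X6)
    (m : hom2 qr (q ;; r)) (m' : hom2 qr' (q' ;; r'))
    (t1 : hom2 (p ;; q) (q' ;; p')) (t2 : hom2 (p' ;; r) (r' ;; p''))
    (t : hom2 (p ;; qr) (qr' ;; p''))
    (b1 : hom2 (o1 F p ;; o1 F q) (o1 F q' ;; o1 F p'))
    (b2 : hom2 (o1 F p' ;; o1 F r) (o1 F r' ;; o1 F p''))
    (b : hom2 (o1 F p ;; o1 F qr) (o1 F qr' ;; o1 F p''))
    (v : hom2 (o1 F q' ;; o1 F r') (o1 F qr')) :
  is_inv2 (phi F p qr) ->
  phi F p q >=> b1 = o2 F t1 >=> phi F q' p' ->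
  phi F p' r >=> b2 = o2 F t2 >=> phi F r' p'' ->
  phi F p qr >=> b = o2 F t >=> phi F qr' p'' ->
  (o2 F m' >=> phi F q' r') >=> v = id2 _ ->
  (id2 p ** m) >=> assocV p q r >=> (t1 ** id2 r) >=> assoc q' p' r
    >=> (id2 q' ** t2) >=> assocV q' r' p''
  = t >=> (m' ** id2 p'') ->
  (id2 (o1 F p) ** (o2 F m >=> phi F q r)) >=> assocV _ _ _
    >=> (b1 ** id2 _) >=> assoc _ _ _ >=> (id2 _ ** b2) >=> assocV _ _ _
    >=> (v ** id2 _)
  = b.
Proof.
move=> Hi e1 e2 e ev et; apply: (inv2_cancell Hi).
rewrite e whiskl_vcomp !vassoc (rea (phi_natr _ _ _)) !vassoc.
rewrite (rea3 (phi_assocV _ _ _ _)) !vassoc.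
rewrite (rea (eq_sym (whiskr_vcomp _ _ _))) e1 whiskr_vcomp.
rewrite !vassoc (rea (phi_natl _ _ _)) !vassoc.
rewrite (rea3 (phi_assoc _ _ _ _)) !vassoc.
rewrite (rea (eq_sym (whiskl_vcomp _ _ _))) e2 whiskl_vcomp.
rewrite !vassoc (rea (phi_natr _ _ _)) !vassoc.
rewrite (rea3 (phi_assocV _ _ _ _)) !vassoc.
rewrite !(rea (eq_sym (o2_vcomp F _ _))) -!vassoc et !vassoc.
rewrite o2_vcomp vassoc -(vassoc (o2 F (m' ** _))) -phi_natl vassoc.
by rewrite -!whiskr_vcomp -(vassoc (o2 F m')) ev hcomp_id vidr.
Qed.

Lemma paste_vert (A B : Bicategory) (F0 : A -> B) (F : Oplax F0)
    (X1 X2 X3 X4 X5 X6 : A) (p : hom1 A X1 X2) (q : hom1 A X2 X3) (r : hom1 A X3 X4)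
    (s : hom1 A X2 X5) (q' : hom1 A X5 X4) (u : hom1 A X1 X6) (p' : hom1 A X6 X5)
    (pq : hom1 A X1 X3) (pq' : hom1 A X6 X4)
    (n : hom2 pq (p ;; q)) (n' : hom2 pq' (p' ;; q'))
    (t1 : hom2 (p ;; s) (u ;; p')) (t2 : hom2 (q ;; r) (s ;; q'))
    (t : hom2 (pq ;; r) (u ;; pq'))
    (b1 : hom2 (o1 F p ;; o1 F s) (o1 F u ;; o1 F p'))
    (b2 : hom2 (o1 F q ;; o1 F r) (o1 F s ;; o1 F q'))
    (b : hom2 (o1 F pq ;; o1 F r) (o1 F u ;; o1 F pq'))
    (v : hom2 (o1 F p' ;; o1 F q') (o1 F pq')) :
  is_inv2 (phi F pq r) ->
  phi F p s >=> b1 = o2 F t1 >=> phi F u p' ->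
  phi F q r >=> b2 = o2 F t2 >=> phi F s q' ->
  phi F pq r >=> b = o2 F t >=> phi F u pq' ->
  (o2 F n' >=> phi F p' q') >=> v = id2 _ ->
  (n ** id2 r) >=> assoc p q r >=> (id2 p ** t2) >=> assocV p s q'
    >=> (t1 ** id2 q') >=> assoc u p' q'
  = t >=> (id2 u ** n') ->
  ((o2 F n >=> phi F p q) ** id2 (o1 F r)) >=> assoc _ _ _
    >=> (id2 _ ** b2) >=> assocV _ _ _ >=> (b1 ** id2 _) >=> assoc _ _ _
    >=> (id2 _ ** v)
  = b.
Proof.
move=> Hi e1 e2 e ev et; apply: (inv2_cancell Hi).
rewrite e whiskr_vcomp !vassoc (rea (phi_natl _ _ _)) !vassoc.
rewrite (rea3 (phi_assoc _ _ _ _)) !vassoc.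
rewrite (rea (eq_sym (whiskl_vcomp _ _ _))) e2 whiskl_vcomp.
rewrite !vassoc (rea (phi_natr _ _ _)) !vassoc.
rewrite (rea3 (phi_assocV _ _ _ _)) !vassoc.
rewrite (rea (eq_sym (whiskr_vcomp _ _ _))) e1 whiskr_vcomp.
rewrite !vassoc (rea (phi_natl _ _ _)) !vassoc.
rewrite (rea3 (phi_assoc _ _ _ _)) !vassoc.
rewrite !(rea (eq_sym (o2_vcomp F _ _))) -!vassoc et !vassoc.
rewrite o2_vcomp vassoc -(vassoc (o2 F (_ ** n'))) -phi_natr vassoc.
by rewrite -!whiskl_vcomp -(vassoc (o2 F n')) ev hcomp_id vidr.
Qed.

Lemma nullary_horiz (A B : Bicategory) (F0 : A -> B) (F : Oplax F0) (X Y : A)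
    (f : hom1 A X Y) (t : hom2 (id1 X ;; f) (f ;; id1 Y))
    (b : hom2 (o1 F (id1 X) ;; o1 F f) (o1 F f ;; o1 F (id1 Y)))
    (v : hom2 (id1 (F0 X)) (o1 F (id1 X))) :
  phi F (id1 X) f >=> b = o2 F t >=> phi F f (id1 Y) ->
  lam F X >=> v = id2 _ ->
  lunitV f >=> t >=> runit f = id2 f ->
  lunitV (o1 F f) >=> (v ** id2 (o1 F f)) >=> b >=> (id2 (o1 F f) ** lam F Y)
    >=> runit (o1 F f) = id2 (o1 F f).
Proof.
move=> e ev et.
have -> : lunitV (o1 F f) >=> (v ** id2 (o1 F f))
          = o2 F (lunitV f) >=> phi F (id1 X) f.
  have <- : o2 F (lunitV f) >=> (phi F (id1 X) f >=> (lam F X ** id2 (o1 F f)))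
            = lunitV (o1 F f).
    rewrite -[LHS]vidr -(lunitK (o1 F f)) -!vassoc.
    rewrite 2!(vassoc (o2 F _)) phi_lunit.
    by rewrite -o2_vcomp lunitVK o2_id vidl.
  by rewrite !vassoc -whiskr_vcomp ev hcomp_id vidr.
rewrite !vassoc (rea e) !vassoc.
have := phi_runit F f; rewrite vassoc => ->.
by rewrite -!o2_vcomp -vassoc et o2_id.
Qed.

Lemma nullary_vert (A B : Bicategory) (F0 : A -> B) (F : Oplax F0) (X Y : A)
    (g : hom1 A X Y) (t : hom2 (g ;; id1 Y) (id1 X ;; g))
    (b : hom2 (o1 F g ;; o1 F (id1 Y)) (o1 F (id1 X) ;; o1 F g))
    (v : hom2 (id1 (F0 Y)) (o1 F (id1 Y))) :
  phi F g (id1 Y) >=> b = o2 F t >=> phi F (id1 X) g ->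
  lam F Y >=> v = id2 _ ->
  runitV g >=> t >=> lunit g = id2 g ->
  runitV (o1 F g) >=> (id2 (o1 F g) ** v) >=> b >=> (lam F X ** id2 (o1 F g))
    >=> lunit (o1 F g) = id2 (o1 F g).
Proof.
move=> e ev et.
have -> : runitV (o1 F g) >=> (id2 (o1 F g) ** v)
          = o2 F (runitV g) >=> phi F g (id1 Y).
  have <- : o2 F (runitV g) >=> (phi F g (id1 Y) >=> (id2 (o1 F g) ** lam F Y))
            = runitV (o1 F g).
    rewrite -[LHS]vidr -(runitK (o1 F g)) -!vassoc.
    rewrite 2!(vassoc (o2 F _)) phi_runit.
    by rewrite -o2_vcomp runitVK o2_id vidl.
  by rewrite !vassoc -whiskl_vcomp ev hcomp_id vidr.
rewrite !vassoc (rea e) !vassoc.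
have := phi_lunit F g; rewrite vassoc => ->.
by rewrite -!o2_vcomp -vassoc et o2_id.
Qed.

Lemma pb_id_legs (E : Category) (P : ChosenPullbacks E) (T : E) :
  lleg (pb P (cid T) (cid T)) = rleg (pb P (cid T) (cid T)).
Proof. by have := pb_sq P (cid T) (cid T); rewrite !cidr. Qed.

Definition unsplit_cell (E : Category) (P : ChosenPullbacks E) (X Y T : E)
    (s : chom E T X) (t : chom E T Y) :
  SpanCell (span_comp P (delt_sp s) (tens_sp t)) (mkSpan s t).
Proof.
exists (lleg (pb P (cid T) (cid T))).
- abstract (by []).
- abstract (by rewrite /= pb_id_legs).
- abstract (exists (sc (split_cell P s t)); split; last exact: pb_medl;
  by apply: pb_ext; rewrite /=; spn; rewrite // pb_id_legs).
Defined.

Definition sq_cell (E : Category) (P : ChosenPullbacks E) (X Y Z Q : E)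
    (f : chom E X Z) (g : chom E Y Z) (p : chom E Q X) (q : chom E Q Y)
    (H : is_pullback f g p q) :
  SpanCell (span_comp P (delt_sp p) (tens_sp q))
           (span_comp P (tens_sp f) (delt_sp g)) :=
  span_cell_comp (unsplit_cell P p q) (base_change_cell P H).

Lemma phi_split (E : Category) (P : ChosenPullbacks E) (C : Bicategory)
    (F0 : E -> C) (F : Oplax (A := SpanIso P) (B := C) F0) (X Y T : E)
    (s : chom E T X) (t : chom E T Y) :
  phi F (delt_sp s) (tens_sp t) = o2 F (unsplit_cell P s t) >=> F_split F s t.
Proof.
rewrite /F_split -vassoc -o2_vcomp.
have -> : @vcomp (SpanIso P) _ _ _ _ _ (unsplit_cell P s t) (split_cell P s t)
          = id2 _.
  apply: span_cell_ext; rewrite /=.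
  by apply: pb_ext; rewrite /=; spn; rewrite // pb_id_legs.
by rewrite o2_id vidl.
Qed.

Lemma phi_split_inv (E : Category) (P : ChosenPullbacks E) (C : Bicategory)
    (F0 : E -> C) (F : Oplax (A := SpanIso P) (B := C) F0)
    (Hs : forall (X Y T : E) (s : chom E T X) (t : chom E T Y),
      is_inv2 (F_split F s t)) (X Y T : E) (s : chom E T X) (t : chom E T Y) :
  is_inv2 (phi F (delt_sp s) (tens_sp t)).
Proof.
rewrite phi_split; apply: is_inv2_vcomp (Hs _ _ _ s t); apply: is_inv2_o2.
exists (split_cell P s t); split; apply: span_cell_ext; rewrite /=.
- by apply: pb_ext; rewrite /=; spn; rewrite // pb_id_legs.
- exact: pb_medl.
Qed.

Lemma F_beckE (E : Category) (P : ChosenPullbacks E) (C : Bicategory)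
    (F0 : E -> C) (F : Oplax (A := SpanIso P) (B := C) F0)
    (Hs : forall (X Y T : E) (s : chom E T X) (t : chom E T Y),
      is_inv2 (F_split F s t)) (X Y Z Q : E) (f : chom E X Z) (g : chom E Y Z)
    (p : chom E Q X) (q : chom E Q Y) (H : is_pullback f g p q) :
  phi F (delt_sp p) (tens_sp q) >=> F_beck Hs H
  = o2 F (sq_cell P H) >=> phi F (tens_sp f) (delt_sp g).
Proof.
rewrite phi_split /F_beck !vassoc.
rewrite (rea3 (inv2K (Hs _ _ _ p q))) vidl.
by rewrite -vassoc -o2_vcomp.
Qed.

Lemma span_cell_is_inv2 (E : Category) (P : ChosenPullbacks E) (X Y : SpanIso P)
    (S T : hom1 (SpanIso P) X Y) (a : hom2 S T) : is_inv2 a.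
Proof.
exists (span_cell_inv a); split; apply: span_cell_ext.
- exact: span_cell_invK.
- exact: span_cell_invVK.
Qed.

Definition greg_beck_of (E : Category) (P : ChosenPullbacks E) (C : Bicategory)
    (F0 : E -> C) (F : Oplax (A := SpanIso P) (B := C) F0)
    (Ht : is_pseudo (F_tens F)) (Hd : is_pseudo (F_delt F))
    (Hs : forall (X Y T : E) (s : chom E T X) (t : chom E T Y),
      is_inv2 (F_split F s t)) : LaxBeckPairOver F0.
Proof.
refine (@Build_LaxBeckPairOver E C F0 (F_tens F) (F_delt F) Ht Hd (F_beck Hs)
  _ _ _ _).
- abstract (move=> X1 X2 Y Z P1 P2 f1 f2 g g' g'' f1' f2' H2 H1 H;
  apply: (paste_horiz (F := F) (phi_split_inv Hs g'' (f2' >> f1'))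
    (F_beckE Hs H2) (F_beckE Hs H1) (F_beckE Hs H)
    (inv2K (proj2 Ht _ _ _ f2 f1)));
  apply: span_cell_ext; rewrite /=;
  apply: pb_ext; [apply: pb_ext|]; rewrite /=; spn; rewrite //;
  by rewrite (is_pullback_sq H2)).
- abstract (move=> X Y1 Y2 Z P1 P2 g1 g2 f f' f'' g1' g2' H2 H1 H;
  apply: (paste_vert (F := F) (phi_split_inv Hs (g2' >> g1') f'')
    (F_beckE Hs H1) (F_beckE Hs H2) (F_beckE Hs H)
    (inv2K (proj2 Hd _ _ _ g1 g2)));
  apply: span_cell_ext; rewrite /=;
  apply: pb_ext; [|apply: pb_ext]; rewrite /=; spn; rewrite ?pb_id_legs //;
  by rewrite (is_pullback_sq H2)).
- abstract (move=> X Y f H;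
  have Hv : lam F X >=> lamV Hd X = id2 _;
    first (have <- : lam (F_delt F) X = lam F X;
      [by rewrite /= o2_id vidl | exact: inv2K]);
  have := nullary_horiz (F := F) (F_beckE Hs H) Hv;
  rewrite /= !o2_id !vidl; apply; apply: span_cell_ext; by rewrite /=; spn).
- abstract (move=> X Y g H;
  have Hv : lam F X >=> lamV Ht X = id2 _;
    first (have <- : lam (F_tens F) X = lam F X;
      [by rewrite /= o2_id vidl | exact: inv2K]);
  have := nullary_vert (F := F) (F_beckE Hs H) Hv;
  rewrite /= !o2_id !vidl; apply; apply: span_cell_ext; by rewrite /=; spn).
Defined.

Definition greg_beck (E : Category) (P : ChosenPullbacks E) (C : Bicategory)
    (F0 : E -> C) (F : GregFib P F0) : LaxBeckPairFib F0 :=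
  greg_beck_of (proj1 (proj2 (proj2_sig F))) (proj1 (proj2 (proj2 (proj2_sig F))))
    (proj2 (proj2 (proj2 (proj2_sig F)))).

Lemma F_beck_mor (E : Category) (P : ChosenPullbacks E) (C : Bicategory)
    (F0 : E -> C) (F G : Oplax (A := SpanIso P) (B := C) F0) (a : Icon F G)
    (HF : forall (X Y T : E) (s : chom E T X) (t : chom E T Y),
      is_inv2 (F_split F s t))
    (HG : forall (X Y T : E) (s : chom E T X) (t : chom E T Y),
      is_inv2 (F_split G s t)) (X Y Z Q : E) (f : chom E X Z) (g : chom E Y Z)
    (p : chom E Q X) (q : chom E Q Y) (H : is_pullback f g p q) :
  (ic a (delt_sp p) ** ic a (tens_sp q)) >=> F_beck HG H
  = F_beck HF H >=> (ic a (tens_sp f) ** ic a (delt_sp g)).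
Proof.
apply: (inv2_cancell (phi_split_inv HF p q)).
rewrite -!vassoc -ic_phi.
transitivity (o2 F (sq_cell P H) >=> phi F (tens_sp f) (delt_sp g)
  >=> (ic a (tens_sp f) ** ic a (delt_sp g))).
  rewrite [RHS]vassoc -ic_phi -[RHS]vassoc ic_nat !vassoc.
  apply: (f_equal (fun x => ic a _ >=> x)).
  by rewrite -(F_beckE HG H) /F_beck !vassoc.
by rewrite -(F_beckE HF H) /F_beck !vassoc.
Qed.

Definition greg_beck_mor (E : Category) (P : ChosenPullbacks E) (C : Bicategory)
    (F0 : E -> C) (F G : GregFib P F0) (a : chom (GregFib P F0) F G) :
  chom (LaxBeckPairFib F0) (greg_beck F) (greg_beck G) :=
  Build_LaxBeckMor (F := greg_beck F) (G := greg_beck G)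
    (mt := icon_restr (tens P) a) (md := icon_restr (delt P) a)
    (fun X Y Z Q f g p q H => F_beck_mor a _ _ H).

Definition TensDeltFib (E : Category) (P : ChosenPullbacks E) (C : Bicategory)
    (F0 : E -> C) : Functor (GregFib P F0) (LaxBeckPairFib F0).
Proof.
refine (@Build_Functor (GregFib P F0) (LaxBeckPairFib F0) (@greg_beck E P C F0)
  (@greg_beck_mor E P C F0) _ _).
- abstract (by move=> F; apply: lax_beck_mor_ext; apply: icon_ext).
- abstract (by move=> F G H a b; apply: lax_beck_mor_ext; apply: icon_ext).
Defined.

Definition TensDelt (E : Category) (P : ChosenPullbacks E) (C : Bicategory) :
  Functor (Greg P C) (LaxBeckPair E C) :=
  TotalFunctor (@TensDeltFib E P C).

Lemma pseudo_greg (E : Category) (P : ChosenPullbacks E) (C : Bicategory)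
    (F0 : E -> C) (F : Oplax (A := SpanIso P) (B := C) F0) :
  is_pseudo F -> is_greg F.
Proof.
move=> [Fl Fp]; split; first by split=> // *; apply: Fp.
split; [|split]; [split|split|].
- move=> X; apply: is_inv2_vcomp (Fl X); apply: is_inv2_o2; exact: is_inv2_id.
- move=> X Y Z f g; apply: is_inv2_vcomp (Fp _ _ _ _ _); apply: is_inv2_o2.
  exact: span_cell_is_inv2.
- move=> X; apply: is_inv2_vcomp (Fl X); apply: is_inv2_o2; exact: is_inv2_id.
- move=> X Y Z f g; apply: is_inv2_vcomp (Fp _ _ _ _ _); apply: is_inv2_o2.
  exact: span_cell_is_inv2.
- move=> X Y T s t; apply: is_inv2_vcomp (Fp _ _ _ _ _); apply: is_inv2_o2.
  exact: span_cell_is_inv2.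
Qed.

Definition IconToGregFib (E : Category) (P : ChosenPullbacks E) (C : Bicategory)
    (F0 : E -> C) :
  Functor (FullSub (A := IconFib (A := SpanIso P) (B := C) F0)
             (@is_pseudo (SpanIso P) C F0)) (GregFib P F0) :=
  full_incl (A := IconFib (A := SpanIso P) (B := C) F0)
    (P := @is_pseudo (SpanIso P) C F0) (Q := @is_greg E P C F0)
    (@pseudo_greg E P C F0).

Lemma pseudo_is_beck (E : Category) (P : ChosenPullbacks E) (C : Bicategory)
    (F0 : E -> C)
    (F : FullSub (A := IconFib (A := SpanIso P) (B := C) F0)
           (@is_pseudo (SpanIso P) C F0)) :
  is_beck (functor_comp (IconToGregFib P F0) (TensDeltFib P F0) F).
Proof.
move=> X Y Z Q f g g' f' H; apply: is_inv2_vcomp.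
- apply: is_inv2_vcomp; first exact: is_inv2_inv.
  apply: is_inv2_o2; exact: span_cell_is_inv2.
- exact: (proj2 (proj2_sig F)).
Qed.

Definition TensDeltPseudo (E : Category) (P : ChosenPullbacks E) (C : Bicategory) :
  Functor (IconCat (SpanIso P) C) (BeckPair E C) :=
  TotalFunctor (fun F0 => full_lift (@pseudo_is_beck E P C F0)).

Definition GregIncl (E : Category) (P : ChosenPullbacks E) (C : Bicategory) :
  Functor (IconCat (SpanIso P) C) (Greg P C) :=
  TotalFunctor (@IconToGregFib E P C).

Definition BeckIncl (E : Category) (C : Bicategory) :
  Functor (BeckPair E C) (LaxBeckPair E C) :=
  TotalFunctor (fun F0 : E -> C =>
    full_forget (A := LaxBeckPairFib F0) (@is_beck E C F0)).

(* Main.v *)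
(** A span [(s,t)] is the composite [(s,1);(1,t)], so a functor in Greg is determined by
    its restrictions [d] along [(-)_Delta] and [t] along [(-)_tensor] together with its
    constraints at the pairs [(1,f),(g,1)], which amount to the Beck cells. Conversely a lax
    Beck pair is glued to the functor [S |-> d (lleg S);; t (rleg S)]: its oplax constraint
    splits the legs of a composite span and applies the Beck cell of the chosen pullback,
    and an isomorphism [k] of spans acts by the Beck cell [d k;; t k => 1] of the square
    with sides [k, k, 1, 1]. Functoriality, naturality and associativity of the glued data
    all reduce to pasting of pullback squares: writing a square [(f, g; p, q)] with an
    invertible [k] inserted at one corner as a pasting expresses its Beck cell by the
    original one and the cell of [k]. *)

Require Import Defs.
From Stdlib Require Import ssreflect FunctionalExtensionality ProofIrrelevance
  IndefiniteDescription.

Set Implicit Arguments.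
Unset Strict Implicit.
Unset Printing Implicit Defensive.


(** * Strictification *)

(** Three obstacles shape the proof. Pasting takes place in an arbitrary bicategory, where
    associators and unitors would swamp every calculation; a 2-cell is therefore replaced by its
    whiskerings with arbitrary [h], transported to left-bracketed composites, where the structural
    cells become identities. Beck cells need not be invertible and cannot be cancelled at will: the
    inverses in the axioms are moved across the equations until only splittings, units and Beck
    cells occur, and invertibility is earned where it is required. Isomorphisms of spans act
    functorially, hence invertibly; so contractions are invertible, and so are the Beck cells of
    squares whose right side [g] is invertible. This is what gregariousness asks for, because a span
    with a right adjoint has an invertible left leg. Finally, legs agree only up to propositional
    equality and vertices only up to the choice of pullback, so the cells take equations and
    arbitrary pullback squares as parameters. Icons fix the function on objects; unit and counit are
    built over one such function and assembled at the end. *)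

Fact st_key : unit.
Proof. exact: tt. Qed.

Section Strictification.

Context {C : Bicategory}.

Inductive tree : C -> C -> Type :=
| Lf X Y (f : hom1 C X Y) : tree X Y
| Un X : tree X X
| Nd X Y Z (a : tree X Y) (b : tree Y Z) : tree X Z.

Fixpoint ev X Y (t : tree X Y) : hom1 C X Y :=
  match t in tree X Y return hom1 C X Y with
  | Lf f => f
  | Un X => id1 X
  | Nd a b => ev a ;; ev b
  end.

(* Composing a 1-cell [h] with a bracketed word, bracketed to the left.  Since
   [act (Nd (Nd a b) c) h] and [act (Nd a (Nd b c)) h] are convertible, a 2-cell that is
   transported to such composites (see [st] below) no longer sees associators and units. *)
Fixpoint act W X Y (t : tree X Y) : hom1 C W X -> hom1 C W Y :=
  match t in tree X Y return hom1 C W X -> hom1 C W Y with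
  | Lf f => fun h => h ;; f
  | Un X => fun h => h
  | Nd a b => fun h => act b (act a h)
  end.

Fixpoint act2 W X Y (t : tree X Y) :
    forall h h' : hom1 C W X, hom2 h h' -> hom2 (act t h) (act t h') :=
  match t in tree X Y
    return forall h h' : hom1 C W X, hom2 h h' -> hom2 (act t h) (act t h') with
  | Lf f => fun h h' x => x ** id2 f
  | Un X => fun h h' x => x
  | Nd a b => fun h h' x => act2 b (act2 a x)
  end.

(** No general coherence theorem enters: invertibility and naturality in [h] of this rebracketing
    follow by induction, and the pentagon and triangle are used only once per structural cell. *)
Fixpoint can W X Y (t : tree X Y) : forall h : hom1 C W X,
    hom2 (h ;; ev t) (act t h) :=
  match t in tree X Y return forall h : hom1 C W X, hom2 (h ;; ev t) (act t h) with
  | Lf f => fun h => id2 (h ;; f)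
  | Un X => fun h => runit h
  | Nd a b => fun h =>
      assocV h (ev a) (ev b) >=> (can a h ** id2 (ev b)) >=> can b (act a h)
  end.

Fixpoint canV W X Y (t : tree X Y) : forall h : hom1 C W X,
    hom2 (act t h) (h ;; ev t) :=
  match t in tree X Y return forall h : hom1 C W X, hom2 (act t h) (h ;; ev t) with
  | Lf f => fun h => id2 (h ;; f)
  | Un X => fun h => runitV h
  | Nd a b => fun h =>
      canV b (act a h) >=> (canV a h ** id2 (ev b)) >=> assoc h (ev a) (ev b)
  end.

Lemma canK W X Y (t : tree X Y) (h : hom1 C W X) : can t h >=> canV t h = id2 _.
Proof.
elim: t h => [X' Y' f|X'|X' Y' Z a IHa b IHb] h /=.
- exact: vidl.
- exact: runitK.
- rewrite !vassoc (rea (IHb _)) vidl (rea (eq_sym (whiskr_vcomp _ _ _))) IHa.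
  by rewrite hcomp_id vidl assocVK.
Qed.

Lemma canVK W X Y (t : tree X Y) (h : hom1 C W X) : canV t h >=> can t h = id2 _.
Proof.
elim: t h => [X' Y' f|X'|X' Y' Z a IHa b IHb] h /=.
- exact: vidl.
- exact: runitVK.
- rewrite !vassoc (rea (assocK _ _ _)) vidl.
  by rewrite (rea (eq_sym (whiskr_vcomp _ _ _))) IHa hcomp_id vidl.
Qed.

Lemma interchange X Y Z (f f' : hom1 C X Y) (g g' : hom1 C Y Z)
    (a : hom2 f f') (b : hom2 g g') :
  (a ** id2 g) >=> (id2 f' ** b) = (id2 f ** b) >=> (a ** id2 g').
Proof. by rewrite -!hcomp_vcomp !vidl !vidr. Qed.

Lemma hcompE X Y Z (f f' : hom1 C X Y) (g g' : hom1 C Y Z)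
    (a : hom2 f f') (b : hom2 g g') :
  a ** b = (a ** id2 g) >=> (id2 f' ** b).
Proof. by rewrite -hcomp_vcomp vidl vidr. Qed.

Lemma assocV_nat X Y Z W (f f' : hom1 C X Y) (g g' : hom1 C Y Z) (h h' : hom1 C Z W)
    (a : hom2 f f') (b : hom2 g g') (c : hom2 h h') :
  (a ** (b ** c)) >=> assocV f' g' h' = assocV f g h >=> ((a ** b) ** c).
Proof.
rewrite -[LHS]vidl -(assocVK f g h) -[RHS]vidr -(assocK f' g' h') !vassoc.
by rewrite (rea (assoc_nat _ _ _)) !vassoc.
Qed.

Lemma act2_id W X Y (t : tree X Y) (h : hom1 C W X) : act2 t (id2 h) = id2 _.
Proof.
elim: t h => [X' Y' f|X'|X' Y' Z a IHa b IHb] h //=; first exact: hcomp_id.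
by rewrite IHa.
Qed.

Lemma can_nat W X Y (t : tree X Y) (h h' : hom1 C W X) (x : hom2 h h') :
  (x ** id2 (ev t)) >=> can t h' = can t h >=> act2 t x.
Proof.
elim: t h h' x => [X' Y' f|X'|X' Y' Z a IHa b IHb] h h' x /=.
- by rewrite vidl vidr.
- exact: runit_nat.
- rewrite -hcomp_id -!vassoc assocV_nat !vassoc (rea (eq_sym (whiskr_vcomp _ _ _))).
  by rewrite IHa whiskr_vcomp !vassoc IHb.
Qed.

Lemma canV_nat W X Y (t : tree X Y) (h h' : hom1 C W X) (x : hom2 h h') :
  act2 t x >=> canV t h' = canV t h >=> (x ** id2 (ev t)).
Proof.
rewrite -[LHS]vidl -(canVK t h) -[RHS]vidr -(canK t h') !vassoc.
by rewrite (rea (can_nat _ _)) !vassoc.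
Qed.

(* [st] is stuck on an opaque constant so that matching does not unfold it. *)
Definition st W X Y (t t' : tree X Y) (a : hom2 (ev t) (ev t')) (h : hom1 C W X) :
    hom2 (act t h) (act t' h) :=
  match st_key with tt => canV t h >=> (id2 h ** a) >=> can t' h end.

Arguments st {W X Y} t t' a h.

Lemma stE W X Y (t t' : tree X Y) (a : hom2 (ev t) (ev t')) (h : hom1 C W X) :
  st t t' a h = canV t h >=> (id2 h ** a) >=> can t' h.
Proof. by rewrite /st; case: st_key. Qed.

Lemma st_id W X Y (t : tree X Y) (h : hom1 C W X) : st t t (id2 _) h = id2 _.
Proof. by rewrite stE hcomp_id vidr canVK. Qed.

Lemma st_vcomp W X Y (t t' t'' : tree X Y) (a : hom2 (ev t) (ev t'))
    (b : hom2 (ev t') (ev t'')) (h : hom1 C W X) :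
  st t t'' (a >=> b) h = st t t' a h >=> st t' t'' b h.
Proof. by rewrite !stE whiskl_vcomp !vassoc (rea (canK _ _)) vidl. Qed.

Lemma st_nat W X Y (t t' : tree X Y) (a : hom2 (ev t) (ev t')) (h h' : hom1 C W X)
    (x : hom2 h h') : act2 t x >=> st t t' a h' = st t t' a h >=> act2 t' x.
Proof.
rewrite !stE -!vassoc canV_nat !vassoc; congr (_ >=> _).
by rewrite -can_nat -!vassoc; congr (_ >=> _); rewrite interchange.
Qed.

(** The right factor acts at the new target [act t' h], so a horizontal composite turns into a
    vertical one. The associators in the canonical cells of the two nodes cancel, and interchange
    slides [b] past the rebracketing of [t']. *)
Lemma st_hcomp W X Y Z (t t' : tree X Y) (u u' : tree Y Z)
    (a : hom2 (ev t) (ev t')) (b : hom2 (ev u) (ev u')) (h : hom1 C W X) :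
  st (Nd t u) (Nd t' u') (a ** b) h = act2 u (st t t' a h) >=> st u u' b (act t' h).
Proof.
rewrite (@stE _ _ _ (Nd t u)) (@stE _ _ _ u) /= !vassoc.
rewrite -(vassoc (act2 u _)) canV_nat !vassoc; congr (_ >=> _).
rewrite stE !whiskr_vcomp !vassoc; congr (_ >=> _).
rewrite (rea (eq_sym (assoc_nat _ _ _))) !vassoc (rea (assocK _ _ _)) vidl.
rewrite -(vassoc _ (id2 _ ** b)) interchange vassoc -vassoc.
by rewrite hcompE !vassoc.
Qed.

Lemma can_st W X Y (t t' : tree X Y) (a : hom2 (ev t) (ev t')) (h : hom1 C W X) :
  id2 h ** a = can t h >=> st t t' a h >=> canV t' h.
Proof. by rewrite stE !vassoc canK vidr (rea (canK _ _)) vidl. Qed.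

(** The case [h = id1 X] suffices: naturality of the left unitor recovers a 2-cell from its
    whiskering with an identity. *)
Lemma st_faithful X Y (t t' : tree X Y) (a b : hom2 (ev t) (ev t')) :
  (forall W (h : hom1 C W X), st t t' a h = st t t' b h) -> a = b.
Proof.
move=> /(_ _ (id1 X)) e.
have {}e : id2 (id1 X) ** a = id2 (id1 X) ** b by rewrite !can_st e.
apply: (@inv2_cancell _ _ _ _ _ _ (lunit (ev t))).
  by exists (lunitV (ev t)); rewrite lunitK lunitVK.
by rewrite -!lunit_nat e.
Qed.

(** The cells [can] are built from [assocV], so the pentagon is needed with all sides but one
    inverted. *)
Lemma pentagonV X Y Z W V (f : hom1 C X Y) (g : hom1 C Y Z) (h : hom1 C Z W)
    (k : hom1 C W V) :
  (id2 f ** assoc g h k) >=> assocV f g (h ;; k) >=> assocV (f ;; g) h k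
  = assocV f (g ;; h) k >=> (assocV f g h ** id2 k).
Proof.
apply: (@inv2_cancell _ _ _ _ _ _ ((assoc f g h ** id2 k) >=> assoc f (g ;; h) k)).
  apply: is_inv2_vcomp; first (apply: is_inv2_hcomp; last exact: is_inv2_id);
  eexists; split; [exact: assocK|exact: assocVK|exact: assocK|exact: assocVK].
rewrite !vassoc (rea (assocK _ _ _)) vidl -whiskr_vcomp assocK hcomp_id.
have p := pentagon f g h k; rewrite -2!vassoc (vassoc (_ ** _)) -p.
by rewrite !vassoc (rea (assocK _ _ _)) vidl assocK.
Qed.

(** Both bracketings have convertible actions, so an identity cell is well typed here; [pentagonV]
    identifies their canonical cells. *)
Lemma st_assoc W X Y Z V (t : tree X Y) (u : tree Y Z) (v : tree Z V)
    (h : hom1 C W X) :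
  st (Nd (Nd t u) v) (Nd t (Nd u v)) (assoc (ev t) (ev u) (ev v)) h = id2 _.
Proof.
transitivity (canV (Nd (Nd t u) v) h >=> can (Nd (Nd t u) v) h);
  last exact: canVK.
rewrite stE vassoc; apply: f_equal; rewrite /= !whiskr_vcomp !vassoc.
rewrite -{1}(hcomp_id (ev u) (ev v)) -(vassoc _ (assocV _ _ _) (_ >=> _)).
rewrite -(vassoc (can t h ** _)) assocV_nat.
by rewrite (vassoc (assocV _ _ _) (_ ** _)) -!vassoc pentagonV.
Qed.

Lemma st_iso W X Y (t t' : tree X Y) (a : hom2 (ev t) (ev t')) (b : hom2 (ev t') (ev t))
    (h : hom1 C W X) : a >=> b = id2 _ ->
  st t t' a h >=> st t' t b h = id2 _.
Proof. by move=> ab; rewrite -st_vcomp ab st_id. Qed.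

Lemma st_assocV W X Y Z V (t : tree X Y) (u : tree Y Z) (v : tree Z V)
    (h : hom1 C W X) :
  st (Nd t (Nd u v)) (Nd (Nd t u) v) (assocV (ev t) (ev u) (ev v)) h = id2 _.
Proof.
rewrite -[LHS]vidr -{1}(st_assoc t u v h).
by rewrite st_iso //; exact: assocVK.
Qed.

(** A coherence law derived from the axioms. Whiskering with an identity is faithful on 2-cells, and
    the whiskered equation follows from the pentagon, two triangles and naturality of [assoc]. *)
Lemma runit_comp W X Y (h : hom1 C W X) (f : hom1 C X Y) :
  assoc h f (id1 Y) >=> (id2 h ** runit f) = runit (h ;; f).
Proof.
suff e : (assoc h f (id1 Y) >=> (id2 h ** runit f)) ** id2 (id1 Y)
         = runit (h ;; f) ** id2 (id1 Y).
  apply: (@inv2_cancell _ _ _ _ _ _ (runit _)).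
    by exists (runitV (h ;; f ;; id1 Y)); rewrite runitK runitVK.
  by rewrite -!runit_nat e.
rewrite -[LHS]vidr -[RHS]vidr -(assocK h f) -!vassoc; congr (_ >=> _).
rewrite whiskr_vcomp !vassoc assoc_nat.
rewrite -[in RHS]triangle -triangle whiskl_vcomp.
have p := pentagon h f (id1 Y) (id1 Y).
rewrite -!vassoc (vassoc (assoc _ _ _ ** _)) -p.
by rewrite !vassoc -assoc_nat hcomp_id.
Qed.

Lemma st_lunit W X Y (t : tree X Y) (h : hom1 C W X) :
  st (Nd (Un X) t) t (lunit (ev t)) h = id2 _.
Proof.
rewrite -[RHS](canVK (Nd (Un X) t) h) stE vassoc; apply: f_equal.
by rewrite /= -triangle -!vassoc assocVK vidl.
Qed.

Lemma st_lunitV W X Y (t : tree X Y) (h : hom1 C W X) :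
  st t (Nd (Un X) t) (lunitV (ev t)) h = id2 _.
Proof.
rewrite -[LHS]vidr -{1}(st_lunit t h); apply: st_iso; exact: lunitVK.
Qed.

Lemma st_runit W X Y (t : tree X Y) (h : hom1 C W X) :
  st (Nd t (Un Y)) t (runit (ev t)) h = id2 _.
Proof.
rewrite -[RHS](canVK (Nd t (Un Y)) h) stE vassoc; apply: f_equal.
by rewrite /= vassoc runit_nat -runit_comp -!vassoc assocVK vidl.
Qed.

Lemma st_runitV W X Y (t : tree X Y) (h : hom1 C W X) :
  st t (Nd t (Un Y)) (runitV (ev t)) h = id2 _.
Proof.
rewrite -[LHS]vidr -{1}(st_runit t h); apply: st_iso; exact: runitVK.
Qed.

End Strictification.

Arguments st {C W X Y} t t' a h.

Ltac reify f :=
  lazymatch f with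
  | comp1 ?a ?b => let a' := reify a in let b' := reify b in constr:(Nd a' b')
  | id1 ?X => constr:(Un X)
  | _ => constr:(Lf f)
  end.

(** Pushes [st] through a pasting down to its generating cells. The middle 1-cell of a vertical
    composite must be reified, since the trees at the two ends do not determine its tree. *)
Ltac strict_step :=
  match goal with
  | |- context [st ?t ?t' (@vcomp _ _ _ _ ?g _ ?a ?b) ?h] =>
      let r := reify g in rewrite (@st_vcomp _ _ _ _ t r t' a b h)
  | |- context [st (Nd ?t ?u) (Nd ?t' ?u') (?a ** ?b) ?h] =>
      rewrite (st_hcomp (t := t) (t' := t') (u := u) (u' := u') a b h)
  | |- context [st ?t ?t (id2 _) ?h] => rewrite (st_id t h)
  | |- context [st (Nd (Nd ?t ?u) ?v) _ (assoc _ _ _) ?h] => rewrite (st_assoc t u v h)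
  | |- context [st (Nd ?t (Nd ?u ?v)) _ (assocV _ _ _) ?h] => rewrite (st_assocV t u v h)
  | |- context [st _ ?t (lunit _) ?h] => rewrite (st_lunit t h)
  | |- context [st ?t _ (lunitV _) ?h] => rewrite (st_lunitV t h)
  | |- context [st _ ?t (runit _) ?h] => rewrite (st_runit t h)
  | |- context [st ?t _ (runitV _) ?h] => rewrite (st_runitV t h)
  end.

Ltac strict_simp := cbn [act act2 ev];
  rewrite ?hcomp_id ?vidl ?vidr ?whiskr_vcomp ?vassoc.

Ltac strict := repeat (strict_step; rewrite ?act2_id ?vidl ?vidr); strict_simp.

Tactic Notation "strictify" ident(V) ident(h) :=
  match goal with
  | |- @eq (hom2 ?f ?g) _ _ =>
      let t := reify f in let t' := reify g in
      apply: (@st_faithful _ _ _ t t'); intros V h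
  end; strict.

(** * Beck cells *)

Lemma loc_disc_irr (E : Category) (X Y : LocDisc E) (f g : hom1 (LocDisc E) X Y)
    (a b : hom2 f g) : a = b.
Proof. exact: (proof_irrelevance (f = g)). Qed.

Section Strict.

Context {E : Category} {C : Bicategory} {F0 : E -> C} (B : LaxBeckPairOver F0).

Local Notation d := (o1 (bd B)).
Local Notation t := (o1 (bt B)).

(* The factorization is an argument because the legs of composite spans are composites
   only up to a propositional equality. *)
Definition split_d (X Y Z : E) (p : chom E X Y) (s : chom E Y Z) (a : chom E X Z)
    (e : a = p >> s) : hom2 (d a) (d s ;; d p) :=
  o2 (bd B) (e : hom2 (a : hom1 (LocDisc (Op E)) Z X) _) >=> phi (bd B) s p.

Definition split_t (X Y Z : E) (q : chom E X Y) (v : chom E Y Z) (b : chom E X Z)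
    (e : b = q >> v) : hom2 (t b) (t q ;; t v) :=
  o2 (bt B) (e : hom2 (b : hom1 (LocDisc E) X Z) _) >=> phi (bt B) q v.

Definition unit_d (X : E) (i : chom E X X) (e : i = cid X) :
    hom2 (d i) (id1 (F0 X)) :=
  o2 (bd B) (e : hom2 (i : hom1 (LocDisc (Op E)) X X) _) >=> lam (bd B) X.

Definition unit_t (X : E) (i : chom E X X) (e : i = cid X) :
    hom2 (t i) (id1 (F0 X)) :=
  o2 (bt B) (e : hom2 (i : hom1 (LocDisc E) X X) _) >=> lam (bt B) X.

Definition dsplit (X Y Z : E) (p : chom E X Y) (s : chom E Y Z) (a : chom E X Z)
    (e : a = p >> s) W (h : hom1 C W (F0 Z)) : hom2 (h ;; d a) (h ;; d s ;; d p) :=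
  st (Lf (d a)) (Nd (Lf (d s)) (Lf (d p))) (split_d e) h.

Definition tsplit (X Y Z : E) (q : chom E X Y) (v : chom E Y Z) (b : chom E X Z)
    (e : b = q >> v) W (h : hom1 C W (F0 X)) : hom2 (h ;; t b) (h ;; t q ;; t v) :=
  st (Lf (t b)) (Nd (Lf (t q)) (Lf (t v))) (split_t e) h.

Definition dunit (X : E) (i : chom E X X) (e : i = cid X) W (h : hom1 C W (F0 X)) :
    hom2 (h ;; d i) h :=
  st (Lf (d i)) (Un _) (unit_d e) h.

Definition tunit (X : E) (i : chom E X X) (e : i = cid X) W (h : hom1 C W (F0 X)) :
    hom2 (h ;; t i) h :=
  st (Lf (t i)) (Un _) (unit_t e) h.

Definition beck (X Y Z P : E) (f : chom E X Z) (g : chom E Y Z)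
    (g' : chom E P X) (f' : chom E P Y) (H : is_pullback f g g' f')
    W (h : hom1 C W (F0 X)) : hom2 (h ;; d g' ;; t f') (h ;; t f ;; d g) :=
  st (Nd (Lf (d g')) (Lf (t f'))) (Nd (Lf (t f)) (Lf (d g))) (bk B H) h.

Lemma dsplit_nat (X Y Z : E) (p : chom E X Y) (s : chom E Y Z) (a : chom E X Z)
    (e : a = p >> s) W (h h' : hom1 C W (F0 Z)) (x : hom2 h h') :
  (x ** id2 (d a)) >=> dsplit e h' = dsplit e h >=> (x ** id2 (d s) ** id2 (d p)).
Proof. exact: (@st_nat _ _ _ _ (Lf (d a)) (Nd (Lf (d s)) (Lf (d p))) (split_d e)). Qed.

Lemma tsplit_nat (X Y Z : E) (q : chom E X Y) (v : chom E Y Z) (b : chom E X Z)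
    (e : b = q >> v) W (h h' : hom1 C W (F0 X)) (x : hom2 h h') :
  (x ** id2 (t b)) >=> tsplit e h' = tsplit e h >=> (x ** id2 (t q) ** id2 (t v)).
Proof. exact: (@st_nat _ _ _ _ (Lf (t b)) (Nd (Lf (t q)) (Lf (t v))) (split_t e)). Qed.

Lemma dunit_nat (X : E) (i : chom E X X) (e : i = cid X) W (h h' : hom1 C W (F0 X))
    (x : hom2 h h') : (x ** id2 (d i)) >=> dunit e h' = dunit e h >=> x.
Proof. exact: (@st_nat _ _ _ _ (Lf (d i)) (Un _) (unit_d e)). Qed.

Lemma tunit_nat (X : E) (i : chom E X X) (e : i = cid X) W (h h' : hom1 C W (F0 X))
    (x : hom2 h h') : (x ** id2 (t i)) >=> tunit e h' = tunit e h >=> x.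
Proof. exact: (@st_nat _ _ _ _ (Lf (t i)) (Un _) (unit_t e)). Qed.

Lemma beck_nat (X Y Z P : E) (f : chom E X Z) (g : chom E Y Z)
    (g' : chom E P X) (f' : chom E P Y) (H : is_pullback f g g' f')
    W (h h' : hom1 C W (F0 X)) (x : hom2 h h') :
  (x ** id2 (d g') ** id2 (t f')) >=> beck H h'
  = beck H h >=> (x ** id2 (t f) ** id2 (d g)).
Proof.
exact: (@st_nat _ _ _ _ (Nd (Lf (d g')) (Lf (t f'))) (Nd (Lf (t f)) (Lf (d g)))
  (bk B H)).
Qed.

(** Stated for an arbitrary proof [e]: eliminating the equations on legs leaves reflexive equations
    whose proofs are not syntactically [eq_refl]. *)
Lemma split_dE (X Y Z : E) (p : chom E X Y) (s : chom E Y Z)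
    (e : p >> s = p >> s) : split_d e = phi (bd B) s p.
Proof.
rewrite /split_d (proof_irrelevance _ e eq_refl) -[RHS]vidl.
congr (_ >=> _); exact: (o2_id (bd B)).
Qed.

Lemma split_tE (X Y Z : E) (q : chom E X Y) (v : chom E Y Z)
    (e : q >> v = q >> v) : split_t e = phi (bt B) q v.
Proof.
rewrite /split_t (proof_irrelevance _ e eq_refl) -[RHS]vidl.
congr (_ >=> _); exact: (o2_id (bt B)).
Qed.

Lemma unit_dE (X : E) (e : cid X = cid X) : unit_d e = lam (bd B) X.
Proof.
rewrite /unit_d (proof_irrelevance _ e eq_refl) -[RHS]vidl.
congr (_ >=> _); exact: (o2_id (bd B)).
Qed.

Lemma unit_tE (X : E) (e : cid X = cid X) : unit_t e = lam (bt B) X.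
Proof.
rewrite /unit_t (proof_irrelevance _ e eq_refl) -[RHS]vidl.
congr (_ >=> _); exact: (o2_id (bt B)).
Qed.

(** The axiom [bk_horiz] with the inverse constraint moved to the right-hand side, so that [phiV]
    disappears, and with composite sides allowed up to an equation. *)
Lemma bk_horiz_split (X1 X2 Y Z P1 P2 : E) (f1 : chom E X1 Z) (f2 : chom E X2 X1)
    (f : chom E X2 Z)
    (g : chom E Y Z) (g' : chom E P1 X1) (g'' : chom E P2 X2)
    (f1' : chom E P1 Y) (f2' : chom E P2 P1) (f' : chom E P2 Y)
    (H2 : is_pullback f2 g' g'' f2') (H1 : is_pullback f1 g g' f1')
    (H : is_pullback f g g'' f') (e : f = f2 >> f1) (e' : f' = f2' >> f1') :
  (id2 (d g'') ** split_t e') >=> assocV _ _ _ >=> (bk B H2 ** id2 (t f1'))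
    >=> assoc _ _ _ >=> (id2 (t f2) ** bk B H1) >=> assocV _ _ _
  = bk B H >=> (split_t e ** id2 (d g)).
Proof.
(* The equations are reversed so that the variables [f] and [f'] are the endpoints that get
   replaced. *)
destruct (eq_sym e), (eq_sym e').
rewrite -(bk_horiz B H2 H1 H) !split_tE.
rewrite (vassoc _ (phiV _ _ _ ** _)) -whiskr_vcomp /phiV inv2VK.
by rewrite hcomp_id vidr.
Qed.

Lemma bk_vert_split (X Y1 Y2 Z P1 P2 : E) (g1 : chom E Y1 Z) (g2 : chom E Y2 Y1)
    (g : chom E Y2 Z)
    (f : chom E X Z) (f' : chom E P1 Y1) (f'' : chom E P2 Y2)
    (g1' : chom E P1 X) (g2' : chom E P2 P1) (g' : chom E P2 X)
    (H2 : is_pullback f' g2 g2' f'') (H1 : is_pullback f g1 g1' f')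
    (H : is_pullback f g g' f'') (e : g = g2 >> g1) (e' : g' = g2' >> g1') :
  (split_d e' ** id2 (t f'')) >=> assoc _ _ _ >=> (id2 (d g1') ** bk B H2)
    >=> assocV _ _ _ >=> (bk B H1 ** id2 (d g2)) >=> assoc _ _ _
  = bk B H >=> (id2 (t f) ** split_d e).
Proof.
destruct (eq_sym e), (eq_sym e').
rewrite -(bk_vert B H2 H1 H) !split_dE.
rewrite (vassoc _ (id2 _ ** phiV _ _ _)) -whiskl_vcomp /phiV inv2VK.
by rewrite hcomp_id vidr.
Qed.

(** The nullary axiom freed of [lamV] in the same way, by cancelling the invertible cells in front
    of the Beck cell. *)
Lemma bk_horiz0_unit (X Y : E) (f : chom E X Y) (i : chom E Y Y) (j : chom E X X)
    (H : is_pullback f i j f) (ei : i = cid Y) (ej : j = cid X) :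
  bk B H >=> (id2 (t f) ** unit_d ei) >=> runit (t f)
  = (unit_d ej ** id2 (t f)) >=> lunit (t f).
Proof.
destruct (eq_sym ei), (eq_sym ej); rewrite !unit_dE.
apply: (@inv2_cancell _ _ _ _ _ _ (lunitV (t f) >=> (lamV (bd_pseudo B) X ** id2 (t f)))).
  apply: is_inv2_vcomp; first by exists (lunit (t f)); rewrite lunitK lunitVK.
  by apply: is_inv2_hcomp; [exact: is_inv2_inv | exact: is_inv2_id].
have e := bk_horiz0 B H; rewrite !vassoc in e; rewrite !vassoc e.
by rewrite (rea (eq_sym (whiskr_vcomp _ _ _))) /lamV inv2VK hcomp_id vidl lunitVK.
Qed.

Lemma bk_vert0_unit (X Y : E) (g : chom E X Y) (i : chom E Y Y) (j : chom E X X)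
    (H : is_pullback i g g j) (ei : i = cid Y) (ej : j = cid X) :
  bk B H >=> (unit_t ei ** id2 (d g)) >=> lunit (d g)
  = (id2 (d g) ** unit_t ej) >=> runit (d g).
Proof.
destruct (eq_sym ei), (eq_sym ej); rewrite !unit_tE.
apply: (@inv2_cancell _ _ _ _ _ _ (runitV (d g) >=> (id2 (d g) ** lamV (bt_pseudo B) X))).
  apply: is_inv2_vcomp; first by exists (runit (d g)); rewrite runitK runitVK.
  by apply: is_inv2_hcomp; [exact: is_inv2_id | exact: is_inv2_inv].
have e := bk_vert0 B H; rewrite !vassoc in e; rewrite !vassoc e.
by rewrite (rea (eq_sym (whiskl_vcomp _ _ _))) /lamV inv2VK hcomp_id vidl runitVK.
Qed.

Lemma split_d_assoc (X Y Z W : E) (p : chom E X Y) (q : chom E Y Z) (r : chom E Z W)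
    (s : chom E Y W) (p' : chom E X Z) (a : chom E X W)
    (e1 : a = p >> s) (e2 : s = q >> r) (e3 : a = p' >> r) (e4 : p' = p >> q) :
  split_d e1 >=> (split_d e2 ** id2 (d p)) >=> assoc _ _ _
  = split_d e3 >=> (id2 (d r) ** split_d e4).
Proof.
destruct (eq_sym e2), (eq_sym e4), (eq_sym e1).
have := phi_assoc (bd B) r q p; rewrite !split_dE => ->.
congr (_ >=> _); congr (_ >=> _); congr (o2 _ _); exact: loc_disc_irr.
Qed.

Lemma split_t_assoc (X Y Z W : E) (p : chom E X Y) (q : chom E Y Z) (r : chom E Z W)
    (s : chom E Y W) (p' : chom E X Z) (a : chom E X W)
    (e1 : a = p >> s) (e2 : s = q >> r) (e3 : a = p' >> r) (e4 : p' = p >> q) :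
  split_t e3 >=> (split_t e4 ** id2 (t r)) >=> assoc _ _ _
  = split_t e1 >=> (id2 (t p) ** split_t e2).
Proof.
destruct (eq_sym e2), (eq_sym e4), (eq_sym e3).
have := phi_assoc (bt B) p q r; rewrite !split_tE => ->.
congr (_ >=> _); congr (_ >=> _); congr (o2 _ _); exact: loc_disc_irr.
Qed.

Lemma split_d_unitl (X Y : E) (i : chom E X X) (a : chom E X Y)
    (e : a = i >> a) (ei : i = cid X) :
  split_d e >=> (id2 (d a) ** unit_d ei) >=> runit (d a) = id2 (d a).
Proof.
destruct (eq_sym ei); rewrite unit_dE /split_d.
rewrite vassoc vassoc -(vassoc (phi _ _ _)) phi_runit -o2_vcomp -o2_id.
congr (o2 _ _); exact: loc_disc_irr.
Qed.

Lemma split_d_unitr (X Y : E) (i : chom E Y Y) (a : chom E X Y)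
    (e : a = a >> i) (ei : i = cid Y) :
  split_d e >=> (unit_d ei ** id2 (d a)) >=> lunit (d a) = id2 (d a).
Proof.
destruct (eq_sym ei); rewrite unit_dE /split_d.
rewrite vassoc vassoc -(vassoc (phi _ _ _)) phi_lunit -o2_vcomp -o2_id.
congr (o2 _ _); exact: loc_disc_irr.
Qed.

Lemma split_t_unitl (X Y : E) (i : chom E X X) (a : chom E X Y)
    (e : a = i >> a) (ei : i = cid X) :
  split_t e >=> (unit_t ei ** id2 (t a)) >=> lunit (t a) = id2 (t a).
Proof.
destruct (eq_sym ei); rewrite unit_tE /split_t.
rewrite vassoc vassoc -(vassoc (phi _ _ _)) phi_lunit -o2_vcomp -o2_id.
congr (o2 _ _); exact: loc_disc_irr.
Qed.

Lemma split_t_unitr (X Y : E) (i : chom E Y Y) (a : chom E X Y)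
    (e : a = a >> i) (ei : i = cid Y) :
  split_t e >=> (id2 (t a) ** unit_t ei) >=> runit (t a) = id2 (t a).
Proof.
destruct (eq_sym ei); rewrite unit_tE /split_t.
rewrite vassoc vassoc -(vassoc (phi _ _ _)) phi_runit -o2_vcomp -o2_id.
congr (o2 _ _); exact: loc_disc_irr.
Qed.

End Strict.

Ltac strict_of e h :=
  match type of e with
  | @eq (hom2 ?f ?g) _ _ =>
      let t := reify f in let t' := reify g in
      have := f_equal (fun x => st t t' x h) e; strict
  end.

(** * The Beck and pseudofunctor axioms in strict form *)

Section StrictAxioms.

Context {E : Category} {C : Bicategory} {F0 : E -> C} (B : LaxBeckPairOver F0).

Local Notation d := (o1 (bd B)).
Local Notation t := (o1 (bt B)).

Lemma beck_horiz (X1 X2 Y Z P1 P2 : E) (f1 : chom E X1 Z) (f2 : chom E X2 X1)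
    (f : chom E X2 Z)
    (g : chom E Y Z) (g' : chom E P1 X1) (g'' : chom E P2 X2)
    (f1' : chom E P1 Y) (f2' : chom E P2 P1) (f' : chom E P2 Y)
    (H2 : is_pullback f2 g' g'' f2') (H1 : is_pullback f1 g g' f1')
    (H : is_pullback f g g'' f') (e : f = f2 >> f1) (e' : f' = f2' >> f1')
    W (h : hom1 C W (F0 X2)) :
  tsplit B e' (h ;; d g'') >=> ((beck B H2 h ** id2 (t f1')) >=> beck B H1 (h ;; t f2))
  = beck B H h >=> (tsplit B e h ** id2 (d g)).
Proof.
strict_of (bk_horiz_split B H2 H1 H e e') h.
by move=> x; exact: x.
Qed.

Lemma beck_vert (X Y1 Y2 Z P1 P2 : E) (g1 : chom E Y1 Z) (g2 : chom E Y2 Y1)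
    (g : chom E Y2 Z)
    (f : chom E X Z) (f' : chom E P1 Y1) (f'' : chom E P2 Y2)
    (g1' : chom E P1 X) (g2' : chom E P2 P1) (g' : chom E P2 X)
    (H2 : is_pullback f' g2 g2' f'') (H1 : is_pullback f g1 g1' f')
    (H : is_pullback f g g' f'') (e : g = g2 >> g1) (e' : g' = g2' >> g1')
    W (h : hom1 C W (F0 X)) :
  (dsplit B e' h ** id2 (t f''))
    >=> (beck B H2 (h ;; d g1') >=> (beck B H1 h ** id2 (d g2)))
  = beck B H h >=> dsplit B e (h ;; t f).
Proof.
strict_of (bk_vert_split B H2 H1 H e e') h.
by move=> x; exact: x.
Qed.

Lemma beck_unit_d (X Y : E) (f : chom E X Y) (i : chom E Y Y) (j : chom E X X)
    (H : is_pullback f i j f) (ei : i = cid Y) (ej : j = cid X)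
    W (h : hom1 C W (F0 X)) :
  beck B H h >=> dunit B ei (h ;; t f) = dunit B ej h ** id2 (t f).
Proof.
strict_of (bk_horiz0_unit B H ei ej) h.
by move=> x; exact: x.
Qed.

Lemma beck_unit_t (X Y : E) (g : chom E X Y) (i : chom E Y Y) (j : chom E X X)
    (H : is_pullback i g g j) (ei : i = cid Y) (ej : j = cid X)
    W (h : hom1 C W (F0 Y)) :
  beck B H h >=> (tunit B ei h ** id2 (d g)) = tunit B ej (h ;; d g).
Proof.
strict_of (bk_vert0_unit B H ei ej) h.
by move=> x; exact: x.
Qed.

Lemma dsplit_assoc (X Y Z W : E) (p : chom E X Y) (q : chom E Y Z) (r : chom E Z W)
    (s : chom E Y W) (p' : chom E X Z) (a : chom E X W)
    (e1 : a = p >> s) (e2 : s = q >> r) (e3 : a = p' >> r) (e4 : p' = p >> q)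
    V (h : hom1 C V (F0 W)) :
  dsplit B e1 h >=> (dsplit B e2 h ** id2 (d p)) = dsplit B e3 h >=> dsplit B e4 (h ;; d r).
Proof.
strict_of (split_d_assoc B e1 e2 e3 e4) h.
by move=> x; exact: x.
Qed.

Lemma tsplit_assoc (X Y Z W : E) (p : chom E X Y) (q : chom E Y Z) (r : chom E Z W)
    (s : chom E Y W) (p' : chom E X Z) (a : chom E X W)
    (e1 : a = p >> s) (e2 : s = q >> r) (e3 : a = p' >> r) (e4 : p' = p >> q)
    V (h : hom1 C V (F0 X)) :
  tsplit B e3 h >=> (tsplit B e4 h ** id2 (t r)) = tsplit B e1 h >=> tsplit B e2 (h ;; t p).
Proof.
strict_of (split_t_assoc B e1 e2 e3 e4) h.
by move=> x; exact: x.
Qed.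

Lemma dsplit_unitl (X Y : E) (i : chom E X X) (a : chom E X Y)
    (e : a = i >> a) (ei : i = cid X) V (h : hom1 C V (F0 Y)) :
  dsplit B e h >=> dunit B ei (h ;; d a) = id2 (h ;; d a).
Proof.
strict_of (split_d_unitl B e ei) h.
by move=> x; exact: x.
Qed.

Lemma dsplit_unitr (X Y : E) (i : chom E Y Y) (a : chom E X Y)
    (e : a = a >> i) (ei : i = cid Y) V (h : hom1 C V (F0 Y)) :
  dsplit B e h >=> (dunit B ei h ** id2 (d a)) = id2 (h ;; d a).
Proof.
strict_of (split_d_unitr B e ei) h.
by move=> x; exact: x.
Qed.

Lemma tsplit_unitl (X Y : E) (i : chom E X X) (a : chom E X Y)
    (e : a = i >> a) (ei : i = cid X) V (h : hom1 C V (F0 X)) :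
  tsplit B e h >=> (tunit B ei h ** id2 (t a)) = id2 (h ;; t a).
Proof.
strict_of (split_t_unitl B e ei) h.
by move=> x; exact: x.
Qed.

Lemma tsplit_unitr (X Y : E) (i : chom E Y Y) (a : chom E X Y)
    (e : a = a >> i) (ei : i = cid Y) V (h : hom1 C V (F0 X)) :
  tsplit B e h >=> tunit B ei (h ;; t a) = id2 (h ;; t a).
Proof.
strict_of (split_t_unitr B e ei) h.
by move=> x; exact: x.
Qed.

End StrictAxioms.

(** * Pullback squares with identity or invertible sides *)

Lemma pullback_idl (E : Category) (Y Z : E) (g : chom E Y Z) :
  is_pullback (cid Z) g g (cid Y).
Proof.
split=> [|Q a b]; rewrite ?cidl ?cidr // => e.
by exists b; split=> [|u [_]]; rewrite ?cidr.
Qed.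

Lemma pullback_idr (E : Category) (Y Z : E) (g : chom E Y Z) :
  is_pullback g (cid Z) (cid Y) g.
Proof.
split=> [|Q a b]; rewrite ?cidl ?cidr // => e.
by exists a; split=> [|u []]; rewrite ?cidr.
Qed.

Lemma pullback_iso (E : Category) (X Y : E) (k : chom E X Y) :
  is_iso k -> is_pullback (cid Y) (cid Y) k k.
Proof.
move=> [l [kl lk]]; split=> // Q a b; rewrite !cidr => <-.
exists (a >> l); split=> [|u [<- _]]; by rewrite cassoc ?lk ?kl cidr.
Qed.

Lemma pullback_precomp (E : Category) (X Y Z P Q : E) (f : chom E X Z)
    (g : chom E Y Z) (p : chom E P X) (q : chom E P Y) (k : chom E Q P) :
  is_iso k -> is_pullback f g p q -> is_pullback f g (k >> p) (k >> q).
Proof.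
move=> [l [kl lk]] [sq un]; split=> [|R a b e]; first by rewrite !cassoc sq.
have [u [[<- <-] uu]] := un _ _ _ e.
exists (u >> l); split=> [|v [e1 e2]]; first by rewrite !cassoc !(rec lk) !cidl.
by rewrite (uu (v >> k)) ?cassoc // kl cidr.
Qed.

Lemma pullback_legs (E : Category) (X Y Z P Q : E) (f : chom E X Z)
    (g : chom E Y Z) (p : chom E P X) (q : chom E P Y) (k : chom E Q P)
    (p' : chom E Q X) (q' : chom E Q Y) :
  is_iso k -> is_pullback f g p q -> k >> p = p' -> k >> q = q' ->
  is_pullback f g p' q'.
Proof. by move=> ki H <- <-; exact: pullback_precomp. Qed.

Lemma pullback_iso_l (E : Category) (X Y Q : E) (p : chom E X Y) (k : chom E Q X) :
  is_iso k -> is_pullback (cid Y) p (k >> p) k.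
Proof.
move=> ki; have := pullback_precomp ki (pullback_idl p).
by rewrite cidr.
Qed.

Lemma pullback_iso_r (E : Category) (X Y Q : E) (p : chom E X Y) (k : chom E Y Q) :
  is_iso k -> is_pullback k (p >> k) p (cid X).
Proof.
move=> [l [kl _]]; split=> [|R a b]; first by rewrite cidl.
rewrite -cassoc => /(f_equal (fun x => x >> l)); rewrite !cassoc kl !cidr => ->.
by exists b; split=> [|u [_]]; rewrite ?cidr.
Qed.

Lemma pullback_sym (E : Category) (X Y Z P : E) (f : chom E X Z) (g : chom E Y Z)
    (p : chom E P X) (q : chom E P Y) :
  is_pullback f g p q -> is_pullback g f q p.
Proof.
move=> [sq un]; split=> [//|Q a b e].
have [u [[up uq] uu]] := un _ b a (eq_sym e).
by exists u; split=> [//|v [vp vq]]; apply: uu.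
Qed.

(** The cancellation half of the pasting lemma: the outer and the right squares are pullbacks, hence
    so is the left one. It supplies the middle square in a triple composite of spans. *)
Lemma pullback_unpaste (E : Category) (T U Y Z P P' P2 : E)
    (v : chom E T Z) (w : chom E U Z) (q : chom E P T)
    (p2 : chom E P2 T) (q2 : chom E P2 U)
    (b : chom E P Z) (p' : chom E P' P) (q' : chom E P' U) (m : chom E P' P2) :
  is_pullback v w p2 q2 -> is_pullback b w p' q' -> b = q >> v ->
  m >> p2 = p' >> q -> m >> q2 = q' -> is_pullback q p2 p' m.
Proof.
move=> H2 [_ un] eb e1 e2; split=> [//|R x y e].
have e' : x >> b = (y >> q2) >> w.
  by rewrite eb -cassoc e !cassoc (is_pullback_sq H2).
have [u [[ux uy] uu]] := un _ _ _ e'.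
exists u; split=> [|z [zx zy]].
- split=> //; apply: (pullback_ext H2); first by rewrite cassoc e1 -cassoc ux.
  by rewrite cassoc e2.
- by apply: uu; split=> //; rewrite -e2 -cassoc zy.
Qed.

(** * Beck cells under a change of one corner along an isomorphism *)

Section Contraction.

Context {E : Category} {C : Bicategory} {F0 : E -> C} (B : LaxBeckPairOver F0).

Local Notation d := (o1 (bd B)).
Local Notation t := (o1 (bt B)).

(** Invertibility of [k] is recorded as the pullback property [K], which is directly what a Beck
    cell takes as its argument. *)
Definition contract (X Y : E) (k : chom E X Y) (K : is_pullback (cid Y) (cid Y) k k) :
    hom2 (d k ;; t k) (id1 (F0 Y)) :=
  bk B K >=> (unit_t B eq_refl ** unit_d B eq_refl) >=> lunit (id1 (F0 Y)).

Definition ctr (X Y : E) (k : chom E X Y) (K : is_pullback (cid Y) (cid Y) k k)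
    W (h : hom1 C W (F0 Y)) : hom2 (h ;; d k ;; t k) h :=
  st (Nd (Lf (d k)) (Lf (t k))) (Un _) (contract K) h.

Lemma ctr_nat (X Y : E) (k : chom E X Y) (K : is_pullback (cid Y) (cid Y) k k)
    W (h h' : hom1 C W (F0 Y)) (x : hom2 h h') :
  (x ** id2 (d k) ** id2 (t k)) >=> ctr K h' = ctr K h >=> x.
Proof. exact: (@st_nat _ _ _ _ (Nd (Lf (d k)) (Lf (t k))) (Un _) (contract K)). Qed.

Lemma ctrE (X Y : E) (k : chom E X Y) (K : is_pullback (cid Y) (cid Y) k k)
    W (h : hom1 C W (F0 Y)) :
  ctr K h = beck B K h >=> ((tunit B eq_refl h ** id2 (d (cid Y))) >=> dunit B eq_refl h).
Proof. by rewrite /ctr /contract; strict. Qed.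

Lemma ctrE' (X Y : E) (k : chom E X Y) (K : is_pullback (cid Y) (cid Y) k k)
    W (h : hom1 C W (F0 Y)) :
  ctr K h = beck B K h >=> (dunit B eq_refl (h ;; t (cid Y)) >=> tunit B eq_refl h).
Proof. by rewrite ctrE dunit_nat. Qed.

(** The square [H] is the vertical pasting of the square of [k] with the identity square of [p]; the
    Beck cell of the latter is a unit cell. *)
Lemma beck_tunit (X Y Q : E) (p : chom E X Y) (k : chom E Q X) (a : chom E Q Y)
    (H : is_pullback (cid Y) p a k) (K : is_pullback (cid X) (cid X) k k)
    (e : a = k >> p) W (h : hom1 C W (F0 Y)) :
  beck B H h >=> (tunit B eq_refl h ** id2 (d p))
  = (dsplit B e h ** id2 (t k)) >=> ctr K (h ;; d p).
Proof.
have v := beck_vert B K (pullback_idl p) H (eq_sym (cidl p)) e h.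
rewrite -[beck B H h]vidr -(dsplit_unitl B (eq_sym (cidl p)) eq_refl).
rewrite -(vassoc (beck B H h)) -v !vassoc (rea (dunit_nat B _ _)) !vassoc beck_unit_t.
by rewrite ctrE'.
Qed.

Lemma beck_dunit (X Y Q : E) (f : chom E X Y) (k : chom E Q X) (b : chom E Q Y)
    (H : is_pullback f (cid Y) k b) (K : is_pullback (cid X) (cid X) k k)
    (e : b = k >> f) W (h : hom1 C W (F0 X)) :
  beck B H h >=> dunit B eq_refl (h ;; t f)
  = tsplit B e (h ;; d k) >=> (ctr K h ** id2 (t f)).
Proof.
have v := beck_horiz B K (pullback_idr f) H (eq_sym (cidl f)) e h.
rewrite -[beck B H h]vidr -hcomp_id -(tsplit_unitl B (eq_sym (cidl f)) eq_refl).
rewrite whiskr_vcomp -(vassoc (beck B H h)) -v !vassoc.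
rewrite (rea (eq_sym (beck_nat B _ _))) !vassoc beck_unit_d.
by rewrite -!whiskr_vcomp ctrE ?vassoc.
Qed.

(** Change of the pullback vertex: [H'] is the horizontal pasting of [H2], whose bottom side is an
    identity, with [H], and [beck_tunit] evaluates the cell of [H2]. *)
Lemma beck_precomp (X Y Z P Q : E) (f : chom E X Z) (g : chom E Y Z)
    (p : chom E P X) (q : chom E P Y) (k : chom E Q P) (a : chom E Q X)
    (b : chom E Q Y) (H : is_pullback f g p q) (H' : is_pullback f g a b)
    (H2 : is_pullback (cid X) p a k)
    (K : is_pullback (cid P) (cid P) k k) (ea : a = k >> p) (eb : b = k >> q)
    W (h : hom1 C W (F0 X)) :
  beck B H' h = (dsplit B ea h ** id2 (t b)) >=> (tsplit B eb (h ;; d p ;; d k)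
    >=> ((ctr K (h ;; d p) ** id2 (t q)) >=> beck B H h)).
Proof.
have v := beck_horiz B H2 H H' (eq_sym (cidl f)) eb h.
rewrite -[LHS]vidr -hcomp_id -(tsplit_unitl B (eq_sym (cidl f)) eq_refl).
rewrite whiskr_vcomp -vassoc -v !vassoc -beck_nat.
rewrite (rea (eq_sym (whiskr_vcomp _ _ _))) (beck_tunit H2 K ea).
by rewrite whiskr_vcomp !vassoc (rea (tsplit_nat B _ _)) !vassoc.
Qed.

Lemma beck_left (X0 X Y Z P : E) (f : chom E X Z) (f0 : chom E X0 Z)
    (k : chom E X X0) (u : chom E Y Z) (p : chom E P X) (a : chom E P X0)
    (q : chom E P Y) (H : is_pullback f u p q) (H' : is_pullback f0 u a q)
    (H2 : is_pullback k a p (cid P))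
    (K : is_pullback (cid X0) (cid X0) k k) (ef : f = k >> f0) (ea : a = p >> k)
    W (h : hom1 C W (F0 X0)) :
  beck B H' h = (dsplit B ea h ** id2 (t q)) >=> (beck B H (h ;; d k)
    >=> ((tsplit B ef (h ;; d k) ** id2 (d u)) >=> (ctr K h ** id2 (t f0) ** id2 (d u)))).
Proof.
have v := beck_horiz B H2 H' H ef (eq_sym (cidl q)) (h ;; d k).
rewrite -(vassoc (beck B H _)) -v !vassoc -beck_nat.
have w := beck_vert B H2 K (pullback_idl a) (eq_sym (cidr a)) ea h.
suff {v} e : (dsplit B ea h ** id2 (t (cid P)))
    >=> (beck B H2 (h ;; d k) >=> (ctr K h ** id2 (d a))) = tunit B eq_refl (h ;; d a).
  rewrite -(vassoc (dsplit _ _ _ ** _)) tsplit_nat !vassoc.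
  rewrite !(rea (eq_sym (whiskr_vcomp _ _ _))) vassoc e.
  by rewrite -vassoc tsplit_unitl vidl.
rewrite ctrE whiskr_vcomp -(vassoc (beck B H2 _)) -(vassoc (dsplit _ _ _ ** _)) w.
rewrite whiskr_vcomp !vassoc -(vassoc (dsplit _ _ _)) -dsplit_nat !vassoc dsplit_unitr vidr.
by rewrite beck_unit_t.
Qed.

(** The mirror image of [beck_left], with the two directions of pasting exchanged. *)
Lemma beck_right (X Y Y0 Z P : E) (f : chom E X Z) (g : chom E Y Z)
    (g0 : chom E Y0 Z) (k : chom E Y Y0) (p : chom E P X) (q : chom E P Y)
    (b : chom E P Y0) (H : is_pullback f g p q) (H' : is_pullback f g0 p b)
    (H2 : is_pullback b k (cid P) q)
    (K : is_pullback (cid Y0) (cid Y0) k k) (eg : g = k >> g0) (eb : b = q >> k)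
    W (h : hom1 C W (F0 X)) :
  beck B H' h = tsplit B eb (h ;; d p) >=> ((beck B H h ** id2 (t k))
    >=> ((dsplit B eg (h ;; t f) ** id2 (t k)) >=> ctr K (h ;; t f ;; d g0))).
Proof.
have v := beck_vert B H2 H' H eg (eq_sym (cidl p)) h.
rewrite -(vassoc (beck B H _ ** _)) -whiskr_vcomp -v !whiskr_vcomp !vassoc ctr_nat.
have w := beck_horiz B H2 K (pullback_idr b) (eq_sym (cidr b)) eb (h ;; d p).
suff {v} e : tsplit B eb (h ;; d p ;; d (cid P))
    >=> ((beck B H2 (h ;; d p) ** id2 (t k)) >=> ctr K (h ;; d p ;; t b))
    = dunit B eq_refl (h ;; d p) ** id2 (t b).
  rewrite -(vassoc (tsplit _ _ _)) -tsplit_nat !vassoc.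
  rewrite -vassoc in e; rewrite (rea3 e).
  by rewrite -vassoc -whiskr_vcomp dsplit_unitl hcomp_id vidl.
rewrite ctrE -(vassoc (beck _ _ _ ** _)) -(vassoc (tsplit _ _ _)) w.
rewrite !vassoc -(vassoc (tsplit _ _ _ ** _)) -whiskr_vcomp tsplit_unitr hcomp_id vidl.
by rewrite beck_unit_d.
Qed.

(** Both sides evaluate one diagram of three squares: [M] pastes horizontally with [H2] to [H12] and
    vertically with [H1] to [H21]. The rest is interchange. *)
Lemma beck_assoc (S T U Y Z P P' P2 : E) (f : chom E S Y) (u : chom E T Y)
    (v : chom E T Z) (w : chom E U Z) (p : chom E P S) (q : chom E P T)
    (p2 : chom E P2 T) (q2 : chom E P2 U)
    (b : chom E P Z) (a2 : chom E P2 Y) (p' : chom E P' P) (q' : chom E P' U)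
    (a : chom E P' S) (m : chom E P' P2)
    (H1 : is_pullback f u p q) (H2 : is_pullback v w p2 q2)
    (H12 : is_pullback b w p' q') (H21 : is_pullback f a2 a m)
    (M : is_pullback q p2 p' m)
    (eb : b = q >> v) (ea2 : a2 = p2 >> u) (ea : a = p' >> p) (eq' : q' = m >> q2)
    W (h : hom1 C W (F0 S)) :
  (dsplit B ea h ** id2 (t q')) >=> (beck B H12 (h ;; d p)
    >=> ((tsplit B eb (h ;; d p) ** id2 (d w)) >=> (beck B H1 h ** id2 (t v) ** id2 (d w))))
  = tsplit B eq' (h ;; d a) >=> ((beck B H21 h ** id2 (t q2))
    >=> ((dsplit B ea2 (h ;; t f) ** id2 (t q2)) >=> beck B H2 (h ;; t f ;; d u))).
Proof.
have e1 := beck_horiz B M H2 H12 eb eq' (h ;; d p).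
have e2 := beck_vert B M H1 H21 ea2 ea h.
rewrite -(vassoc (beck _ _ _) (_ ** _)) -e1 -(vassoc (beck B H21 _ ** _)) -whiskr_vcomp -e2.
rewrite !whiskr_vcomp !vassoc -beck_nat -(vassoc (dsplit _ _ _ ** _)) tsplit_nat.
by rewrite !vassoc.
Qed.

End Contraction.

(** * The action on isomorphisms and the oplax constraint *)

Section Spread.

Context {E : Category} {C : Bicategory} {F0 : E -> C} (B : LaxBeckPairOver F0).

Local Notation d := (o1 (bd B)).
Local Notation t := (o1 (bt B)).

(** This and the next five equations hold by conversion; collected in [st_fold], they restore the
    named cells after [strict] has reached the generators. *)
Lemma st_split_d (X Y Z : E) (p : chom E X Y) (s : chom E Y Z) (a : chom E X Z)
    (e : a = p >> s) W (h : hom1 C W (F0 Z)) :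
  st (Lf (d a)) (Nd (Lf (d s)) (Lf (d p))) (split_d B e) h = dsplit B e h.
Proof. by []. Qed.

Lemma st_split_t (X Y Z : E) (q : chom E X Y) (v : chom E Y Z) (b : chom E X Z)
    (e : b = q >> v) W (h : hom1 C W (F0 X)) :
  st (Lf (t b)) (Nd (Lf (t q)) (Lf (t v))) (split_t B e) h = tsplit B e h.
Proof. by []. Qed.

Lemma st_unit_d (X : E) (i : chom E X X) (e : i = cid X) W (h : hom1 C W (F0 X)) :
  st (Lf (d i)) (Un _) (unit_d B e) h = dunit B e h.
Proof. by []. Qed.

Lemma st_unit_t (X : E) (i : chom E X X) (e : i = cid X) W (h : hom1 C W (F0 X)) :
  st (Lf (t i)) (Un _) (unit_t B e) h = tunit B e h.
Proof. by []. Qed.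

Lemma st_bk (X Y Z P : E) (f : chom E X Z) (g : chom E Y Z)
    (g' : chom E P X) (f' : chom E P Y) (H : is_pullback f g g' f')
    W (h : hom1 C W (F0 X)) :
  st (Nd (Lf (d g')) (Lf (t f'))) (Nd (Lf (t f)) (Lf (d g))) (bk B H) h = beck B H h.
Proof. by []. Qed.

Lemma st_contract (X Y : E) (k : chom E X Y) (K : is_pullback (cid Y) (cid Y) k k)
    W (h : hom1 C W (F0 Y)) :
  st (Nd (Lf (d k)) (Lf (t k))) (Un _) (contract B K) h = ctr B K h.
Proof. by []. Qed.

Definition st_fold :=
  (st_split_d, st_split_t, st_unit_d, st_unit_t, st_bk, st_contract).

Definition spread (Q S T X Y : E) (p : chom E Q S) (q : chom E Q T) (s : chom E S X)
    (v : chom E T Y) (a : chom E Q X) (b : chom E Q Y) (ea : a = p >> s)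
    (eb : b = q >> v) : hom2 (d a ;; t b) (d s ;; ((d p ;; t q) ;; t v)) :=
  (split_d B ea ** split_t B eb) >=> assoc (d s) (d p) (t q ;; t v)
    >=> (id2 (d s) ** assocV (d p) (t q) (t v)).

Definition iso_cell (Q S X Y : E) (k : chom E Q S) (s : chom E S X)
    (v : chom E S Y) (a : chom E Q X) (b : chom E Q Y)
    (K : is_pullback (cid S) (cid S) k k) (ea : a = k >> s)
    (eb : b = k >> v) : hom2 (d a ;; t b) (d s ;; t v) :=
  spread ea eb >=> (id2 (d s) ** (contract B K ** id2 (t v)))
    >=> (id2 (d s) ** lunit (t v)).

(** Any pullback of the inner legs is allowed, not only the chosen one: naturality, associativity
    and the counit pass through intermediate pullbacks that are not chosen. *)
Definition comp_cell (Q S T X Y Z : E) (f : chom E S Y) (u : chom E T Y)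
    (p : chom E Q S) (q : chom E Q T) (s : chom E S X)
    (v : chom E T Z) (a : chom E Q X) (b : chom E Q Z)
    (H : is_pullback f u p q) (ea : a = p >> s) (eb : b = q >> v) :
    hom2 (d a ;; t b) ((d s ;; t f) ;; (d u ;; t v)) :=
  spread ea eb >=> (id2 (d s) ** (bk B H ** id2 (t v)))
    >=> (id2 (d s) ** assoc (t f) (d u) (t v)) >=> assocV (d s) (t f) (d u ;; t v).

Lemma st_iso_cell (Q S X Y : E) (k : chom E Q S) (s : chom E S X)
    (v : chom E S Y) (a : chom E Q X) (b : chom E Q Y)
    (K : is_pullback (cid S) (cid S) k k) (ea : a = k >> s)
    (eb : b = k >> v) W (h : hom1 C W (F0 X)) :
  st (Nd (Lf (d a)) (Lf (t b))) (Nd (Lf (d s)) (Lf (t v))) (iso_cell K ea eb) h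
  = (dsplit B ea h ** id2 (t b)) >=> (tsplit B eb (h ;; d s ;; d k)
    >=> (ctr B K (h ;; d s) ** id2 (t v))).
Proof. by rewrite /iso_cell /spread; strict; rewrite !st_fold. Qed.

Lemma st_comp_cell (Q S T X Y Z : E) (f : chom E S Y) (u : chom E T Y)
    (p : chom E Q S) (q : chom E Q T) (s : chom E S X)
    (v : chom E T Z) (a : chom E Q X) (b : chom E Q Z)
    (H : is_pullback f u p q) (ea : a = p >> s) (eb : b = q >> v)
    W (h : hom1 C W (F0 X)) :
  st (Nd (Lf (d a)) (Lf (t b))) (Nd (Nd (Lf (d s)) (Lf (t f))) (Nd (Lf (d u)) (Lf (t v))))
    (comp_cell H ea eb) h
  = (dsplit B ea h ** id2 (t b)) >=> (tsplit B eb (h ;; d s ;; d p)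
    >=> (beck B H (h ;; d s) ** id2 (t v))).
Proof. by rewrite /comp_cell /spread; strict; rewrite !st_fold. Qed.

(* [x] is arbitrary so that it can be both a Beck cell and a contraction [d k;; t k => 1]. *)
Lemma spread_spread (Q S T S' T' X Y : E) (p : chom E Q S) (q : chom E Q T)
    (s : chom E S X) (v : chom E T Y) (a : chom E Q X) (b : chom E Q Y)
    (l : chom E S S') (l' : chom E T T') (s' : chom E S' X) (v' : chom E T' Y)
    (p' : chom E Q S') (q' : chom E Q T')
    (ea : a = p >> s) (eb : b = q >> v) (es : s = l >> s') (ev' : v = l' >> v')
    (ea' : a = p' >> s') (eb' : b = q' >> v') (ep : p' = p >> l) (eq' : q' = q >> l')
    (m : tree (F0 S) (F0 T)) (x : hom2 (d p ;; t q) (ev m))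
    W (h : hom1 C W (F0 X)) :
  (dsplit B ea h ** id2 (t b)) >=> (tsplit B eb (h ;; d s ;; d p)
    >=> ((st (Nd (Lf (d p)) (Lf (t q))) m x (h ;; d s) ** id2 (t v))
    >=> ((act2 m (dsplit B es h) ** id2 (t v))
    >=> tsplit B ev' (act m (h ;; d s' ;; d l)))))
  = (dsplit B ea' h ** id2 (t b)) >=> (tsplit B eb' (h ;; d s' ;; d p')
    >=> ((dsplit B ep (h ;; d s') ** id2 (t q') ** id2 (t v'))
    >=> ((tsplit B eq' (h ;; d s' ;; d l ;; d p) ** id2 (t v'))
    >=> (st (Nd (Lf (d p)) (Lf (t q))) m x (h ;; d s' ;; d l) ** id2 (t l')
         ** id2 (t v'))))).
Proof.
rewrite (rea (eq_sym (whiskr_vcomp _ _ _))).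
have -> : st (Nd (Lf (d p)) (Lf (t q))) m x (h ;; d s) >=> act2 m (dsplit B es h)
    = (dsplit B es h ** id2 (d p) ** id2 (t q))
      >=> st (Nd (Lf (d p)) (Lf (t q))) m x (h ;; d s' ;; d l).
  exact: (eq_sym (st_nat (t := Nd (Lf (d p)) (Lf (t q))) x (dsplit B es h))).
rewrite whiskr_vcomp !vassoc tsplit_nat.
rewrite (rea (eq_sym (tsplit_nat B eb _))) (rea (eq_sym (tsplit_nat B eb' _))) !vassoc.
rewrite !(rea (eq_sym (whiskr_vcomp _ _ _))) (dsplit_assoc B ea es ea' ep).
by rewrite (rea (tsplit_assoc B eb ev' eb' eq' _)) !vassoc.
Qed.

(** The case of [beck_precomp] in which the original square is that of [l]; it is what makes the
    action on isomorphisms functorial. *)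
Lemma ctr_precomp (P Q Y : E) (l : chom E P Y) (k : chom E Q P) (a : chom E Q Y)
    (K : is_pullback (cid P) (cid P) k k) (L : is_pullback (cid Y) (cid Y) l l)
    (A : is_pullback (cid Y) (cid Y) a a) (ki : is_iso k)
    (ea : a = k >> l) W (h : hom1 C W (F0 Y)) :
  ctr B A h = (dsplit B ea h ** id2 (t a)) >=> (tsplit B ea (h ;; d l ;; d k)
    >=> ((ctr B K (h ;; d l) ** id2 (t l)) >=> ctr B L h)).
Proof.
have H2 : is_pullback (cid Y) l a k by rewrite ea; exact: pullback_iso_l.
by rewrite (ctrE' B A) (ctrE' B L) (beck_precomp B L A H2 K ea ea) !vassoc.
Qed.

Lemma iso_cell_id (S X Y : E) (k : chom E S S) (s : chom E S X) (v : chom E S Y)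
    (K : is_pullback (cid S) (cid S) k k) (ea : s = k >> s) (eb : v = k >> v) :
  k = cid S -> iso_cell K ea eb = id2 _.
Proof.
move=> ek; destruct (eq_sym ek); strictify V h; rewrite st_iso_cell (ctrE' B K).
rewrite (rea (beck_unit_d B K eq_refl eq_refl _)) tunit_nat whiskr_vcomp.
rewrite (rea (tsplit_unitl B eb eq_refl _)) vidl -whiskr_vcomp dsplit_unitl.
exact: hcomp_id.
Qed.

Lemma iso_cell_comp (R Q S X Y : E) (k : chom E R Q) (l : chom E Q S) (kl : chom E R S)
    (s : chom E S X) (v : chom E S Y) (a : chom E Q X) (b : chom E Q Y)
    (a' : chom E R X) (b' : chom E R Y)
    (K : is_pullback (cid Q) (cid Q) k k) (L : is_pullback (cid S) (cid S) l l)
    (KL : is_pullback (cid S) (cid S) kl kl) (ki : is_iso k)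
    (ea : a = l >> s) (eb : b = l >> v) (ea' : a' = k >> a) (eb' : b' = k >> b)
    (ea'' : a' = kl >> s) (eb'' : b' = kl >> v) (e : kl = k >> l) :
  iso_cell KL ea'' eb'' = iso_cell K ea' eb' >=> iso_cell L ea eb.
Proof.
strictify V h; rewrite !st_iso_cell (ctr_precomp K L KL ki e).
have := spread_spread (m := Un _) ea' eb' ea eb ea'' eb'' e e (contract B K) h.
move=> /(f_equal (fun z => z >=> (ctr B L (h ;; d s) ** id2 (t v)))).
by rewrite !st_contract /= !whiskr_vcomp !vassoc => ->.
Qed.

(** An isomorphism in front of the constraint is absorbed into the vertex of the pullback, by
    [beck_precomp]. *)
Lemma iso_cell_comp_cell (R Q S T X Y Z : E) (f : chom E S Y) (u : chom E T Y)
    (p : chom E Q S) (q : chom E Q T) (s : chom E S X) (v : chom E T Z)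
    (a : chom E Q X) (b : chom E Q Z) (k : chom E R Q)
    (p' : chom E R S) (q' : chom E R T) (a' : chom E R X) (b' : chom E R Z)
    (K : is_pullback (cid Q) (cid Q) k k) (H : is_pullback f u p q)
    (H' : is_pullback f u p' q') (ki : is_iso k)
    (ea : a = p >> s) (eb : b = q >> v) (eka : a' = k >> a) (ekb : b' = k >> b)
    (ea' : a' = p' >> s) (eb' : b' = q' >> v) (ep : p' = k >> p) (eq' : q' = k >> q) :
  iso_cell K eka ekb >=> comp_cell H ea eb = comp_cell H' ea' eb'.
Proof.
have H2 : is_pullback (cid S) p p' k by rewrite ep; exact: pullback_iso_l.
strictify V h; rewrite !st_iso_cell !st_comp_cell (beck_precomp B H H' H2 K ep eq').
have := spread_spread (m := Un _) eka ekb ea eb ea' eb' ep eq' (contract B K) h.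
move=> /(f_equal (fun z => z >=> (beck B H (h ;; d s) ** id2 (t v)))).
by rewrite !st_contract /= !whiskr_vcomp !vassoc => ->.
Qed.

Lemma beck_sides (S S' T T' Y Q : E) (f : chom E S Y) (u : chom E T Y)
    (p : chom E Q S) (q : chom E Q T) (k : chom E S S') (l : chom E T T')
    (f' : chom E S' Y) (u' : chom E T' Y) (p' : chom E Q S') (q' : chom E Q T')
    (H : is_pullback f u p q) (H' : is_pullback f' u' p' q')
    (K : is_pullback (cid S') (cid S') k k) (L : is_pullback (cid T') (cid T') l l)
    (ki : is_iso k) (li : is_iso l)
    (ef : f = k >> f') (eu : u = l >> u') (ep : p' = p >> k) (eq' : q' = q >> l)
    W (h : hom1 C W (F0 S')) :
  beck B H' h = (dsplit B ep h ** id2 (t q')) >=> (tsplit B eq' (h ;; d k ;; d p)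
    >=> ((beck B H (h ;; d k) ** id2 (t l))
    >=> ((tsplit B ef (h ;; d k) ** id2 (d u) ** id2 (t l))
    >=> ((ctr B K h ** id2 (t f') ** id2 (d u) ** id2 (t l))
    >=> ((dsplit B eu (h ;; t f') ** id2 (t l)) >=> ctr B L (h ;; t f' ;; d u')))))).
Proof.
(* The intermediate square has the corner [S] already replaced by [S'] and the corner [T] still in
   place. *)
have M : is_pullback f' u p' q.
  case: ki => k' [kk' k'k]; split=> [|R x y e].
    by rewrite ep cassoc -ef; exact: is_pullback_sq H.
  have [|z [[zx zy] zu]] := proj2 H R (x >> k') y.
    by rewrite ef cassoc (rec k'k) cidl.
  exists z; split=> [|z' [zx' zy']].
    by rewrite ep -cassoc zx cassoc k'k cidr.
  by apply: zu; rewrite -zx' ep !cassoc kk' cidr.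
have H2 : is_pullback k p' p (cid Q) by rewrite ep; exact: pullback_iso_r.
have H3 : is_pullback q' l (cid Q) q.
  by apply: pullback_sym; rewrite eq'; exact: pullback_iso_r.
rewrite (beck_right B M H' H3 L eu eq') (beck_left B H M H2 K ef ep).
by rewrite !whiskr_vcomp !vassoc (rea (tsplit_nat B eq' _)) !vassoc.
Qed.

Lemma comp_cell_nat (Q S S' T T' X Y Z : E) (f : chom E S Y) (u : chom E T Y)
    (p : chom E Q S) (q : chom E Q T) (s : chom E S X) (v : chom E T Z)
    (a : chom E Q X) (b : chom E Q Z) (k : chom E S S') (l : chom E T T')
    (f' : chom E S' Y) (u' : chom E T' Y) (s' : chom E S' X) (v' : chom E T' Z)
    (p' : chom E Q S') (q' : chom E Q T')
    (H : is_pullback f u p q) (H' : is_pullback f' u' p' q')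
    (K : is_pullback (cid S') (cid S') k k) (L : is_pullback (cid T') (cid T') l l)
    (ki : is_iso k) (li : is_iso l)
    (ea : a = p >> s) (eb : b = q >> v) (ea' : a = p' >> s') (eb' : b = q' >> v')
    (es : s = k >> s') (ef : f = k >> f') (eu : u = l >> u') (ev' : v = l >> v')
    (ep : p' = p >> k) (eq' : q' = q >> l) :
  comp_cell H ea eb >=> (iso_cell K es ef ** iso_cell L eu ev') = comp_cell H' ea' eb'.
Proof.
strictify V h; rewrite !st_iso_cell !st_comp_cell (beck_sides H H' K L ki li ef eu ep eq').
have := spread_spread (m := Nd (Lf (t f)) (Lf (d u))) ea eb es ev' ea' eb' ep eq'
  (bk B H) h.
rewrite !st_bk /= !whiskr_vcomp !vassoc => e.
do 3 rewrite (rea (tsplit_nat B ev' _)) !vassoc.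
move: e => /(f_equal (fun z => z
  >=> ((tsplit B ef (h ;; d s' ;; d k) ** id2 (d u) ** id2 (t l) ** id2 (t v'))
    >=> ((ctr B K (h ;; d s') ** id2 (t f') ** id2 (d u) ** id2 (t l) ** id2 (t v'))
    >=> ((dsplit B eu (h ;; d s' ;; t f') ** id2 (t l) ** id2 (t v'))
    >=> (ctr B L (h ;; d s' ;; t f' ;; d u') ** id2 (t v'))))))).
by rewrite !vassoc.
Qed.

(** Once the outer legs are split off on both sides, only the three Beck squares of [beck_assoc]
    remain; [pullback_unpaste] provides the middle one. *)
Lemma comp_cell_assoc (S T U P P' P2 X Y Z V : E) (f : chom E S Y) (u : chom E T Y)
    (v : chom E T Z) (w : chom E U Z) (s : chom E S X) (x : chom E U V)
    (p : chom E P S) (q : chom E P T)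
    (p2 : chom E P2 T) (q2 : chom E P2 U) (p' : chom E P' P) (q' : chom E P' U)
    (c : chom E P' S) (m : chom E P' P2)
    (ps : chom E P X) (qv : chom E P Z) (pu : chom E P2 Y) (qx : chom E P2 V)
    (a : chom E P' X) (b : chom E P' V)
    (H1 : is_pullback f u p q) (H2 : is_pullback v w p2 q2)
    (H12 : is_pullback qv w p' q') (H21 : is_pullback f pu c m)
    (eps : ps = p >> s) (eqv : qv = q >> v) (epu : pu = p2 >> u) (eqx : qx = q2 >> x)
    (e1 : a = p' >> ps) (e2 : b = q' >> x) (e3 : a = c >> s) (e4 : b = m >> qx)
    (ec : c = p' >> p) (em : q' = m >> q2) (sq : m >> p2 = p' >> q) :
  comp_cell H12 e1 e2 >=> (comp_cell H1 eps eqv ** id2 (d w ;; t x)) >=> assoc _ _ _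
  = comp_cell H21 e3 e4 >=> (id2 (d s ;; t f) ** comp_cell H2 epu eqx).
Proof.
have M : is_pullback q p2 p' m by apply: pullback_unpaste H2 H12 _ _ _.
strictify V' h; rewrite !st_comp_cell !whiskr_vcomp !vassoc.
rewrite (rea (eq_sym (whiskr_vcomp _ (beck B H12 _) _))) -beck_nat !whiskr_vcomp !vassoc.
rewrite (rea (eq_sym (tsplit_nat B e2 _))) !vassoc (rea (eq_sym (whiskr_vcomp _ _ _))).
rewrite (dsplit_assoc B e1 eps e3 ec) whiskr_vcomp !vassoc.
rewrite (rea (tsplit_nat B e2 _)) !vassoc.
do 2 rewrite (rea (tsplit_nat B eqx _)) !vassoc.
rewrite (rea (eq_sym (tsplit_assoc B e4 eqx e2 em _))) !vassoc.
have e := f_equal (fun z => z ** id2 (t x))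
  (beck_assoc B H1 H2 H12 H21 M eqv epu ec em (h ;; d s)).
by rewrite /= !whiskr_vcomp in e; rewrite e.
Qed.

(** The square has an identity as its bottom side, so [beck_tunit] turns its Beck cell into the
    contraction of [q], which underlies the left unitor of spans. *)
Lemma comp_cell_lunit (S X Z Q : E) (u : chom E S X) (v : chom E S Z) (p : chom E Q X)
    (q : chom E Q S) (i j : chom E X X) (a : chom E Q X) (b : chom E Q Z)
    (H : is_pullback j u p q) (K : is_pullback (cid S) (cid S) q q)
    (ei : i = cid X) (ej : j = cid X)
    (ea : a = p >> i) (eb eb' : b = q >> v) (ea' : a = q >> u) :
  comp_cell H ea eb >=> (((unit_d B ei ** unit_t B ej) >=> lunit _) ** id2 (d u ;; t v))
    >=> lunit (d u ;; t v)
  = iso_cell K ea' eb'.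
Proof.
rewrite (proof_irrelevance _ eb' eb); destruct (eq_sym ei), (eq_sym ej).
have e0 : p = a by rewrite ea cidr.
subst p; strictify V h; rewrite st_comp_cell st_iso_cell !st_fold ?whiskr_vcomp ?vassoc.
rewrite (rea (eq_sym (whiskr_vcomp _ (beck B H _) _))) -beck_nat !whiskr_vcomp !vassoc.
rewrite -whiskr_vcomp (proof_irrelevance _ ej eq_refl) (beck_tunit B H K ea') whiskr_vcomp.
rewrite (rea (eq_sym (tsplit_nat B eb _))) vassoc (rea (eq_sym (whiskr_vcomp _ _ _))).
by rewrite dsplit_unitr hcomp_id vidl (rea (tsplit_nat B eb _)) vassoc.
Qed.

Lemma comp_cell_runit (S X Y Q : E) (s : chom E S X) (f : chom E S Y) (p : chom E Q S)
    (q : chom E Q Y) (i j : chom E Y Y) (a : chom E Q X) (b : chom E Q Y)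
    (H : is_pullback f i p q) (K : is_pullback (cid S) (cid S) p p)
    (ei : i = cid Y) (ej : j = cid Y)
    (ea ea' : a = p >> s) (eb : b = q >> j) (eb' : b = p >> f) :
  comp_cell H ea eb >=> (id2 (d s ;; t f) ** ((unit_d B ei ** unit_t B ej) >=> lunit _))
    >=> runit (d s ;; t f)
  = iso_cell K ea' eb'.
Proof.
rewrite (proof_irrelevance _ ea' ea); destruct (eq_sym ei), (eq_sym ej).
have e0 : q = b by rewrite eb cidr.
subst q; strictify V h; rewrite st_comp_cell st_iso_cell !st_fold ?whiskr_vcomp ?vassoc.
rewrite (proof_irrelevance _ ei eq_refl) (rea (eq_sym (whiskr_vcomp _ (beck B H _) _))).
by rewrite (beck_dunit B H K eb') tunit_nat (rea (tsplit_unitr B eb ej _)) vidl.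
Qed.
End Spread.

(** * Gluing a lax Beck pair *)

Section Glue.

Context {E : Category} (P : ChosenPullbacks E) {C : Bicategory} {F0 : E -> C}
  (B : LaxBeckPairOver F0).

Local Notation d := (o1 (bd B)).
Local Notation t := (o1 (bt B)).

Definition glue_1 (X Y : E) (S : Span X Y) : hom1 C (F0 X) (F0 Y) :=
  d (lleg S) ;; t (rleg S).

Definition glue_2 (X Y : E) (S T : Span X Y) (x : SpanCell S T) :
    hom2 (glue_1 S) (glue_1 T) :=
  iso_cell B (pullback_iso (sc_iso x)) (eq_sym (sc_l x)) (eq_sym (sc_r x)).

Definition glue_lam (X : E) : hom2 (glue_1 (span_id X)) (id1 (F0 X)) :=
  (unit_d B eq_refl ** unit_t B eq_refl) >=> lunit (id1 (F0 X)).

Definition glue_phi (X Y Z : E) (S : Span X Y) (T : Span Y Z) :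
    hom2 (glue_1 (span_comp P S T)) (glue_1 S ;; glue_1 T) :=
  comp_cell B (pb_is P (rleg S) (lleg T)) eq_refl eq_refl.

(** Both sides equal the constraint over a pullback that is not chosen: the vertex comes from [S]
    and [T], the projections are prolonged by [a] and [b]. *)
Lemma glue_phi_nat (X Y Z : E) (S S' : Span X Y) (T T' : Span Y Z)
    (a : SpanCell S S') (b : SpanCell T T') :
  glue_2 (span_hcomp P a b) >=> glue_phi S' T'
  = glue_phi S T >=> (glue_2 a ** glue_2 b).
Proof.
have H : is_pullback (rleg S') (lleg T') (lleg (pb P (rleg S) (lleg T)) >> sc a)
  (rleg (pb P (rleg S) (lleg T)) >> sc b).
  apply: (pullback_legs (sc_iso (span_hcomp P a b)) (pb_is P _ _));
  [exact: pb_medl | exact: pb_medr].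
have e1 : lleg (span_comp P S T)
    = (lleg (pb P (rleg S) (lleg T)) >> sc a) >> lleg S' by rewrite cassoc sc_l.
have e2 : rleg (span_comp P S T)
    = (rleg (pb P (rleg S) (lleg T)) >> sc b) >> rleg T' by rewrite cassoc sc_r.
transitivity (comp_cell B H e1 e2).
- apply: iso_cell_comp_cell; [exact: (sc_iso (span_hcomp P a b)) | |];
  [exact: eq_sym (pb_medl _ _) | exact: eq_sym (pb_medr _ _)].
- symmetry; apply: comp_cell_nat; rewrite //; exact: sc_iso.
Qed.

Lemma glue_phi_assoc (X Y Z W : E) (S : Span X Y) (T : Span Y Z) (U : Span Z W) :
  glue_phi (span_comp P S T) U >=> (glue_phi S T ** id2 (glue_1 U)) >=> assoc _ _ _
  = glue_2 (span_assoc P S T U) >=> glue_phi S (span_comp P T U)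
    >=> (id2 (glue_1 S) ** glue_phi T U).
Proof.
pose k := sc (span_assoc P S T U).
have H : is_pullback (rleg S) (lleg (span_comp P T U))
   (k >> lleg (pb P (rleg S) (lleg (span_comp P T U))))
   (k >> rleg (pb P (rleg S) (lleg (span_comp P T U)))).
  by apply: pullback_precomp; [exact: (sc_iso (span_assoc P S T U))|exact: pb_is].
have e1 : lleg (span_comp P (span_comp P S T) U)
  = (k >> lleg (pb P (rleg S) (lleg (span_comp P T U)))) >> lleg S.
  by rewrite cassoc -(sc_l (span_assoc P S T U)).
have e2 : rleg (span_comp P (span_comp P S T) U)
  = (k >> rleg (pb P (rleg S) (lleg (span_comp P T U)))) >> rleg (span_comp P T U).
  by rewrite cassoc -(sc_r (span_assoc P S T U)).
transitivity (comp_cell B H e1 e2 >=> (id2 (glue_1 S) ** glue_phi T U)).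
- by apply: comp_cell_assoc; rewrite /k /=; spn.
- congr (_ >=> _); symmetry; apply: iso_cell_comp_cell => //.
  exact: (sc_iso (span_assoc P S T U)).
Qed.

Lemma glue_phi_lunit (X Y : E) (S : Span X Y) :
  glue_phi (span_id X) S >=> (glue_lam X ** id2 (glue_1 S)) >=> lunit (glue_1 S)
  = glue_2 (span_lunit P S).
Proof.
refine (comp_cell_lunit B (pb_is P (cid X) (lleg S))
  (pullback_iso (sc_iso (span_lunit P S)))
  eq_refl eq_refl eq_refl eq_refl (eq_sym (sc_r (span_lunit P S)))
  (eq_sym (sc_l (span_lunit P S)))).
Qed.

Lemma glue_phi_runit (X Y : E) (S : Span X Y) :
  glue_phi S (span_id Y) >=> (id2 (glue_1 S) ** glue_lam Y) >=> runit (glue_1 S)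
  = glue_2 (span_runit P S).
Proof.
refine (comp_cell_runit B (pb_is P (rleg S) (cid Y))
  (pullback_iso (sc_iso (span_runit P S)))
  eq_refl eq_refl eq_refl (eq_sym (sc_l (span_runit P S))) eq_refl
  (eq_sym (sc_r (span_runit P S)))).
Qed.

Lemma glue_2_id (X Y : E) (S : Span X Y) : glue_2 (span_cell_id S) = id2 _.
Proof. exact: iso_cell_id. Qed.

Lemma glue_2_comp (X Y : E) (S T U : Span X Y) (a : SpanCell S T) (b : SpanCell T U) :
  glue_2 (span_cell_comp a b) = glue_2 a >=> glue_2 b.
Proof. by apply: iso_cell_comp => //; exact: sc_iso. Qed.

Definition glue : Oplax (A := SpanIso P) (B := C) F0 :=
  @Build_Oplax (SpanIso P) C F0 glue_1 glue_2 glue_2_id glue_2_comp glue_lam glue_phi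
    glue_phi_nat glue_phi_assoc glue_phi_lunit glue_phi_runit.

End Glue.

(** * Invertible cells and gregariousness of the glued functor *)

Lemma is_inv2_cancelr (C : Bicategory) (X Y : C) (f g h : hom1 C X Y) (a : hom2 f g)
    (b : hom2 g h) : is_inv2 b -> is_inv2 (a >=> b) -> is_inv2 a.
Proof.
move=> bi abi; have -> : a = (a >=> b) >=> inv2 bi by rewrite vassoc inv2K vidr.
by apply: is_inv2_vcomp abi _; exact: is_inv2_inv.
Qed.

Lemma is_inv2_cancell (C : Bicategory) (X Y : C) (f g h : hom1 C X Y) (a : hom2 f g)
    (b : hom2 g h) : is_inv2 a -> is_inv2 (a >=> b) -> is_inv2 b.
Proof.
move=> ai abi; have -> : b = inv2 ai >=> (a >=> b) by rewrite -vassoc inv2VK vidl.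
by apply: is_inv2_vcomp _ abi; exact: is_inv2_inv.
Qed.

Lemma is_inv2_assoc (C : Bicategory) (X Y Z W : C) (f : hom1 C X Y) (g : hom1 C Y Z)
    (h : hom1 C Z W) : is_inv2 (assoc f g h).
Proof. by exists (assocV f g h); rewrite assocK assocVK. Qed.

Lemma is_inv2_assocV (C : Bicategory) (X Y Z W : C) (f : hom1 C X Y) (g : hom1 C Y Z)
    (h : hom1 C Z W) : is_inv2 (assocV f g h).
Proof. by exists (assoc f g h); rewrite assocK assocVK. Qed.

Lemma is_inv2_lunit (C : Bicategory) (X Y : C) (f : hom1 C X Y) : is_inv2 (lunit f).
Proof. by exists (lunitV f); rewrite lunitK lunitVK. Qed.

Lemma is_inv2_runit (C : Bicategory) (X Y : C) (f : hom1 C X Y) : is_inv2 (runit f).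
Proof. by exists (runitV f); rewrite runitK runitVK. Qed.

Create HintDb inv2.
#[local] Hint Resolve is_inv2_id is_inv2_vcomp is_inv2_hcomp is_inv2_assoc is_inv2_assocV
  is_inv2_lunit is_inv2_runit : inv2.

(** Whiskering once more with [k'] gives, up to the invertible cell [i] and structural cells, [a]
    itself. *)
Lemma whiskr_reflect_inv2 (C : Bicategory) (X Y Z : C) (f g : hom1 C X Y)
    (k : hom1 C Y Z) (k' : hom1 C Z Y) (i : hom2 (k ;; k') (id1 Y)) (a : hom2 f g) :
  is_inv2 i -> is_inv2 (a ** id2 k) -> is_inv2 a.
Proof.
move=> ii ai; apply: (is_inv2_cancell (is_inv2_runit f)).
rewrite -runit_nat; apply: is_inv2_vcomp; last exact: is_inv2_runit.
apply: (is_inv2_cancell (a := id2 f ** i)); first by auto with inv2.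
rewrite -interchange; apply: is_inv2_vcomp; last by auto with inv2.
apply: (is_inv2_cancell (is_inv2_assoc f k k')).
rewrite -hcomp_id -assoc_nat; auto with inv2.
Qed.

Lemma pullback_iso_leg (E : Category) (X Y Z Q : E) (f : chom E X Z) (g : chom E Y Z)
    (p : chom E Q X) (q : chom E Q Y) : is_pullback f g p q -> is_iso g -> is_iso p.
Proof.
move=> H [g' [gg' g'g]].
have [|u [[up uq] _]] := proj2 H X (cid X) (f >> g').
  by rewrite cidl cassoc g'g cidr.
exists u; split=> //; apply: (pullback_ext H); first by rewrite cassoc up cidl cidr.
by rewrite cassoc uq cidl -cassoc (is_pullback_sq H) cassoc gg' cidr.
Qed.

Section Invertible.

Context {E : Category} {C : Bicategory} {F0 : E -> C} (B : LaxBeckPairOver F0).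

Local Notation d := (o1 (bd B)).
Local Notation t := (o1 (bt B)).

Lemma locdisc_is_inv2 (D : Category) (X Y : LocDisc D) (f g : hom1 (LocDisc D) X Y)
    (a : hom2 f g) : is_inv2 a.
Proof. by exists (eq_sym a); split; exact: loc_disc_irr. Qed.

Lemma split_d_inv (X Y Z : E) (p : chom E X Y) (s : chom E Y Z) (a : chom E X Z)
    (e : a = p >> s) : is_inv2 (split_d B e).
Proof.
apply: is_inv2_vcomp (proj2 (bd_pseudo B) _ _ _ _ _).
by apply: is_inv2_o2; exact: locdisc_is_inv2.
Qed.

Lemma split_t_inv (X Y Z : E) (q : chom E X Y) (v : chom E Y Z) (b : chom E X Z)
    (e : b = q >> v) : is_inv2 (split_t B e).
Proof.
apply: is_inv2_vcomp (proj2 (bt_pseudo B) _ _ _ _ _).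
by apply: is_inv2_o2; exact: locdisc_is_inv2.
Qed.

Lemma unit_d_inv (X : E) (i : chom E X X) (e : i = cid X) : is_inv2 (unit_d B e).
Proof.
apply: is_inv2_vcomp (proj1 (bd_pseudo B) _).
by apply: is_inv2_o2; exact: locdisc_is_inv2.
Qed.

Lemma unit_t_inv (X : E) (i : chom E X X) (e : i = cid X) : is_inv2 (unit_t B e).
Proof.
apply: is_inv2_vcomp (proj1 (bt_pseudo B) _).
by apply: is_inv2_o2; exact: locdisc_is_inv2.
Qed.

#[local] Hint Resolve split_d_inv split_t_inv unit_d_inv unit_t_inv : inv2.

(** The inverse is the cell of the inverse isomorphism, by functoriality of the action. *)
Lemma iso_cell_inv (Q S X Y : E) (k : chom E Q S) (s : chom E S X)
    (v : chom E S Y) (a : chom E Q X) (b : chom E Q Y)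
    (K : is_pullback (cid S) (cid S) k k) (ea : a = k >> s)
    (eb : b = k >> v) : is_iso k -> is_inv2 (iso_cell B K ea eb).
Proof.
move=> [l [kl lk]].
have ki : is_iso k by exists l.
have li : is_iso l by exists k.
have ea' : s = l >> a by rewrite ea -cassoc lk cidl.
have eb' : v = l >> b by rewrite eb -cassoc lk cidl.
have eQ x (f : chom E Q x) : f = (k >> l) >> f by rewrite kl cidl.
have eS x (f : chom E S x) : f = (l >> k) >> f by rewrite lk cidl.
have KL : is_pullback (cid Q) (cid Q) (k >> l) (k >> l).
  by apply: pullback_iso; rewrite kl; exact: is_iso_id.
have LK : is_pullback (cid S) (cid S) (l >> k) (l >> k).
  by apply: pullback_iso; rewrite lk; exact: is_iso_id.
exists (iso_cell B (pullback_iso li) ea' eb'); split.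
- rewrite -(iso_cell_comp B K (pullback_iso li) KL ki ea' eb' ea eb (eQ _ a) (eQ _ b)) //.
  exact: iso_cell_id.
- rewrite -(iso_cell_comp B (pullback_iso li) K LK li ea eb ea' eb' (eS _ s) (eS _ v)) //.
  exact: iso_cell_id.
Qed.

(** Read as a morphism from the span [(k, k)] to the identity span, [k] acts by its contraction up
    to unit cells; invertibility of the action thus passes to the contraction. *)
Lemma contractE (X Y : E) (k : chom E X Y) (K : is_pullback (cid Y) (cid Y) k k)
  (e : k = k >> cid Y) :
  contract B K = iso_cell B K e e >=> ((unit_d B eq_refl ** unit_t B eq_refl) >=> lunit _).
Proof.
strictify V h; rewrite st_iso_cell !st_fold !vassoc.
rewrite (rea (eq_sym (whiskr_vcomp _ (ctr B K _) _))) -ctr_nat whiskr_vcomp !vassoc.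
rewrite (rea (eq_sym (tsplit_nat B _ _))) !vassoc (rea (eq_sym (whiskr_vcomp _ _ _))).
by rewrite dsplit_unitr hcomp_id vidl tunit_nat (rea (tsplit_unitr B _ _ _)) vidl.
Qed.

Lemma contract_inv (X Y : E) (k : chom E X Y) (K : is_pullback (cid Y) (cid Y) k k) :
  is_iso k -> is_inv2 (contract B K).
Proof.
move=> ki; rewrite (contractE K (eq_sym (cidr k))).
by apply: is_inv2_vcomp; [exact: iso_cell_inv | auto with inv2].
Qed.

Lemma bk_inv_idr (X Y Q : E) (f : chom E X Y) (k : chom E Q X) (b : chom E Q Y)
    (H : is_pullback f (cid Y) k b) : is_inv2 (bk B H).
Proof.
have ki : is_iso k by apply: pullback_iso_leg H (is_iso_id _).
have e : b = k >> f by rewrite (is_pullback_sq H) cidr.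
apply: (is_inv2_cancelr (b := (id2 (t f) ** unit_d B eq_refl) >=> runit (t f))).
  by auto with inv2.
have -> : bk B H >=> ((id2 (t f) ** unit_d B eq_refl) >=> runit (t f))
  = (id2 (d k) ** split_t B e) >=> assocV _ _ _
    >=> (contract B (pullback_iso ki) ** id2 (t f)) >=> lunit (t f).
  by strictify V h; rewrite !st_fold (beck_dunit B H (pullback_iso ki) e).
by have := contract_inv (pullback_iso ki) ki; auto 10 with inv2.
Qed.

Lemma bk_inv_idl (X Y Q : E) (p : chom E X Y) (k : chom E Q X) (a : chom E Q Y)
    (H : is_pullback (cid Y) p a k) : is_inv2 (bk B H).
Proof.
have ki : is_iso k by apply: pullback_iso_leg (pullback_sym H) (is_iso_id _).
have e : a = k >> p by rewrite -(is_pullback_sq H) cidr.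
apply: (is_inv2_cancelr (b := (unit_t B eq_refl ** id2 (d p)) >=> lunit (d p))).
  by auto with inv2.
have -> : bk B H >=> ((unit_t B eq_refl ** id2 (d p)) >=> lunit (d p))
  = (split_d B e ** id2 (t k)) >=> assoc _ _ _
    >=> (id2 (d p) ** contract B (pullback_iso ki)) >=> runit (d p).
  by strictify V h; rewrite !st_fold (beck_tunit B H (pullback_iso ki) e).
by have := contract_inv (pullback_iso ki) ki; auto 10 with inv2.
Qed.

(** Shrinking the corner [Y] along [g] yields a square [H'] with an identity on the right, whose
    cell is invertible. By [beck_right] this cell is that of [H] whiskered with [t g], between
    invertible cells [U] and [V]. *)
Lemma bk_inv_iso (X Y Z Q : E) (f : chom E X Z) (g : chom E Y Z) (p : chom E Q X)
    (q : chom E Q Y) (H : is_pullback f g p q) : is_iso g -> is_inv2 (bk B H).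
Proof.
move=> gi.
have pi := pullback_iso_leg H gi.
have H' : is_pullback f (cid Z) p (q >> g).
  rewrite -(is_pullback_sq H); apply: (pullback_legs pi (pullback_idr f)) => //.
  exact: cidr.
have H2 : is_pullback (q >> g) g (cid Q) q.
  by apply: pullback_sym; exact: pullback_iso_r.
have e : g = g >> cid Z by rewrite cidr.
have := bk_inv_idr H'.
pose U := (id2 (d p) ** split_t B (eq_refl (q >> g))) >=> assocV (d p) (t q) (t g).
pose V := assoc (t f) (d g) (t g) >=> (id2 (t f) ** ((split_d B e ** id2 (t g))
  >=> assoc _ _ _ >=> (id2 (d (cid Z)) ** contract B (pullback_iso gi)) >=> runit _)).
have -> : bk B H' = (U >=> (bk B H ** id2 (t g))) >=> V.
  rewrite /U /V.
  by strictify W h; rewrite !st_fold (beck_right B H H' H2 (pullback_iso gi) e eq_refl).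
have ci := contract_inv (pullback_iso gi) gi.
have Ui : is_inv2 U by rewrite /U; auto with inv2.
have Vi : is_inv2 V by rewrite /V; auto 10 with inv2.
move=> /(is_inv2_cancelr Vi) /(is_inv2_cancell Ui) i1.
(* [t g] is an equivalence with inverse [t g']. *)
have [g' [gg' _]] := gi.
have ui := split_t_inv (eq_sym gg').
apply: (@whiskr_reflect_inv2 _ _ _ _ _ _ _ (t g') (inv2 ui >=> unit_t B eq_refl)) i1.
by apply: is_inv2_vcomp (is_inv2_inv ui) (unit_t_inv _).
Qed.

Lemma comp_cell_inv (Q S T X Y Z : E) (f : chom E S Y) (u : chom E T Y)
    (p : chom E Q S) (q : chom E Q T) (s : chom E S X)
    (v : chom E T Z) (a : chom E Q X) (b : chom E Q Z)
    (H : is_pullback f u p q) (ea : a = p >> s) (eb : b = q >> v) :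
  is_inv2 (bk B H) -> is_inv2 (comp_cell B H ea eb).
Proof. by rewrite /comp_cell /spread; auto 12 with inv2. Qed.

End Invertible.

(* All 2-cells are invertible, so an adjunction is an equivalence. *)
Lemma right_adjoint_lleg_iso (E : Category) (P : ChosenPullbacks E) (X Y : SpanIso P)
    (S : hom1 (SpanIso P) X Y) : has_right_adjoint S -> is_iso (lleg S).
Proof.
move=> [R [eta [eps _]]].
case: (sc_iso eta) => j [_ jK]; case: (sc_iso eps) => e [_ eK].
have eta_l := sc_l eta; have eps_r := sc_r eps; have eps_l := sc_l eps.
rewrite /= in j jK eta_l e eK eps_r eps_l.
rewrite cidr in eps_l; rewrite cidr in eps_r.
set pl := lleg (pb P (rleg R) (lleg S)) in eps_l.
set pr := rleg (pb P (rleg R) (lleg S)) in eps_r.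
have sl : (e >> pl) >> lleg R = cid Y by rewrite cassoc -eps_l.
have sq : cid (apex S) >> rleg S = (rleg S >> (e >> pl)) >> lleg R.
  by rewrite cassoc sl cidl cidr.
set ql := lleg (pb P (rleg S) (lleg R)) in eta_l.
(* The unit followed by the projection to the apex of [S] is a section of [lleg S], since the unit
   respects left legs. For the other identity, the inverse of the counit gives a section of
   [lleg R], and with it a lift of the identity of the apex of [S] to the vertex of the
   composite. *)
exists (sc eta >> ql); split; last by rewrite cassoc.
have e1 : pb_med P _ _ sq >> ql = cid _ by exact: pb_medl.
have e2 : ql >> lleg S = j.
  by rewrite -[LHS]cidl -jK cassoc eta_l cidr.
have e3 : lleg S = pb_med P _ _ sq >> j by rewrite -e2 -cassoc e1 cidl.
by rewrite e3 cassoc (rec jK) cidl e1.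
Qed.

Section GlueGreg.

Context {E : Category} (P : ChosenPullbacks E) {C : Bicategory} {F0 : E -> C}
  (B : LaxBeckPairOver F0).

Lemma glue_lam_inv (X : E) : is_inv2 (glue_lam B X).
Proof.
apply: is_inv2_vcomp (is_inv2_lunit _); apply: is_inv2_hcomp.
- exact: unit_d_inv.
- exact: unit_t_inv.
Qed.

Lemma glue_phi_inv (X Y Z : E) (S : Span X Y) (T : Span Y Z) :
  is_iso (lleg T) -> is_inv2 (glue_phi P B S T).
Proof. by move=> i; apply: comp_cell_inv; exact: bk_inv_iso. Qed.

Lemma glue_is_greg : is_greg (glue P B).
Proof.
have li X : is_inv2 (lam (glue P B) X) by exact: glue_lam_inv.
split; [split|split; [split|split; [split|]]] => //.
- move=> X Y Z S T h; apply: glue_phi_inv; exact: right_adjoint_lleg_iso h.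
- move=> X; apply: is_inv2_vcomp (li X); apply: is_inv2_o2; exact: is_inv2_id.
- move=> X Y Z f g; apply: is_inv2_vcomp; last by apply: glue_phi_inv; exact: is_iso_id.
  by apply: is_inv2_o2; exact: span_cell_is_inv2.
- move=> X; apply: is_inv2_vcomp (li X); apply: is_inv2_o2; exact: is_inv2_id.
- move=> X Y Z f g; apply: is_inv2_vcomp; last by apply: comp_cell_inv; exact: bk_inv_idl.
  by apply: is_inv2_o2; exact: span_cell_is_inv2.
- move=> X Y T s v; apply: is_inv2_vcomp; last by apply: glue_phi_inv; exact: is_iso_id.
  by apply: is_inv2_o2; exact: span_cell_is_inv2.
Qed.

Lemma glue_is_pseudo : is_beck B -> is_pseudo (glue P B).
Proof.
move=> b; split=> [X|X Y Z S T]; first exact: glue_lam_inv.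
by apply: comp_cell_inv; exact: b.
Qed.

End GlueGreg.

(** * Gluing morphisms of Beck pairs *)

Section GlueMorphism.

Context {E : Category} (P : ChosenPullbacks E) {C : Bicategory} {F0 : E -> C}
  (B B' : LaxBeckPairOver F0) (a : LaxBeckMor B B').

Lemma split_d_mor (X Y Z : E) (p : chom E X Y) (s : chom E Y Z) (f : chom E X Z)
    (e : f = p >> s) :
  ic (md a) f >=> split_d B' e = split_d B e >=> (ic (md a) s ** ic (md a) p).
Proof. by rewrite /split_d -vassoc -ic_nat !vassoc -ic_phi. Qed.

Lemma split_t_mor (X Y Z : E) (p : chom E X Y) (s : chom E Y Z) (f : chom E X Z)
    (e : f = p >> s) :
  ic (mt a) f >=> split_t B' e = split_t B e >=> (ic (mt a) p ** ic (mt a) s).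
Proof. by rewrite /split_t -vassoc -ic_nat !vassoc -ic_phi. Qed.

Lemma unit_d_mor (X : E) (i : chom E X X) (e : i = cid X) :
  ic (md a) i >=> unit_d B' e = unit_d B e.
Proof. by rewrite /unit_d -vassoc -ic_nat !vassoc ic_lam. Qed.

Lemma unit_t_mor (X : E) (i : chom E X X) (e : i = cid X) :
  ic (mt a) i >=> unit_t B' e = unit_t B e.
Proof. by rewrite /unit_t -vassoc -ic_nat !vassoc ic_lam. Qed.

Lemma contract_mor (X Y : E) (k : chom E X Y) (K : is_pullback (cid Y) (cid Y) k k) :
  (ic (md a) k ** ic (mt a) k) >=> contract B' K = contract B K.
Proof.
rewrite /contract -!vassoc m_bk (vassoc (bk B K)) -hcomp_vcomp.
by rewrite unit_t_mor unit_d_mor.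
Qed.

Lemma spread_mor (Q S T X Y : E) (p : chom E Q S) (q : chom E Q T) (s : chom E S X)
    (v : chom E T Y) (f : chom E Q X) (g : chom E Q Y) (ea : f = p >> s)
    (eb : g = q >> v) :
  (ic (md a) f ** ic (mt a) g) >=> spread B' ea eb
  = spread B ea eb >=> (ic (md a) s ** ((ic (md a) p ** ic (mt a) q) ** ic (mt a) v)).
Proof.
rewrite /spread -!vassoc -hcomp_vcomp split_d_mor split_t_mor hcomp_vcomp.
rewrite !vassoc; apply: f_equal; rewrite -(vassoc _ (assoc _ _ _)) assoc_nat vassoc.
by apply: f_equal; rewrite -!hcomp_vcomp vidl vidr assocV_nat.
Qed.

Lemma iso_cell_mor (Q S X Y : E) (k : chom E Q S) (s : chom E S X)
    (v : chom E S Y) (f : chom E Q X) (g : chom E Q Y)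
    (K : is_pullback (cid S) (cid S) k k) (ea : f = k >> s) (eb : g = k >> v) :
  (ic (md a) f ** ic (mt a) g) >=> iso_cell B' K ea eb
  = iso_cell B K ea eb >=> (ic (md a) s ** ic (mt a) v).
Proof.
have core : ((ic (md a) k ** ic (mt a) k) ** ic (mt a) v)
    >=> ((contract B' K ** id2 _) >=> lunit _)
  = (contract B K ** id2 _) >=> (lunit _ >=> ic (mt a) v).
  by rewrite -lunit_nat -!vassoc -!hcomp_vcomp contract_mor !vidl !vidr.
have := spread_mor ea eb; rewrite /iso_cell.
move: (spread B ea eb) (spread B' ea eb) => x x' e.
rewrite !vassoc (rea e) !vassoc -!hcomp_vcomp !vidl !vidr core.
by [].
Qed.

Lemma comp_cell_mor (Q S T X Y Z : E) (f : chom E S Y) (u : chom E T Y)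
    (p : chom E Q S) (q : chom E Q T) (s : chom E S X)
    (v : chom E T Z) (g : chom E Q X) (g' : chom E Q Z)
    (H : is_pullback f u p q) (ea : g = p >> s) (eb : g' = q >> v) :
  (ic (md a) g ** ic (mt a) g') >=> comp_cell B' H ea eb
  = comp_cell B H ea eb
    >=> ((ic (md a) s ** ic (mt a) f) ** (ic (md a) u ** ic (mt a) v)).
Proof.
have core : ((ic (md a) p ** ic (mt a) q) ** ic (mt a) v)
    >=> ((bk B' H ** id2 _) >=> assoc _ _ _)
  = ((bk B H ** id2 _) >=> assoc _ _ _)
    >=> (ic (mt a) f ** (ic (md a) u ** ic (mt a) v)).
  by rewrite vassoc -assoc_nat -!vassoc -!hcomp_vcomp m_bk !vidl !vidr.
have := spread_mor ea eb; rewrite /comp_cell.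
move: (spread B ea eb) (spread B' ea eb) => x x' e.
rewrite !vassoc (rea e) -assocV_nat !vassoc; congr (_ >=> _).
rewrite -!vassoc -!hcomp_vcomp !vidl !vidr -core.
by rewrite -(vassoc (_ ** ic (mt a) v)) -hcomp_vcomp vidr.
Qed.

Definition glue_mor : Icon (glue P B) (glue P B').
Proof.
refine (@Build_Icon (SpanIso P) C F0 (glue P B) (glue P B')
  (fun X Y S => ic (md a) (lleg S) ** ic (mt a) (rleg S)) _ _ _).
- abstract (by move=> X Y S T x; rewrite /= /glue_2 iso_cell_mor).
- abstract (by move=> X Y Z S T; exact: comp_cell_mor).
- abstract (by move=> X; rewrite /= /glue_lam -vassoc -hcomp_vcomp unit_d_mor unit_t_mor).
Defined.

End GlueMorphism.

Definition GlueFib (E : Category) (P : ChosenPullbacks E) (C : Bicategory)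
    (F0 : E -> C) : Functor (LaxBeckPairFib F0) (GregFib P F0).
Proof.
refine (@Build_Functor (LaxBeckPairFib F0) (GregFib P F0)
  (fun B => exist _ (glue P B) (glue_is_greg P B))
  (fun B B' a => glue_mor P a) _ _).
- abstract (by move=> B; apply: icon_ext => X Y S; exact: hcomp_id).
- abstract (by move=> B B' B'' a b; apply: icon_ext => X Y S; exact: hcomp_vcomp).
Defined.

(** * Unit and counit *)

Section Counit.

Context {E : Category} (P : ChosenPullbacks E) {C : Bicategory} {F0 : E -> C}
  (B : LaxBeckPairOver F0).

Local Notation d := (o1 (bd B)).
Local Notation t := (o1 (bt B)).

Definition trim_t (X Y : E) (f : chom E X Y) : hom2 (d (cid X) ;; t f) (t f) :=
  (unit_d B eq_refl ** id2 (t f)) >=> lunit (t f).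

Definition trim_d (X Y : E) (g : chom E X Y) : hom2 (d g ;; t (cid X)) (d g) :=
  (id2 (d g) ** unit_t B eq_refl) >=> runit (d g).

Lemma st_trim_t (X Y : E) (f : chom E X Y) W (h : hom1 C W (F0 X)) :
  st (Nd (Lf (d (cid X))) (Lf (t f))) (Lf (t f)) (trim_t f) h
  = dunit B eq_refl h ** id2 (t f).
Proof. by rewrite /trim_t; strict. Qed.

Lemma st_trim_d (X Y : E) (g : chom E X Y) W (h : hom1 C W (F0 Y)) :
  st (Nd (Lf (d g)) (Lf (t (cid X)))) (Lf (d g)) (trim_d g) h
  = tunit B eq_refl (h ;; d g).
Proof. by rewrite /trim_d; strict. Qed.

Lemma trim_t_split (X Y Z : E) (f : chom E X Y) (g : chom E Y Z) (b : chom E X Z)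
    (H : is_pullback f (cid Y) (cid X) f) (e : cid X = cid X >> cid X)
    (eb eb' : b = f >> g) :
  trim_t b >=> split_t B eb = comp_cell B H e eb' >=> (trim_t f ** trim_t g).
Proof.
rewrite (proof_irrelevance _ eb' eb).
strictify V h; rewrite st_comp_cell !st_trim_t !st_fold !vassoc ?whiskr_vcomp.
rewrite (rea (eq_sym (whiskr_vcomp _ (beck B H _) _))) -beck_nat whiskr_vcomp !vassoc.
rewrite -whiskr_vcomp (beck_unit_d B H eq_refl eq_refl).
rewrite (rea (eq_sym (tsplit_nat B _ _))) !vassoc (rea (eq_sym (whiskr_vcomp _ _ _))).
by rewrite dsplit_unitr hcomp_id vidl tsplit_nat.
Qed.

Lemma trim_d_split (X Y Z : E) (f : chom E Y Z) (g : chom E X Y) (a : chom E X Z)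
    (H : is_pullback (cid Y) g g (cid X)) (e : cid X = cid X >> cid X)
    (ea ea' : a = g >> f) :
  trim_d a >=> split_d B ea = comp_cell B H ea' e >=> (trim_d f ** trim_d g).
Proof.
rewrite (proof_irrelevance _ ea' ea).
strictify V h; rewrite st_comp_cell !st_trim_d !st_fold !vassoc ?whiskr_vcomp.
rewrite (rea (eq_sym (whiskr_vcomp _ (beck B H _) _))) (beck_unit_t B H eq_refl eq_refl).
by rewrite tunit_nat (rea (tsplit_unitr B e eq_refl _)) vidl tunit_nat.
Qed.

Lemma trim_bk (X Y Z Q R : E) (f : chom E X Z) (g : chom E Y Z) (p : chom E Q X)
    (q : chom E Q Y) (l r : chom E R Q) (a : chom E R X) (b : chom E R Y)
    (H : is_pullback f g p q) (N : is_pullback (cid Q) (cid Q) l r)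
    (H' : is_pullback f g a b) (ea : a = l >> p) (eb : b = r >> q)
    (ea' : a = a >> cid X) (eb' : b = b >> cid Y) :
  comp_cell B N ea eb >=> (trim_d p ** trim_t q) >=> bk B H
  = comp_cell B H' ea' eb' >=> (trim_t f ** trim_d g).
Proof.
(* The projections of a pullback of two identities coincide and are invertible, which reduces the
   claim to a change of vertex along [l]. *)
have e : r = l by have := is_pullback_sq N; rewrite !cidr.
destruct (eq_sym e).
have li : is_iso l by apply: pullback_iso_leg N (is_iso_id _).
have H2 : is_pullback (cid X) p a l by rewrite ea; exact: pullback_iso_l.
strictify V h; rewrite !st_comp_cell !st_trim_d !st_trim_t !st_fold !vassoc.
rewrite (rea (eq_sym (whiskr_vcomp _ (beck B H' _) _))) -beck_nat.
rewrite whiskr_vcomp !vassoc (rea (eq_sym (tsplit_nat B eb' _))) !vassoc.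
rewrite (rea (eq_sym (whiskr_vcomp _ (dsplit B ea' _) _))) dsplit_unitr hcomp_id vidl.
rewrite tunit_nat (rea (tsplit_unitr B eb' eq_refl _)) vidl.
rewrite (beck_precomp B H H' H2 N ea eb) ctrE whiskr_vcomp !vassoc.
by rewrite ?whiskr_vcomp ?vassoc.
Qed.

Lemma trim_t_unit (X : E) :
  trim_t (cid X) >=> unit_t B eq_refl = glue_lam B X.
Proof. by rewrite /glue_lam; strictify V h; rewrite st_trim_t !st_fold. Qed.

Lemma trim_d_unit (X : E) :
  trim_d (cid X) >=> unit_d B eq_refl = glue_lam B X.
Proof. by rewrite /glue_lam; strictify V h; rewrite st_trim_d !st_fold tunit_nat. Qed.

Lemma trim_t_inv (X Y : E) (f : chom E X Y) : is_inv2 (trim_t f).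
Proof.
apply: is_inv2_vcomp (is_inv2_lunit _); apply: is_inv2_hcomp (is_inv2_id _).
exact: unit_d_inv.
Qed.

Lemma trim_d_inv (X Y : E) (g : chom E X Y) : is_inv2 (trim_d g).
Proof.
apply: is_inv2_vcomp (is_inv2_runit _); apply: is_inv2_hcomp (is_inv2_id _) _.
exact: unit_t_inv.
Qed.

Lemma glue_2_tens_2 (X Y : E) (f g : chom E X Y) (e : f = g) :
  glue_2 B (tens_2 e) >=> trim_t g
  = trim_t f >=> o2 (bt B) (e : hom2 (f : hom1 (LocDisc E) X Y) g).
Proof.
destruct e; rewrite (o2_id (bt B)) vidr.
by rewrite (_ : glue_2 B _ = id2 _) ?vidl //; exact: iso_cell_id.
Qed.

Lemma glue_2_delt_2 (X Y : E) (f g : chom E X Y) (e : f = g) :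
  glue_2 B (delt_2 e) >=> trim_d g
  = trim_d f >=> o2 (bd B) (e : hom2 (f : hom1 (LocDisc (Op E)) Y X) g).
Proof.
destruct e; rewrite (o2_id (bd B)) vidr.
by rewrite (_ : glue_2 B _ = id2 _) ?vidl //; exact: iso_cell_id.
Qed.

Lemma trim_t_phi (X Y Z : E) (f : chom E X Y) (g : chom E Y Z) :
  trim_t (f >> g) >=> phi (bt B) f g
  = (glue_2 B (tens_phi P f g) >=> glue_phi P B (tens_sp f) (tens_sp g))
    >=> (trim_t f ** trim_t g).
Proof.
have e : cid X = cid X >> cid X by rewrite cidl.
rewrite -(split_tE B eq_refl) (trim_t_split (pullback_idr f) e _ eq_refl).
congr (_ >=> _); symmetry.
apply: iso_cell_comp_cell; [exact: (sc_iso (tens_phi P f g)) | |].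
- exact: eq_sym (pb_medl _ _).
- exact: eq_sym (pb_medr _ _).
Qed.

Lemma trim_d_phi (X Y Z : E) (f : chom E Y X) (g : chom E Z Y) :
  trim_d (g >> f) >=> phi (bd B) f g
  = (glue_2 B (delt_phi P g f) >=> glue_phi P B (delt_sp f) (delt_sp g))
    >=> (trim_d f ** trim_d g).
Proof.
have e : cid Z = cid Z >> cid Z by rewrite cidl.
rewrite -(split_dE B eq_refl) (trim_d_split (pullback_idl g) e _ eq_refl).
congr (_ >=> _); symmetry.
apply: iso_cell_comp_cell; [exact: (sc_iso (delt_phi P g f)) | |].
- exact: eq_sym (pb_medl _ _).
- exact: eq_sym (pb_medr _ _).
Qed.

Definition counit_t : Icon (F_tens (glue P B)) (bt B).
Proof.
refine (@Build_Icon (LocDisc E) C F0 (F_tens (glue P B)) (bt B) trim_t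
  glue_2_tens_2 trim_t_phi _).
abstract (by move=> X; rewrite /= glue_2_id vidl -(unit_tE B eq_refl);
  exact: trim_t_unit).
Defined.

Definition counit_d : Icon (F_delt (glue P B)) (bd B).
Proof.
refine (@Build_Icon (LocDisc (Op E)) C F0 (F_delt (glue P B)) (bd B)
  (fun X Y => @trim_d Y X) (fun X Y => @glue_2_delt_2 Y X)
  (fun X Y Z => @trim_d_phi X Y Z) _).
abstract (by move=> X; rewrite /= glue_2_id vidl -(unit_dE B eq_refl);
  exact: trim_d_unit).
Defined.

(** Cancelling the invertible constraint at [(p,1)] and [(1,q)] removes the inverse hidden in
    [F_beck]; [trim_bk] and absorption of an isomorphism then give both sides. *)
Lemma counit_bk (X Y Z Q : E) (f : chom E X Z) (g : chom E Y Z)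
    (p : chom E Q X) (q : chom E Q Y) (H : is_pullback f g p q)
    (Hs : forall (X Y T : E) (s : chom E T X) (t : chom E T Y),
      is_inv2 (F_split (glue P B) s t)) :
  (trim_d p ** trim_t q) >=> bk B H = F_beck Hs H >=> (trim_t f ** trim_d g).
Proof.
apply: (inv2_cancell (phi_split_inv Hs p q)).
rewrite -[RHS]vassoc (F_beckE Hs H).
have ki := sc_iso (sq_cell P H).
have H' : is_pullback f g (lleg (span_comp P (delt_sp p) (tens_sp q)))
    (rleg (span_comp P (delt_sp p) (tens_sp q))).
  apply: (pullback_legs ki (pb_is P f g));
    [have := sc_l (sq_cell P H) | have := sc_r (sq_cell P H)]; by rewrite /= cidr.
have e1 := eq_sym (cidr (lleg (span_comp P (delt_sp p) (tens_sp q)))).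
have e2 := eq_sym (cidr (rleg (span_comp P (delt_sp p) (tens_sp q)))).
transitivity (comp_cell B H' e1 e2 >=> (trim_t f ** trim_d g)).
- rewrite -[LHS]vassoc; exact: trim_bk.
- congr (_ >=> _); symmetry; apply: iso_cell_comp_cell => //.
  + by have := sc_l (sq_cell P H); rewrite /= cidr.
  + by have := sc_r (sq_cell P H); rewrite /= cidr.
Qed.

End Counit.

Definition icon_inv (A C : Bicategory) (F0 : A -> C) (F G : Oplax F0) (a : Icon F G)
    (ai : forall X Y (f : hom1 A X Y), is_inv2 (ic a f)) : Icon G F.
Proof.
refine (@Build_Icon A C F0 G F (fun X Y f => inv2 (ai X Y f)) _ _ _).
- move=> X Y f g x; apply: (inv2_cancell (ai _ _ f)).
  by rewrite -!vassoc -ic_nat inv2K vassoc inv2K vidl vidr.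
- move=> X Y Z f g; apply: (inv2_cancell (ai _ _ (f ;; g))).
  by rewrite -!vassoc inv2K ic_phi vidl vassoc -hcomp_vcomp !inv2K hcomp_id vidr.
- by move=> X; apply: (inv2_cancell (ai _ _ (id1 X))); rewrite -vassoc inv2K vidl ic_lam.
Defined.

Lemma icon_is_iso (A C : Bicategory) (F0 : A -> C) (F G : Oplax F0) (a : Icon F G) :
  (forall X Y (f : hom1 A X Y), is_inv2 (ic a f)) ->
  @is_iso (IconFib F0) F G a.
Proof.
move=> ai; exists (icon_inv ai); split; apply: icon_ext => X Y f /=.
- exact: inv2K.
- exact: inv2VK.
Qed.

Lemma lax_beck_mor_is_iso (E : Category) (C : Bicategory) (F0 : E -> C)
    (F G : LaxBeckPairOver F0) (a : LaxBeckMor F G) :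
  (forall X Y (f : chom E X Y), is_inv2 (ic (mt a) f)) ->
  (forall X Y (f : chom E X Y), is_inv2 (ic (md a) f)) ->
  @is_iso (LaxBeckPairFib F0) F G a.
Proof.
move=> ti di.
have di' X Y (f : hom1 (LocDisc (Op E)) X Y) : is_inv2 (ic (md a) f) by exact: di.
have ti' X Y (f : hom1 (LocDisc E) X Y) : is_inv2 (ic (mt a) f) by exact: ti.
have m X Y Z Q (f : chom E X Z) (g : chom E Y Z) (g' : chom E Q X) (f' : chom E Q Y)
    (H : is_pullback f g g' f') :
  (ic (icon_inv di') g' ** ic (icon_inv ti') f') >=> bk F H
  = bk G H >=> (ic (icon_inv ti') f ** ic (icon_inv di') g).
  apply: (inv2_cancell (is_inv2_hcomp (di _ _ g') (ti _ _ f'))).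
  rewrite -[LHS]vassoc -[RHS]vassoc m_bk -hcomp_vcomp /= !inv2K hcomp_id vidl.
  by rewrite vassoc -hcomp_vcomp !inv2K hcomp_id vidr.
exists (Build_LaxBeckMor m); split; apply: lax_beck_mor_ext; apply: icon_ext;
  move=> X Y f /=; try exact: inv2K; exact: inv2VK.
Qed.

(* [H] is arbitrary because the cells of [TensDeltFib] depend on the proof of
   gregariousness, and for Beck pairs that proof comes from [pseudo_greg]. *)
Definition counit (E : Category) (P : ChosenPullbacks E) (C : Bicategory)
    (F0 : E -> C) (B : LaxBeckPairFib F0) (H : is_greg (glue P B)) :
  chom (LaxBeckPairFib F0) (TensDeltFib P F0 (exist _ (glue P B) H)) B :=
  @Build_LaxBeckMor _ _ _ (TensDeltFib P F0 (exist _ (glue P B) H)) B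
    (counit_t P B) (counit_d P B)
    (fun X Y Z Q f g p q K => counit_bk (f := f) (g := g) (p := p) (q := q) K _).

Lemma counit_nat (E : Category) (P : ChosenPullbacks E) (C : Bicategory)
    (F0 : E -> C) (B B' : LaxBeckPairFib F0) (H : is_greg (glue P B))
    (H' : is_greg (glue P B')) (a : chom (LaxBeckPairFib F0) B B') :
  @fhom _ _ (TensDeltFib P F0) (exist _ (glue P B) H) (exist _ (glue P B') H')
    (glue_mor P a) >> counit H' = counit H >> a.
Proof.
apply: lax_beck_mor_ext; apply: icon_ext => X Y f /=.
- rewrite /trim_t -[LHS]vassoc -hcomp_vcomp unit_d_mor vidr.
  by rewrite [RHS]vassoc -lunit_nat -[RHS]vassoc -hcomp_vcomp vidl vidr.
- rewrite /trim_d -[LHS]vassoc -hcomp_vcomp unit_t_mor vidr.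
  by rewrite [RHS]vassoc -runit_nat -[RHS]vassoc -hcomp_vcomp vidl vidr.
Qed.

Lemma counit_is_iso (E : Category) (P : ChosenPullbacks E) (C : Bicategory)
    (F0 : E -> C) (B : LaxBeckPairFib F0) (H : is_greg (glue P B)) :
  is_iso (counit H).
Proof.
apply: lax_beck_mor_is_iso => X Y f; [exact: trim_t_inv | exact: trim_d_inv].
Qed.

(** * Pastings under an oplax functor *)

Section OplaxStrict.

Context {A C : Bicategory} {F0 : A -> C} (F : Oplax F0).

Definition strict_o2 (X Y : A) (f g : hom1 A X Y) (a : hom2 f g) W (h : hom1 C W (F0 X)) :
  hom2 (h ;; o1 F f) (h ;; o1 F g) := st (Lf (o1 F f)) (Lf (o1 F g)) (o2 F a) h.

Definition strict_phi (X Y Z : A) (f : hom1 A X Y) (g : hom1 A Y Z) W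
    (h : hom1 C W (F0 X)) :
  hom2 (h ;; o1 F (f ;; g)) (h ;; o1 F f ;; o1 F g) :=
  st (Lf (o1 F (f ;; g))) (Nd (Lf (o1 F f)) (Lf (o1 F g))) (phi F f g) h.

Lemma strict_o2_comp (X Y : A) (f g k : hom1 A X Y) (a : hom2 f g) (b : hom2 g k) W
    (h : hom1 C W (F0 X)) : strict_o2 a h >=> strict_o2 b h = strict_o2 (a >=> b) h.
Proof. by rewrite /strict_o2 o2_vcomp; strict. Qed.

Lemma strict_phi_natl (X Y Z : A) (f f' : hom1 A X Y) (g : hom1 A Y Z) (a : hom2 f f') W
    (h : hom1 C W (F0 X)) :
  strict_phi f g h >=> (strict_o2 a h ** id2 (o1 F g))
  = strict_o2 (a ** id2 g) h >=> strict_phi f' g h.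
Proof. by strict_of (phi_natl F g a) h. Qed.

Lemma strict_phi_natr (X Y Z : A) (f : hom1 A X Y) (g g' : hom1 A Y Z) (a : hom2 g g') W
    (h : hom1 C W (F0 X)) :
  strict_phi f g h >=> strict_o2 a (h ;; o1 F f)
  = strict_o2 (id2 f ** a) h >=> strict_phi f g' h.
Proof. by strict_of (phi_natr F f a) h. Qed.

Lemma strict_phi_assoc (X Y Z V : A) (f : hom1 A X Y) (g : hom1 A Y Z) (k : hom1 A Z V) W
    (h : hom1 C W (F0 X)) :
  strict_phi (f ;; g) k h >=> (strict_phi f g h ** id2 (o1 F k))
  = strict_o2 (assoc f g k) h
    >=> (strict_phi f (g ;; k) h >=> strict_phi g k (h ;; o1 F f)).
Proof. by strict_of (phi_assoc F f g k) h. Qed.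

Lemma strict_phi_assocV (X Y Z V : A) (f : hom1 A X Y) (g : hom1 A Y Z) (k : hom1 A Z V) W
    (h : hom1 C W (F0 X)) :
  strict_phi f (g ;; k) h >=> strict_phi g k (h ;; o1 F f)
  = strict_o2 (assocV f g k) h
    >=> (strict_phi (f ;; g) k h >=> (strict_phi f g h ** id2 (o1 F k))).
Proof. by strict_of (phi_assocV F f g k) h. Qed.

(** For the pair restricted from a functor, [spread] is made of constraints of that functor. This
    gathers all splitting and rebracketing into one cell of the source, so that only constraints are
    left outside. *)
Lemma phi_spread (X1 X2 X3 X4 X5 : A) (a : hom1 A X1 X3) (b : hom1 A X3 X5)
    (s : hom1 A X1 X2) (p : hom1 A X2 X3) (q : hom1 A X3 X4) (v : hom1 A X4 X5)
    (dl : hom2 a (s ;; p)) (tl : hom2 b (q ;; v)) W (h : hom1 C W (F0 X1)) :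
  strict_phi a b h >=> (((strict_o2 dl h >=> strict_phi s p h) ** id2 (o1 F b))
    >=> ((strict_o2 tl (h ;; o1 F s ;; o1 F p) >=> strict_phi q v (h ;; o1 F s ;; o1 F p))))
  = strict_o2 ((dl ** tl) >=> assoc s p (q ;; v) >=> (id2 s ** assocV p q v)) h
    >=> (strict_phi s ((p ;; q) ;; v) h >=> (strict_phi (p ;; q) v (h ;; o1 F s)
    >=> (strict_phi p q (h ;; o1 F s) ** id2 (o1 F v)))).
Proof.
rewrite !whiskr_vcomp !vassoc (rea (strict_phi_natl _ _ _)) !vassoc.
rewrite (rea (strict_phi_assoc _ _ _ _)) !vassoc (rea (strict_phi_natr _ _ _)) !vassoc.
rewrite (rea (strict_phi_natr _ _ _)) !vassoc strict_phi_assocV.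
rewrite (rea (strict_phi_natr _ _ _)) !vassoc.
rewrite !(rea (strict_o2_comp _ _ _)) !vassoc.
by rewrite (rea (eq_sym (assoc_nat _ _ _))) !vassoc hcomp_id -!vassoc -hcompE.
Qed.

Lemma phi_lunit_strict (X Y : A) (f : hom1 A X Y) W (h : hom1 C W (F0 X)) :
  strict_phi (id1 X) f h >=> (st (Lf (o1 F (id1 X))) (Un _) (lam F X) h ** id2 (o1 F f))
  = strict_o2 (lunit f) h.
Proof. by strict_of (phi_lunit F f) h. Qed.

Lemma oplax_contract (X Y : A) (p : hom1 A X Y) (q : hom1 A Y X)
    (c : hom2 (p ;; q) (id1 X ;; id1 X))
    (x : hom2 (o1 F p ;; o1 F q) (o1 F (id1 X) ;; o1 F (id1 X))) :
  phi F p q >=> x = o2 F c >=> phi F (id1 X) (id1 X) ->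
  phi F p q >=> (x >=> (lam F X ** lam F X) >=> lunit _)
  = o2 F (c >=> lunit (id1 X)) >=> lam F X.
Proof.
move=> e; rewrite hcompE !vassoc lunit_nat (rea e) o2_vcomp -phi_lunit.
by rewrite !vassoc.
Qed.

(** Reduces naturality of the unit to the equation [ec] in the source bicategory, which for spans is
    checked on pullback projections. The hypothesis on [x] says that it is the contraction computed
    from the functor. *)
Lemma oplax_iso_cell (X1 X2 X3 : A) (S : hom1 A X1 X3) (X : A) (a : hom1 A X1 X)
    (b : hom1 A X X3) (s : hom1 A X1 X2) (p : hom1 A X2 X) (q : hom1 A X X2)
    (v : hom1 A X2 X3) (T : hom1 A X1 X3)
    (g : hom2 S T) (sS : hom2 S (a ;; b)) (sT : hom2 T (s ;; v))
    (dl : hom2 a (s ;; p)) (tl : hom2 b (q ;; v)) (c : hom2 (p ;; q) (id1 X2))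
    (x : hom2 (o1 F p ;; o1 F q) (id1 (F0 X2))) :
  phi F p q >=> x = o2 F c >=> lam F X2 ->
  sS >=> ((dl ** tl) >=> assoc s p (q ;; v) >=> (id2 s ** assocV p q v))
    >=> (id2 s ** (c ** id2 v)) >=> (id2 s ** lunit v) = g >=> sT ->
  (o2 F sS >=> phi F a b)
  >=> ((((o2 F dl >=> phi F s p) ** (o2 F tl >=> phi F q v)) >=> assoc _ _ _
    >=> (id2 _ ** assocV _ _ _)) >=> (id2 _ ** (x ** id2 _)) >=> (id2 _ ** lunit _))
  = o2 F g >=> (o2 F sT >=> phi F s v).
Proof.
move=> ex ec.
have ex' W (h : hom1 C W (F0 X2)) : strict_phi p q h
    >=> st (Nd (Lf (o1 F p)) (Lf (o1 F q))) (Un _) x h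
    = strict_o2 c h >=> st (Lf (o1 F (id1 X2))) (Un _) (lam F X2) h.
  by strict_of ex h.
rewrite -[RHS]vassoc -o2_vcomp -ec.
have ps W (h : hom1 C W (F0 X1)) := phi_spread dl tl h.
strictify W h; rewrite -!/(strict_o2 _ _) -!/(strict_phi _ _ _).
have {}ps := ps _ h.
rewrite !whiskr_vcomp !vassoc in ps.
move: ps => /(f_equal (fun z => z
  >=> (st (Nd (Lf (o1 F p)) (Lf (o1 F q))) (Un _) x (h ;; o1 F s) ** id2 (o1 F v)))).
rewrite !vassoc => ->.
rewrite -whiskr_vcomp ex' whiskr_vcomp (rea (strict_phi_natl _ _ _)) !vassoc.
rewrite (rea (strict_phi_natr _ _ _)) !vassoc phi_lunit_strict strict_phi_natr.
by rewrite !(rea (strict_o2_comp _ _ _)) !vassoc.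
Qed.

(** The analogous reduction for compatibility of the unit with the constraints; the hypothesis on
    [x] is the property [F_beckE] of the Beck data. *)
Lemma oplax_comp_cell (X1 X2 X3 X4 X5 : A) (S : hom1 A X1 X4) (T : hom1 A X4 X5) (X : A)
    (a : hom1 A X1 X) (b : hom1 A X X5) (s : hom1 A X1 X2) (p : hom1 A X2 X)
    (q : hom1 A X X3) (v : hom1 A X3 X5) (f : hom1 A X2 X4) (u : hom1 A X4 X3)
    (sg : hom2 (S ;; T) (a ;; b)) (sS : hom2 S (s ;; f)) (sT : hom2 T (u ;; v))
    (dl : hom2 a (s ;; p)) (tl : hom2 b (q ;; v)) (c : hom2 (p ;; q) (f ;; u))
    (x : hom2 (o1 F p ;; o1 F q) (o1 F f ;; o1 F u)) :
  phi F p q >=> x = o2 F c >=> phi F f u ->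
  sg >=> ((dl ** tl) >=> assoc s p (q ;; v) >=> (id2 s ** assocV p q v))
    >=> (id2 s ** (c ** id2 v)) >=> (id2 s ** assoc f u v) >=> assocV s f (u ;; v)
  = sS ** sT ->
  (o2 F sg >=> phi F a b)
  >=> ((((o2 F dl >=> phi F s p) ** (o2 F tl >=> phi F q v)) >=> assoc _ _ _
    >=> (id2 _ ** assocV _ _ _)) >=> (id2 _ ** (x ** id2 _))
    >=> (id2 _ ** assoc _ _ _) >=> assocV _ _ _)
  = phi F S T >=> ((o2 F sS >=> phi F s f) ** (o2 F sT >=> phi F u v)).
Proof.
move=> ex ec.
have ex' W (h : hom1 C W (F0 X2)) : strict_phi p q h
    >=> st (Nd (Lf (o1 F p)) (Lf (o1 F q))) (Nd (Lf (o1 F f)) (Lf (o1 F u))) x h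
    = strict_o2 c h >=> strict_phi f u h.
  by strict_of ex h.
rewrite [in RHS]hcomp_vcomp -[RHS]vassoc -phi_nat -ec.
have ps W (h : hom1 C W (F0 X1)) := phi_spread dl tl h.
strictify W h; rewrite -!/(strict_o2 _ _) -!/(strict_phi _ _ _).
have {}ps := ps _ h.
rewrite !whiskr_vcomp !vassoc in ps.
move: ps => /(f_equal (fun z => z
  >=> (st (Nd (Lf (o1 F p)) (Lf (o1 F q))) (Nd (Lf (o1 F f)) (Lf (o1 F u))) x
        (h ;; o1 F s) ** id2 (o1 F v)))).
rewrite !vassoc => ->.
rewrite -whiskr_vcomp ex' whiskr_vcomp (rea (strict_phi_natl _ _ _)) !vassoc.
rewrite strict_phi_assoc (rea (strict_phi_natr _ _ _)) !vassoc.
rewrite (rea (strict_phi_natr _ _ _)) !vassoc (rea (strict_phi_assocV _ _ _ _)) !vassoc.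
by rewrite !(rea (strict_o2_comp _ _ _)) !vassoc.
Qed.

End OplaxStrict.

(** The source of [split_cell] is [mkSpan (lleg S) (rleg S)], which becomes [S] only after case
    analysis. *)
Definition leg_cell (E : Category) (P : ChosenPullbacks E) (X Y : E) (S : Span X Y) :
    SpanCell S (span_comp P (delt_sp (lleg S)) (tens_sp (rleg S))) :=
  match S with mkSpan s t => split_cell P s t end.

Lemma sc_leg_cell (E : Category) (P : ChosenPullbacks E) (X Y : E) (S : Span X Y) :
  sc (leg_cell P S) = pb_med P (cid (apex S)) (cid (apex S)) eq_refl.
Proof. by case: S. Qed.

(** Cells into the iterated pullback are compared on its four projections; [cf] and [cu] describe
    the central cell [c] there. *)
Lemma cell_pasting (E : Category) (P : ChosenPullbacks E) (X1 X2 X3 X4 X5 X : E)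
    (S : Span X1 X4) (T : Span X4 X5) (a : Span X1 X) (b : Span X X5)
    (s : Span X1 X2) (p : Span X2 X) (q : Span X X3) (v : Span X3 X5)
    (f : Span X2 X4) (u : Span X4 X3)
    (sg : SpanCell (span_comp P S T) (span_comp P a b))
    (sS : SpanCell S (span_comp P s f)) (sT : SpanCell T (span_comp P u v))
    (dl : SpanCell a (span_comp P s p)) (tl : SpanCell b (span_comp P q v))
    (c : SpanCell (span_comp P p q) (span_comp P f u))
    (cf : chom E (apex p) (apex f)) (cu : chom E (apex p) (apex u)) :
  sc c >> lleg (pb P (rleg f) (lleg u)) = lleg (pb P (rleg p) (lleg q)) >> cf ->
  sc c >> rleg (pb P (rleg f) (lleg u)) = lleg (pb P (rleg p) (lleg q)) >> cu ->
  sc sg >> (lleg (pb P (rleg a) (lleg b)) >> (sc dl >> lleg (pb P (rleg s) (lleg p))))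
  = lleg (pb P (rleg S) (lleg T)) >> (sc sS >> lleg (pb P (rleg s) (lleg f))) ->
  sc sg >> (lleg (pb P (rleg a) (lleg b))
    >> (sc dl >> (rleg (pb P (rleg s) (lleg p)) >> cf)))
  = lleg (pb P (rleg S) (lleg T)) >> (sc sS >> rleg (pb P (rleg s) (lleg f))) ->
  sc sg >> (lleg (pb P (rleg a) (lleg b))
    >> (sc dl >> (rleg (pb P (rleg s) (lleg p)) >> cu)))
  = rleg (pb P (rleg S) (lleg T)) >> (sc sT >> lleg (pb P (rleg u) (lleg v))) ->
  sc sg >> (rleg (pb P (rleg a) (lleg b)) >> (sc tl >> rleg (pb P (rleg q) (lleg v))))
  = rleg (pb P (rleg S) (lleg T)) >> (sc sT >> rleg (pb P (rleg u) (lleg v))) ->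
  @vcomp (SpanIso P) X1 X5 _ _ _ sg
    ((@hcomp (SpanIso P) _ _ _ _ (span_comp P s p) _ (span_comp P q v) dl tl
      >=> assoc _ _ _ >=> (id2 _ ** assocV _ _ _)))
    >=> (id2 _ ** (@hcomp (SpanIso P) _ _ _ _ (span_comp P f u) _ _ c (id2 _)))
    >=> (id2 _ ** assoc _ _ _) >=> assocV _ _ _
  = @hcomp (SpanIso P) _ _ _ _ (span_comp P s f) _ (span_comp P u v) sS sT.
Proof.
move=> cl cr e1 e2 e3 e4; apply: span_cell_ext; rewrite /=.
by apply: pb_ext; apply: pb_ext; spn; rewrite ?cl ?cr; spn.
Qed.

(** * The unit, from a gregarious functor to the gluing of its restrictions *)

Section Unit.

Context {E : Category} (P : ChosenPullbacks E) {C : Bicategory} {F0 : E -> C}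
  (F : Oplax (A := SpanIso P) (B := C) F0)
  (Ht : is_pseudo (F_tens F)) (Hd : is_pseudo (F_delt F))
  (Hs : forall (X Y T : E) (s : chom E T X) (t : chom E T Y),
    is_inv2 (F_split F s t)).

Local Notation B := (greg_beck_of Ht Hd Hs).

Definition delt_cell (X Y Z : E) (p : chom E X Y) (s : chom E Y Z) (a : chom E X Z)
    (e : a = p >> s) : SpanCell (delt_sp a) (span_comp P (delt_sp s) (delt_sp p)) :=
  span_cell_comp (delt_2 e) (delt_phi P p s).

Definition tens_cell (X Y Z : E) (q : chom E X Y) (v : chom E Y Z) (b : chom E X Z)
    (e : b = q >> v) : SpanCell (tens_sp b) (span_comp P (tens_sp q) (tens_sp v)) :=
  span_cell_comp (tens_2 e) (tens_phi P q v).

Lemma greg_split_d (X Y Z : E) (p : chom E X Y) (s : chom E Y Z) (a : chom E X Z)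
    (e : a = p >> s) :
  split_d B e = @o2 _ _ _ F Z X _ _ (delt_cell e)
    >=> phi F (delt_sp s) (delt_sp p).
Proof.
rewrite /delt_cell (@o2_vcomp _ _ _ F Z X _ _ _ (delt_2 e)).
by rewrite vassoc.
Qed.

Lemma greg_split_t (X Y Z : E) (q : chom E X Y) (v : chom E Y Z) (b : chom E X Z)
    (e : b = q >> v) :
  split_t B e = @o2 _ _ _ F X Z _ _ (tens_cell e)
    >=> phi F (tens_sp q) (tens_sp v).
Proof.
rewrite /tens_cell (@o2_vcomp _ _ _ F X Z _ _ _ (tens_2 e)).
by rewrite vassoc.
Qed.

Lemma greg_unit_d (X : E) : unit_d B (eq_refl (cid X)) = lam F X.
Proof. by rewrite unit_dE /= o2_id vidl. Qed.

Lemma greg_unit_t (X : E) : unit_t B (eq_refl (cid X)) = lam F X.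
Proof. by rewrite unit_tE /= o2_id vidl. Qed.

Definition contract_cell (X Y : E) (k : chom E X Y)
    (K : is_pullback (cid Y) (cid Y) k k) :
    SpanCell (span_comp P (delt_sp k) (tens_sp k)) (span_id Y) :=
  span_cell_comp (sq_cell P K) (span_lunit P (span_id Y)).

Lemma greg_contract (X Y : E) (k : chom E X Y) (K : is_pullback (cid Y) (cid Y) k k) :
  phi F (delt_sp k) (tens_sp k) >=> contract B K
  = @o2 _ _ _ F Y Y _ _ (contract_cell K) >=> lam F Y.
Proof.
rewrite /contract greg_unit_d greg_unit_t; apply: (oplax_contract (F := F)).
exact: F_beckE.
Qed.

Definition unit_cell (X Y : E) (S : Span X Y) : hom2 (o1 F S) (glue_1 B S) :=
  @o2 _ _ _ F X Y _ _ (leg_cell P S) >=> phi F (delt_sp (lleg S)) (tens_sp (rleg S)).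

Lemma unit_cell_inv (X Y : E) (S : Span X Y) : is_inv2 (unit_cell S).
Proof.
apply: is_inv2_vcomp; last exact: phi_split_inv.
by apply: is_inv2_o2; exact: span_cell_is_inv2.
Qed.

Lemma unit_cell_nat (X Y : E) (S T : Span X Y) (a : SpanCell S T) :
  @o2 _ _ _ F X Y _ _ a >=> unit_cell T = unit_cell S >=> glue_2 B a.
Proof.
rewrite /glue_2 /iso_cell /spread greg_split_d greg_split_t; symmetry.
refine (@oplax_iso_cell (SpanIso P) C F0 F X (apex T) Y S (apex S) (delt_sp (lleg S))
  (tens_sp (rleg S)) (delt_sp (lleg T)) (delt_sp (sc a)) (tens_sp (sc a))
  (tens_sp (rleg T)) T a (leg_cell P S) (leg_cell P T)
  (delt_cell (eq_sym (sc_l a))) (tens_cell (eq_sym (sc_r a)))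
  (contract_cell (pullback_iso (sc_iso a))) (contract B (pullback_iso (sc_iso a)))
  (greg_contract _) _).
apply: span_cell_ext; rewrite /= !sc_leg_cell.
by apply: pb_ext; spn.
Qed.

Lemma unit_cell_phi (X Y Z : E) (S : Span X Y) (T : Span Y Z) :
  unit_cell (span_comp P S T) >=> glue_phi P B S T
  = @phi _ _ _ F X Y Z S T >=> (unit_cell S ** unit_cell T).
Proof.
rewrite /glue_phi /comp_cell /spread greg_split_d greg_split_t.
refine (@oplax_comp_cell (SpanIso P) C F0 F X (apex S) (apex T) Y Z S T
  (apex (span_comp P S T)) (delt_sp (lleg (span_comp P S T)))
  (tens_sp (rleg (span_comp P S T))) (delt_sp (lleg S))
  (delt_sp (lleg (pb P (rleg S) (lleg T)))) (tens_sp (rleg (pb P (rleg S) (lleg T))))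
  (tens_sp (rleg T)) (tens_sp (rleg S)) (delt_sp (lleg T))
  (leg_cell P (span_comp P S T)) (leg_cell P S) (leg_cell P T)
  (delt_cell eq_refl) (tens_cell eq_refl)
  (sq_cell P (pb_is P (rleg S) (lleg T))) (bk B (pb_is P (rleg S) (lleg T)))
  (F_beckE Hs _) _).
apply: cell_pasting; rewrite ?sc_leg_cell /=; by spn.
Qed.

Lemma unit_cell_lam (X : E) : unit_cell (span_id X) >=> glue_lam B X = lam F X.
Proof.
rewrite /unit_cell /glue_lam greg_unit_d greg_unit_t.
transitivity (@o2 _ _ _ F X X _ _ (span_cell_comp (leg_cell P (span_id X))
  (span_lunit P (span_id X))) >=> lam F X).
  rewrite vassoc (o2_vcomp (A := SpanIso P) F) vassoc; congr (_ >=> _).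
  rewrite -(phi_lunit F (id1 (X : SpanIso P))) hcompE !vassoc lunit_nat.
  by [].
rewrite (_ : span_cell_comp _ _ = span_cell_id (span_id X)) ?o2_id ?vidl //.
by apply: span_cell_ext; rewrite /=; spn.
Qed.

End Unit.

Definition unit_icon (E : Category) (P : ChosenPullbacks E) (C : Bicategory)
    (F0 : E -> C) (F : GregFib P F0) :
  chom (GregFib P F0) F (GlueFib P F0 (TensDeltFib P F0 F)) :=
  @Build_Icon (SpanIso P) C F0 (proj1_sig F) (glue P (TensDeltFib P F0 F))
    (fun X Y S => @unit_cell E P C F0 (proj1_sig F) _ _ _ X Y S)
    (fun X Y S T a => unit_cell_nat _ _ _ a)
    (fun X Y Z S T => unit_cell_phi _ _ _ S T)
    (fun X => unit_cell_lam _ _ _ X).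

Lemma unit_icon_nat (E : Category) (P : ChosenPullbacks E) (C : Bicategory)
    (F0 : E -> C) (F G : GregFib P F0) (a : chom (GregFib P F0) F G) :
  a >> unit_icon G = unit_icon F >> fhom (GlueFib P F0) (fhom (TensDeltFib P F0) a).
Proof.
apply: icon_ext => X Y S /=.
by rewrite /unit_cell -vassoc -ic_nat !vassoc -ic_phi.
Qed.

Lemma unit_icon_is_iso (E : Category) (P : ChosenPullbacks E) (C : Bicategory)
    (F0 : E -> C) (F : GregFib P F0) : is_iso (unit_icon F).
Proof.
have [j [jK jVK]] := icon_is_iso (a := unit_icon F) (fun X Y S => unit_cell_inv _ _ _ S).
by exists j.
Qed.

(** * The equivalences *)

Lemma nat_isomorphic_sym (A B : Category) (F G : Functor A B) :
  nat_isomorphic F G -> nat_isomorphic G F.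
Proof.
move=> [eta [nat iso]].
pose inv X := proj1_sig (constructive_indefinite_description _ (iso X)).
have invP X : eta X >> inv X = cid _ /\ inv X >> eta X = cid _.
  exact: (proj2_sig (constructive_indefinite_description _ (iso X))).
exists inv; split=> [X Y f|X]; last by exists (eta X); have [? ?] := invP X.
rewrite -[LHS]cidl -(proj2 (invP X)) !cassoc; apply: f_equal.
by rewrite -(cassoc (eta X)) -nat cassoc (proj1 (invP Y)) cidr.
Qed.

(** Quasi-inverses are chosen for each index; all functors involved preserve indices, so the natural
    isomorphisms can be taken over [eq_refl]. *)
Lemma total_is_equivalence (I : Type) (D D' : I -> Category)
    (F : forall i, Functor (D i) (D' i)) :
  (forall i, is_equivalence (F i)) -> is_equivalence (TotalFunctor F).
Proof.
move=> eqv.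
pose G i := proj1_sig (constructive_indefinite_description _ (eqv i)).
have GP i : nat_isomorphic (functor_comp (F i) (G i)) (functor_id (D i)) /\
    nat_isomorphic (functor_comp (G i) (F i)) (functor_id (D' i)).
  exact: (proj2_sig (constructive_indefinite_description _ (eqv i))).
have tot (J : I -> Category) (H : forall i, Functor (J i) (J i)) :
    (forall i, nat_isomorphic (H i) (functor_id (J i))) ->
    nat_isomorphic (TotalFunctor H) (functor_id (TotalCat J)).
  move=> iso.
  pose eta i := proj1_sig (constructive_indefinite_description _ (iso i)).
  have etaP i : (forall X Y (f : chom (J i) X Y),
      fhom (H i) f >> eta i Y = eta i X >> f) /\ (forall X, is_iso (eta i X)).
    exact: (proj2_sig (constructive_indefinite_description _ (iso i))).
  exists (fun x => existT _ eq_refl (eta (projT1 x) (projT2 x))).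
  split=> [[i x] [j y] [/= e f]|[i x]].
    by destruct e; rewrite /= (proj1 (etaP i)).
  have [g [gK Kg]] := proj2 (etaP i) x.
  by exists (existT _ eq_refl g); rewrite /= gK Kg.
exists (TotalFunctor G); split.
(* The composite of total functors and the total functor of the composites agree on objects by
   conversion, but on morphisms only after the equality of indices is eliminated. *)
- have [eta [nat iso]] := tot _ _ (fun i => proj1 (GP i)).
  exists eta; split=> // [[i x] [j y] [/= e f]].
  have := nat (existT _ i x) (existT _ j y) (existT _ e f).
  by destruct e.
- have [eta [nat iso]] := tot _ _ (fun i => proj2 (GP i)).
  exists eta; split=> // [[i x] [j y] [/= e f]].
  have := nat (existT _ i x) (existT _ j y) (existT _ e f).
  by destruct e.
Qed.

Lemma functor_ext (A B : Category) (F : A -> B)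
    (h h' : forall X Y, chom A X Y -> chom B (F X) (F Y)) i c i' c' :
  (forall X Y f, h X Y f = h' X Y f) ->
  @Build_Functor A B F h i c = @Build_Functor A B F h' i' c'.
Proof.
move=> e; have {}e : h = h' by do 3 apply: functional_extensionality_dep => ?; exact: e.
by subst h'; f_equal; exact: proof_irrelevance.
Qed.

Lemma tens_delt_fib_equivalence (E : Category) (P : ChosenPullbacks E) (C : Bicategory)
    (F0 : E -> C) : is_equivalence (TensDeltFib P F0).
Proof.
exists (GlueFib P F0); split.
- apply: nat_isomorphic_sym; exists (@unit_icon E P C F0); split=> [F G a|F].
  + exact: unit_icon_nat.
  + exact: unit_icon_is_iso.
- exists (fun B => counit (glue_is_greg P B)); split=> [B B' a|B].
  + exact: counit_nat.
  + exact: counit_is_iso.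
Qed.

Definition GluePseudoFib (E : Category) (P : ChosenPullbacks E) (C : Bicategory)
    (F0 : E -> C) :
  Functor (FullSub (A := LaxBeckPairFib F0) (@is_beck E C F0))
    (FullSub (A := IconFib (A := SpanIso P) (B := C) F0) (@is_pseudo (SpanIso P) C F0)) :=
  @Build_Functor
    (FullSub (A := LaxBeckPairFib F0) (@is_beck E C F0))
    (FullSub (A := IconFib (A := SpanIso P) (B := C) F0) (@is_pseudo (SpanIso P) C F0))
    (fun B => exist _ (glue P (proj1_sig B)) (glue_is_pseudo P (proj2_sig B)))
    (fun B B' a => glue_mor P a)
    (fun B => fhom_id (GlueFib P F0) (proj1_sig B))
    (fun B B' B'' a b => fhom_comp (GlueFib P F0) a b).

Lemma tens_delt_pseudo_fib_equivalence (E : Category) (P : ChosenPullbacks E)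
    (C : Bicategory) (F0 : E -> C) : is_equivalence (full_lift (@pseudo_is_beck E P C F0)).
Proof.
exists (GluePseudoFib P F0); split.
- apply: nat_isomorphic_sym.
  exists (fun F => unit_icon (IconToGregFib P F0 F)); split=> [F G a|F].
  + exact: (unit_icon_nat (F := IconToGregFib P F0 F) (G := IconToGregFib P F0 G) a).
  + exact: (unit_icon_is_iso (IconToGregFib P F0 F)).
- exists (fun B : FullSub (A := LaxBeckPairFib F0) (@is_beck E C F0) =>
    counit (pseudo_greg (glue_is_pseudo P (proj2_sig B)))); split=> [B B' a|B].
  + exact: counit_nat.
  + exact: counit_is_iso.
Qed.

Theorem theorem38 (E : Category) (P : ChosenPullbacks E) (C : Bicategory) :
  is_equivalence (TensDelt P C) /\
  (functor_comp (TensDeltPseudo P C) (BeckIncl E C)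
     = functor_comp (GregIncl P C) (TensDelt P C) /\
   is_equivalence (TensDeltPseudo P C)).
Proof.
split; first by apply: total_is_equivalence; exact: tens_delt_fib_equivalence.
split; last by apply: total_is_equivalence; exact: tens_delt_pseudo_fib_equivalence.
(* The restriction square commutes strictly: on objects by conversion, on morphisms once [e] is
   eliminated. *)
apply: functor_ext => [[F0 F] [G0 G] [/= e a]].
by destruct e.
Qed.
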